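(* If $I\subset(0,1)$ is a closed interval and $f: I\to(0,1)$ is real analytic on $I$, then $f$ has a fast simulation on $I$. Conversely, if $S\subset(0,1)$ and a function $f:S\to[0,1]$ has a fast simulation on $S$, then $f$ is real analytic on any open subset of $S$.
   Context: A function is real analytic on a closed interval $I$ if it is the restriction to $I$ of a (complex) analytic function on some open domain containing $I$. For $p\in[0,1]$ let $\mathbf{P}_p$ be the law of an infinite sequence $X_1,X_2,\ldots$ of i.i.d. $\{0,1\}$-valued random variables (''$p$-coin tosses'') with $\mathbf{P}_p(X_i=1)=p$. An algorithm consists of a stopping time $N$ (values in $\{0,1,2,\ldots\}\cup\{\infty\}$) with respect to the natural filtration of $(X_i)_{i\ge1}$, and a $\{0,1\}$-valued output which, on $\{N<\infty\}$, is a function of $(X_1,\ldots,X_N)$ only; no randomness other than the tosses is used, and the algorithm does not depend on $p$. $N$ is the number of inputs needed. The algorithm simulates a function $f:S\to[0,1]$ on $S\subset[0,1]$ if for every $p\in S$ we have $\mathbf{P}_p(N<\infty)=1$ and $\mathbf{P}_p(\text{output}=1)=f(p)$. A function $f$ has a fast simulation on $S$ if there exists an algorithm which simulates $f$ on $S$ such that for every $p\in S$ there exist constants $C>0$, $\rho<1$ (which may depend on $p$) with $\mathbf{P}_p(N>n)\le C\rho^n$ for all $n$. *)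

(* Defs.v *)
From HB Require Import structures.
From mathcomp Require Import all_boot all_order all_algebra complex ring lra.
From mathcomp Require Import all_classical all_reals all_analysis.
From mathcomp Require Import measurable_realfun.

Set Implicit Arguments.
Unset Strict Implicit.
Unset Printing Implicit Defensive.

Import Order.TTheory GRing.Theory Num.Theory numFieldNormedType.Exports.
Local Open Scope classical_set_scope.
Local Open Scope ring_scope.

(* A sequence of tosses is x : nat -> bool, with [x i] standing for X_{i+1}.  *)
Definition toss (i : nat) (x : nat -> bool) : bool := x i.

Definition toss_events : set (set (nat -> bool)) :=
  \bigcup_i preimage_set_system setT (toss i) setT.

Definition coin_space := g_sigma_algebraType toss_events.

HB.instance Definition _ := Measurable.on coin_space.

Lemma measurable_toss i : measurable_fun setT (toss i : coin_space -> bool).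
Proof.
by move=> _ B _; apply: sub_sigma_algebra; exists i => //; exists B.
Qed.

(* F_n = sigma(X_1, ..., X_n) *)
Definition natural_filtration (n : nat) : set (set coin_space) :=
  g_sigma_preimage (fun i : 'I_n => toss i : coin_space -> bool).

(* [None] encodes N = oo. *)
Definition stopping_time (N : coin_space -> option nat) : Prop :=
  forall n, natural_filtration n [set x | exists2 k, N x = Some k & (k <= n)%N].

(* The output is only defined on {N < oo}: there it is [decide] applied to    *)
(* the word X_1 ... X_N of tosses read so far.                                *)
Record algorithm := Algorithm {
  inputs : coin_space -> option nat ;
  decide : seq bool -> bool ;
  inputs_stopping_time : stopping_time inputs }.

Definition halts (A : algorithm) : set coin_space :=
  [set x | exists n, inputs A x = Some n].

Definition outputs1 (A : algorithm) : set coin_space :=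
  [set x | exists2 n, inputs A x = Some n & decide A (mkseq x n)].

Definition needs_more_than (A : algorithm) (n : nat) : set coin_space :=
  [set x | forall k, inputs A x = Some k -> (n < k)%N].

Section coin_law.
Variable R : realType.
Implicit Types p u : R.

(* Construction of P_p as the image of the uniform law on [0, 1]: a point     *)
(* yields a 1 when it lies below p, and the part of [0, 1] containing it is   *)
(* then rescaled to [0, 1] for the next toss.  By a pi-lambda argument, P_p   *)
(* is characterised, for p in [0, 1], by [coin_law_cylinder] below, where     *)
(* [bernoulli_pmf p b] is p if b and 1 - p otherwise.                         *)
Definition coin_step p u : R := if u < p then u / p else (u - p) / (1 - p).

Definition coin_bits p (u : measurableTypeR R) : coin_space := fun n => iter n (coin_step p) u < p.

Lemma measurable_coin_step p : measurable_fun setT (coin_step p).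
Proof.
apply: measurable_fun_ifT.
- exact: measurable_fun_ltr.
- exact: measurable_funM.
- by apply: measurable_funM => //; exact: measurable_funB.
Qed.

Lemma measurable_coin_bits p : measurable_fun setT (coin_bits p).
Proof.
have mE : @measurable _ coin_space = <<s toss_events >> by [].
have h := @measurability _ _ _ _ [set: measurableTypeR R] (coin_bits p) _ mE.
apply: h => _ [_ [i _ [B _ <-]] <-]; rewrite !setTI.
have mT n : measurable_fun setT (iter n (coin_step p)).
  elim: n => [|n IH]; first exact: measurable_id.
  exact: (measurableT_comp (measurable_coin_step p) IH).
have mi : measurable_fun setT (fun u => iter i (coin_step p) u < p).
  exact: measurable_fun_ltr.
by rewrite -[X in measurable X]setTI; exact: mi.
Qed.

HB.instance Definition _ p :=
  isMeasurableFun.Build _ _ _ _ (coin_bits p) (measurable_coin_bits p).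

Definition coin_law p : probability coin_space R :=
  distribution (uniform_prob (@ltr01 R)) (coin_bits p).

Lemma coin_bits_cylinder p n (w : nat -> bool) : 0 <= p <= 1 ->
  exists a : R, [/\ 0 <= a, a + \prod_(i < n) bernoulli_pmf p (w i) <= 1 &
    forall u, (0 <= u < 1 /\ (forall i, (i < n)%N -> toss i (coin_bits p u) = w i))
      <-> a <= u < a + \prod_(i < n) bernoulli_pmf p (w i)].
Proof.
move=> /andP[p0 p1]; elim: n w => [|n IH] w.
  exists 0; rewrite big_ord0 add0r; split => // u.
  by split => [[]|u01].
have [a [a0 am1 aP]] := IH (fun i => w i.+1).
rewrite big_ord_recl /=; under eq_bigr do rewrite /bump /= add1n.
move: aP am1; set m := \prod_(i < n) _ => aP am1.
have m0 : 0 <= m by apply: prodr_ge0 => i _; rewrite bernoulli_pmf_ge0// p0.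
have bitsS u i : toss i.+1 (coin_bits p u) = toss i (coin_bits p (coin_step p u)).
  by rewrite /toss /coin_bits iterSr.
have recE u : (forall i, (i < n.+1)%N -> toss i (coin_bits p u) = w i) <->
    (u < p) = w 0%N /\ (forall i, (i < n)%N ->
      toss i (coin_bits p (coin_step p u)) = w i.+1).
  split => [H|[H0 H1] [|i]//]; last by rewrite ltnS bitsS; exact: H1.
  by split=> [|i i_n]; [exact: (H 0%N)|rewrite -bitsS; exact: H].
rewrite /bernoulli_pmf; case w0: (w 0%N).
- exists (p * a); split; [exact: mulr_ge0|nra|move=> u].
  rewrite recE w0; split=> [[/andP[u0 u1] [up H]]|/andP[au um]].
    have pgt0 : 0 < p by lra.
    have /aP : 0 <= coin_step p u < 1 /\ (forall i, (i < n)%N ->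
        toss i (coin_bits p (coin_step p u)) = w i.+1).
      split=> //; rewrite /coin_step up divr_ge0//=.
      by rewrite ltr_pdivrMr// mul1r.
    rewrite /coin_step up ler_pdivlMr// ltr_pdivrMr// => /andP[? ?].
    by apply/andP; split; nra.
  have pgt0 : 0 < p by rewrite lt_neqAle p0 andbT; apply/eqP => pE; nra.
  have up : u < p by nra.
  have /aP[_ H] : a <= coin_step p u < a + m.
    rewrite /coin_step up ler_pdivlMr// ltr_pdivrMr//.
    by apply/andP; split; nra.
  by split; [apply/andP; split; nra|rewrite up].
- exists (p + (1 - p) * a); split; [nra|nra|move=> u].
  rewrite recE w0; split=> [[/andP[u0 u1] [up H]]|/andP[au um]].
    have pu : p <= u by rewrite leNgt up.
    have p_lt1 : 0 < 1 - p by lra.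
    have /aP : 0 <= coin_step p u < 1 /\ (forall i, (i < n)%N ->
        toss i (coin_bits p (coin_step p u)) = w i.+1).
      split=> //; rewrite /coin_step up divr_ge0//= ?subr_ge0//.
      by rewrite ltr_pdivrMr// mul1r; lra.
    rewrite /coin_step up ler_pdivlMr// ltr_pdivrMr// => /andP[? ?].
    by apply/andP; split; nra.
  have p_lt1 : 0 < 1 - p.
    rewrite subr_gt0 lt_neqAle p1 andbT; apply/eqP => pE; subst p.
    by move: au um; rewrite subrr !mul0r !addr0; lra.
  have up : (u < p) = false by apply/negbTE; rewrite -leNgt; nra.
  have /aP[_ H] : a <= coin_step p u < a + m.
    rewrite /coin_step up ler_pdivlMr// ltr_pdivrMr//.
    by apply/andP; split; nra.
  by split; [apply/andP; split; nra|rewrite up].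
Qed.

Lemma measurable_cylinder n (w : nat -> bool) :
  measurable [set x : coin_space | forall i, (i < n)%N -> toss i x = w i].
Proof.
rewrite (_ : [set _ | _] = \bigcap_(i < n) (toss i @^-1` [set w i])); last first.
  by apply/seteqP; split => x /= H i /=; exact: H.
apply: bigcap_measurableType => i _.
by rewrite -[X in measurable X]setTI; exact: measurable_toss.
Qed.

Lemma coin_law_cylinder p n (w : nat -> bool) : 0 <= p <= 1 ->
  coin_law p [set x | forall i, (i < n)%N -> toss i x = w i] =
  (\prod_(i < n) bernoulli_pmf p (w i))%:E.
Proof.
move=> p01; have [a [a0 am1 aP]] := coin_bits_cylinder n w p01.
move: am1 aP; set m := \prod_(i < n) _ => am1 aP.
have m0 : 0 <= m by apply: prodr_ge0 => i _; exact: bernoulli_pmf_ge0.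
rewrite /coin_law /= /distribution /pushforward /=.
set E := _ @^-1` _.
have mE : measurable E.
  rewrite -[E]setTI; apply: measurable_coin_bits => //.
  exact: measurable_cylinder.
rewrite /uniform_prob integral_uniform_pdf.
rewrite (eq_integral (fun=> 1%E)); last first.
  by move=> x; rewrite inE /= in_itv /= => -[_ xE];
    rewrite /uniform_pdf xE subr0 invr1.
rewrite integral_cst//=; last exact: measurableI.
rewrite mul1e.
have -> : E `&` `[0, 1] = `[a, a + m[ `|` (E `&` [set 1]).
  apply/seteqP; split => [u [Eu]|u].
    rewrite /= in_itv /= => /andP[u0]; rewrite le_eqVlt => /orP[/eqP u1|u1].
      by right.
    by left; rewrite /= in_itv /=; apply/aP; split => //; rewrite u0.
  rewrite /= in_itv /= => -[/aP[/andP[u0 u1] H]|[Eu u1]].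
    by split=> //; rewrite in_itv /= u0 ltW.
  by split=> //; rewrite u1 in_itv /= ler01 lexx.
rewrite measureU0//.
- apply: etrans (lebesgue_measure_itv `[a, a + m[%R) _; rewrite /= lte_fin ltrDl.
  case: ifPn => [_|]; first by rewrite -EFinD addrC addKr.
  by rewrite -leNgt => m_le0; congr (_%:E); apply/eqP; rewrite eq_le m0 m_le0.
- exact: measurableI.
- apply/eqP; rewrite -measure_le0.
  have <- : lebesgue_measure [set 1 : R] = 0%E by exact: lebesgue_measure_set1.
  by apply: le_measure; rewrite ?inE//; exact: measurableI.
Qed.

End coin_law.

Definition simulates (R : realType) (A : algorithm) (S : set R) (f : R -> R) :
    Prop :=
  forall p, S p ->
    coin_law p (halts A) = 1%E /\ coin_law p (outputs1 A) = (f p)%:E.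

Definition fast_simulation (R : realType) (S : set R) (f : R -> R) : Prop :=
  exists A : algorithm, simulates A S f /\
    forall p, S p -> exists C rho : R, [/\ 0 < C, rho < 1 &
      forall n, (coin_law p (needs_more_than A n) <= (C * rho ^+ n)%:E)%E].

(* g is the sum of a convergent power series on a neighbourhood of z0; the    *)
(* topology of C is carried by [R[i]^o].                                      *)
Definition analytic_at (R : realType) (g : R[i]^o -> R[i]^o) (z0 : R[i]^o) :
    Prop :=
  exists c : nat -> R[i]^o, \forall z \near z0,
    series (fun n => c n * (z - z0) ^+ n) @ \oo --> g z.

(* D is not asked to be connected, so that I may be any set, in particular a  *)
(* disconnected open set.  When I is an interval, this makes no difference:   *)
(* restrict g to the component of D containing I.                             *)
Definition real_analytic_on (R : realType) (I : set R) (f : R -> R) : Prop :=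
  exists (D : set R[i]^o) (g : R[i]^o -> R[i]^o),
    [/\ open D, forall x, I x -> D x%:C%C,
        forall z, D z -> analytic_at g z &
        forall x, I x -> g x%:C%C = (f x)%:C%C].

(* Main.v *)
From HB Require Import structures.
Require Import Defs.
From mathcomp Require Import all_boot all_order all_algebra complex.
From mathcomp Require Import all_classical all_reals all_analysis.
From mathcomp Require Import ring lra zify.
Import Order.TTheory GRing.Theory Num.Theory numFieldNormedType.Exports.
Local Open Scope classical_set_scope.
Local Open Scope ring_scope.
Set Implicit Arguments.
Unset Strict Implicit.
Unset Printing Implicit Defensive.

(** Why the theorem is true.

    Fast simulation forces analyticity.  Let O n be the set of words of length
    n on which an algorithm stops and outputs 1.  Then f p is the sum over n of
    g_n p, where g_n z is the sum over O n of the products of factors z (for a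
    toss 1) and 1 - z (for a toss 0).  When z is moved into the complex plane,
    each factor grows by at most 1 + |z - p| / m with m = min (p, 1 - p), so
    |g_n z| is at most (1 + |z - p| / m)^n g_n p, and g_n p decays
    exponentially.  This bound even holds for the sum of the moduli of the
    Taylor terms of g_n at any centre close to p, whence the double series may
    be interchanged into one power series ([words_weight_analytic]).

    Analyticity gives a fast simulation.  Since words with the same number of
    ones are equally likely, an algorithm may be specified by the number of words
    of length n with k ones on which it has already decided 1, respectively 0.
    The only constraints are that these counts dominate what the Pascal rule
    inherits from length n - 1, and that they do not overlap ([count_decision]).
    Dividing by binomial coefficients and rounding, one needs real envelopes
    0 <= lo <= hi <= 1 on the lattice of pairs (n, k), with lo at least, and hi
    at most, its average [avg] over the two parents of (n, k); the probability
    of being undecided is then the Bernstein polynomial of hi - lo, up to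
    rounding, which costs an exponentially small probability
    ([bernstein_envelope_fast_simulation]).

    The average [avg] is the degree elevation rule of Bernstein coefficients,
    so the coefficients of a fixed polynomial are exactly invariant under it
    ([bcoef_avg]).  For an analytic f the lattice point (n, k) receives the
    degree n Bernstein coefficient of the Taylor polynomial of f at k / n,
    truncated at degree n / q with q large and fixed ([local_coef]).  The
    coefficient of (X - y)^j is of size at most s^j near y, as long as
    j <= n / q ([bcoef_centered_bound]); hence replacing the centre by that of
    a neighbour, or the degree n / q by that of the next row, changes the value
    by an exponentially small amount only ([taylor_poly_change_center]), and
    the array is invariant up to such an error ([local_coef_avg]), while it
    tracks f up to O(1/n) ([local_coef_approx]).

    This array exists only near [a, b].  Farther away it is blended into the
    constant 1/2 by a cutoff with Lipschitz derivative, at the price of an error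
    O(1/n^2) in the average rule, away from [a, b] only ([blended_avg]).  The
    envelopes are the blended array plus and minus a margin
    D th^n + (E / n) w (k / n), where w is convex, vanishes near [a, b] and is
    positive where the blending takes place: by Jensen the average of the
    margin exceeds the next margin by a multiple of th^n + w / n^2, which
    absorbs both errors ([margin_avg]).  For p in [a, b] the point k / n is
    exponentially unlikely to leave the zone where w vanishes ([bern_tail]), so
    the gap has an exponentially small expectation. *)

(** * Words and the events read off finitely many tosses *)

Fixpoint words (n : nat) : seq (seq bool) :=
  if n is m.+1 then
    [seq rcons u true | u <- words m] ++ [seq rcons u false | u <- words m]
  else [:: [::]].

Lemma mem_words n w : (w \in words n) = (size w == n).
Proof.
elim: n w => [|n IH] w; first by rewrite inE size_eq0.
rewrite /= mem_cat; apply/orP/eqP => [[]/mapP[u]|].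
- by rewrite IH => /eqP <- ->; rewrite size_rcons.
- by rewrite IH => /eqP <- ->; rewrite size_rcons.
case/lastP: w => [//|u b]; rewrite size_rcons => -[un].
by case: b; [left|right]; apply: map_f; rewrite IH un.
Qed.

Lemma words_uniq n : uniq (words n).
Proof.
elim: n => [//|n IH] /=; rewrite cat_uniq !map_inj_uniq ?IH //=.
- rewrite andbT; apply/hasPn => _ /mapP[u _ ->]; apply/mapP => -[v _].
  by move/rcons_inj.
- by move=> u v /rcons_inj[].
- by move=> u v /rcons_inj[].
Qed.

(** Over an arbitrary ring, so that the probability of a word and its analytic
    continuation to complex parameters are the same expression. *)
Definition word_prob (K : pzRingType) (z : K) (w : seq bool) : K :=
  \prod_(b <- w) (if b then z else 1 - z).

Lemma word_prob_ge0 (R : realDomainType) (p : R) w :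
  0 <= p <= 1 -> 0 <= word_prob p w.
Proof.
move=> /andP[p0 p1]; apply: prodr_ge0 => -[] _ //.
by rewrite subr_ge0.
Qed.

Section prefix_events.

Lemma eq_mkseq (x y : nat -> bool) n :
  mkseq x n = mkseq y n <-> forall i, (i < n)%N -> x i = y i.
Proof.
split=> [xy i i_n|xy]; first by rewrite -(nth_mkseq false x i_n) xy nth_mkseq.
by apply: (@eq_from_nth _ false); rewrite !size_mkseq // => i i_n;
   rewrite !nth_mkseq // xy.
Qed.

Lemma mkseq_nth_size (w : seq bool) n : size w = n -> mkseq (nth false w) n = w.
Proof. by move=> <-; exact: mkseq_nth. Qed.

Lemma mkseqS_take (x : nat -> bool) n m : (n <= m)%N ->
  take n (mkseq x m) = mkseq x n.
Proof.
move=> nm; rewrite /mkseq -map_take; congr map.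
by rewrite take_iota; congr iota; exact/minn_idPl.
Qed.

Definition prefix_event n (P : pred (seq bool)) : set coin_space :=
  [set x | P (mkseq x n)].

Lemma prefix_event1 n (w : seq bool) : size w = n ->
  prefix_event n (pred1 w) =
  [set x | forall i, (i < n)%N -> toss i x = nth false w i].
Proof.
move=> wn; apply/seteqP; split => x /=.
  by move/eqP => xw i i_n; rewrite -xw nth_mkseq.
move=> H; apply/eqP; rewrite -(mkseq_nth_size wn); apply/eq_mkseq => i i_n.
by rewrite -H.
Qed.

Lemma prefix_eventE n P : prefix_event n P =
  \big[setU/set0]_(w <- words n | P w) prefix_event n (pred1 w).
Proof.
rewrite -bigcup_seq_cond; apply/seteqP; split => x.
  rewrite /prefix_event /= => Px; exists (mkseq x n) => /=; last exact: eqxx.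
  by rewrite mem_words size_mkseq eqxx.
by move=> [w /= /andP[_ Pw]]; rewrite /prefix_event /= => /eqP ->.
Qed.

Lemma measurable_prefix_event n P : measurable (prefix_event n P).
Proof.
rewrite prefix_eventE big_seq_cond; apply: bigsetU_measurable => w /andP[].
rewrite mem_words => /eqP wn _.
by rewrite prefix_event1 //; exact: measurable_cylinder.
Qed.

Lemma coin_law_prefix_event (R : realType) (p : R) n P : 0 <= p <= 1 ->
  coin_law p (prefix_event n P) = (\sum_(w <- words n | P w) word_prob p w)%:E.
Proof.
move=> p01.
suff H s : uniq s -> {subset s <= words n} ->
    coin_law p (prefix_event n [pred w | P w & w \in s]) =
    (\sum_(w <- s | P w) word_prob p w)%:E.
  rewrite -(H (words n)) ?words_uniq //; congr (coin_law p _).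
  by apply/seteqP; split => x;
    rewrite /prefix_event /= mem_words size_mkseq eqxx andbT.
elim: s => [|w s IH] /=.
  rewrite big_nil => _ _; rewrite (_ : prefix_event _ _ = set0) ?measure0 //.
  by rewrite /prefix_event; apply/seteqP; split => x //=; rewrite andbF.
move=> /andP[ws us] sub; rewrite big_cons.
have {}IH := IH us (fun x xs => sub x (mem_behead (s := w :: s) xs)).
have /eqP wn : size w == n by rewrite -mem_words sub // mem_head.
case: ifPn => Pw; last first.
  rewrite -IH; congr (coin_law p _); rewrite /prefix_event; apply/seteqP; split => x /=.
    rewrite inE => /andP[Px /orP[/eqP xw|->]]; last by rewrite Px.
    by rewrite xw (negbTE Pw) in Px.
  by rewrite inE => /andP[-> ->]; rewrite orbT.
have -> : prefix_event n [pred w0 | P w0 & w0 \in w :: s] =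
    prefix_event n (pred1 w) `|` prefix_event n [pred w | P w & w \in s].
  rewrite /prefix_event; apply/seteqP; split => x /=.
    by rewrite inE => /andP[Px /orP[/eqP xw|xs]];
      [left; apply/eqP|right; rewrite Px].
  by rewrite inE; case=> [/eqP ->|/andP[-> ->]]; rewrite ?eqxx ?Pw ?orbT.
have dis : prefix_event n (pred1 w) `&`
    prefix_event n [pred w | P w & w \in s] = set0.
  rewrite /prefix_event; apply/seteqP; split => x //= -[/eqP ->].
  by rewrite (negbTE ws) andbF.
apply: etrans (measureU (coin_law p) (measurable_prefix_event n (pred1 w))
  (measurable_prefix_event n [pred w | P w & w \in s]) dis) _.
rewrite EFinD -IH; congr (_ + _)%E.
rewrite prefix_event1 //; apply: etrans (coin_law_cylinder _ _ p01) _.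
congr (_%:E).
rewrite /word_prob (big_nth false) big_mkord wn.
by apply: eq_bigr => i _; rewrite /bernoulli_pmf.
Qed.

(** The prefix events form a sigma-algebra containing the generators of F_n,
    and conversely are finite unions of cylinders; so measurability with respect
    to F_n turns into a combinatorial condition on words. *)
Lemma natural_filtrationP n (B : set coin_space) :
  natural_filtration n B <-> exists P, B = prefix_event n P.
Proof.
split.
  pose G : set (set coin_space) := [set B | exists P, B = prefix_event n P].
  apply: (smallest_sub (X := G)).
    split=> [|_ [P ->]|F FG].
    - by exists xpred0; apply/seteqP; split => x.
    - by exists (predC P); rewrite /prefix_event; apply/seteqP; split => x /=;
        [move=> [_ H]; apply/negP|move/negP].
    - have [Q FQ] := choice FG.
      exists (fun w => `[< exists i, Q i w >]).
      rewrite /prefix_event; apply/seteqP; split => x /=.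
        by move=> [i _]; rewrite FQ => Qx; apply/asboolP; exists i.
      by move=> /asboolP[i Qx]; exists i => //; rewrite FQ.
  move=> A; rewrite -bigcup_seq => -[/= i _ [C _ <-]].
  exists (fun w => nth false w i \in C).
  rewrite setTI; apply/seteqP; split => x; rewrite /prefix_event /= nth_mkseq //.
    by rewrite inE.
  by rewrite inE.
move=> [P ->]; rewrite /natural_filtration /g_sigma_preimage.
set G := \big[setU/set0]_(i < n) _.
pose T := g_sigma_algebraType G.
suff : measurable (prefix_event n P : set T) by [].
rewrite prefix_eventE big_seq_cond; apply: bigsetU_measurable => w /andP[].
rewrite mem_words => /eqP wn _.
have -> : prefix_event n (pred1 w) =
    \bigcap_(i in [set: 'I_n]) [set x : coin_space | toss i x = nth false w i].
  rewrite prefix_event1 //; rewrite /prefix_event; apply/seteqP; split => x /= H.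
    by move=> i _; exact: H.
  by move=> i i_n; exact: (H (Ordinal i_n)).
apply: (@fin_bigcap_measurable _ T); first exact: finite_finset.
move=> i _; apply: sub_sigma_algebra.
rewrite /G -bigcup_seq; exists i; first by rewrite /= mem_index_enum.
by exists [set nth false w i] => //; rewrite setTI.
Qed.

End prefix_events.

Section halting_events.
Variable A : algorithm.

Definition halted_by n : set coin_space :=
  [set x | exists2 k, inputs A x = Some k & (k <= n)%N].

Lemma halted_by_prefix n : exists P, halted_by n = prefix_event n P.
Proof. by apply/natural_filtrationP; exact: inputs_stopping_time. Qed.

Lemma measurable_halted_by n : measurable (halted_by n).
Proof. by have [P ->] := halted_by_prefix n; exact: measurable_prefix_event. Qed.

Lemma needs_more_thanE n : needs_more_than A n = ~` halted_by n.
Proof.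
apply/seteqP; split => x.
  by move=> H [k xk]; rewrite leqNgt (H _ xk).
by move=> H k xk; rewrite ltnNge; apply/negP => kn; apply: H; exists k.
Qed.

End halting_events.

(** * Dominated series *)

Section series_lemmas.
Variable R : realType.
Implicit Types (u v B : nat -> R).

Lemma cvgn_sum (I : Type) (r : seq I) (f : I -> nat -> R) (l : I -> R) :
  (forall i, f i @ \oo --> l i) ->
  (fun n => \sum_(i <- r) f i n) @ \oo --> \sum_(i <- r) l i.
Proof.
move=> fl; elim: r => [|i r IH].
  rewrite big_nil; under eq_fun do rewrite big_nil; exact: cvg_cst.
by rewrite big_cons; under eq_fun do rewrite big_cons; exact: cvgD.
Qed.

Lemma dominated_series_cvg v B :
  (forall n, `|v n| <= B n) -> cvgn (series B) -> cvgn (series v).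
Proof.
move=> vB cB; apply: normed_cvg; apply: series_le_cvg cB => n //=.
by apply: le_trans _ (vB n).
Qed.

Lemma dominated_series_tail v B N :
  (forall n, `|v n| <= B n) -> cvgn (series B) ->
  `|limn (series v) - series v N| <= limn (series B) - series B N.
Proof.
move=> vB cB; have cv := dominated_series_cvg vB cB.
have h : (fun M => `|series v M - series v N|) @ \oo -->
    `|limn (series v) - series v N|.
  by apply: cvg_norm; apply: cvgB => //; exact: cvg_cst.
have h' : (fun M => series B M - series B N) @ \oo -->
    limn (series B) - series B N.
  by apply: cvgB => //; exact: cvg_cst.
rewrite -(cvg_lim _ h) // -(cvg_lim _ h') //.
apply: ler_lim; [by apply: cvgP h|by apply: cvgP h'|].
exists N => // M /= NM; rewrite !sub_series_geq //.
apply: le_trans (ler_norm_sum _ _ _) _.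
by apply: ler_sum => i _.
Qed.

Lemma geometric_dominated_cvg v (K t : R) : 0 <= t < 1 ->
  (forall n, `|v n| <= K * t ^+ n) -> cvgn (series v).
Proof.
move=> /andP[t0 t1] vK.
apply: (@dominated_series_cvg _ (geometric K t)) => //.
by apply: is_cvg_geometric_series; rewrite ger0_norm.
Qed.

(** The tail estimate behind every truncation of a power series below; taking
    N = 0 bounds the sum, taking N = 1 bounds its deviation from the constant
    term. *)
Lemma geometric_dominated_lim v (K t : R) N : 0 <= t < 1 ->
  (forall n, `|v n| <= K * t ^+ n) ->
  `|limn (series v) - series v N| <= K * t ^+ N / (1 - t).
Proof.
move=> /andP[t0 t1] vK; have nt1 : `|t| < 1 by rewrite ger0_norm.
apply: le_trans (dominated_series_tail N vK _) _.
  exact: (@is_cvg_geometric_series _ K t).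
rewrite (cvg_lim _ (@cvg_geometric_series _ K t nt1)) //.
have : series (fun n => K * t ^+ n) N = K * (1 - t ^+ N) / (1 - t).
  have /(@geometric_seriesE _ K)/(congr1 (fun f => f N)) : t != 1 by rewrite lt_eqF.
  by [].
move=> ->; rewrite le_eqVlt; apply/orP; left; apply/eqP.
by field; rewrite subr_eq0 gt_eqF.
Qed.

(** Tannery's theorem: the terms beyond a fixed N contribute at most a tail of
    the dominating series, uniformly in J, and the others are finitely many. *)
Lemma tannery (a : nat -> nat -> R) (l B : nat -> R) :
  (forall n J, `|a n J| <= B n) -> cvgn (series B) ->
  (forall n, a n @ \oo --> l n) ->
  (fun J => limn (series (fun n => a n J))) @ \oo --> limn (series l).
Proof.
move=> aB cB al.
have lB n : `|l n| <= B n.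
  have h : (fun J => `|a n J|) @ \oo --> `|l n| by apply: cvg_norm; exact: al.
  rewrite -(cvg_lim _ h) //; apply: limr_le; first exact: cvgP h.
  by near=> J; exact: aB.
apply/cvgrPdist_lt => e e0.
have e4 : 0 < e / 4 by rewrite divr_gt0.
have /cvgrPdist_lt/(_ _ e4)[N _ /(_ N (leqnn N)) HN] :
  series B @ \oo --> limn (series B) by [].
have {HN} HN : limn (series B) - series B N < e / 4.
  by apply: le_lt_trans HN; exact: ler_norm.
have cN : (fun J => series (fun n => a n J) N) @ \oo --> series l N.
  by rewrite /series /=; apply: cvgn_sum.
move/cvgrPdist_lt : cN => /(_ _ e4) cN.
near=> J.
have H1 := le_lt_trans (dominated_series_tail N lB cB) HN.
have H2 := le_lt_trans (dominated_series_tail N (aB^~ J) cB) HN.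
have H3 : `|series l N - series (fun n => a n J) N| < e / 4 by near: J.
move: H1 H2 H3; rewrite !ltr_norml => /andP[? ?] /andP[? ?] /andP[? ?].
by apply/andP; split; lra.
Unshelve. all: by end_near.
Qed.

(** The partial sums over j of the double series are, for each J, the sum over
    n of the truncated rows; Tannery's theorem lets J tend to infinity. *)
Lemma series_interchange (a b : nat -> nat -> R) (A B : nat -> R) :
  (forall n j, `|a n j| <= b n j) -> (forall n J, series (b n) J <= B n) ->
  cvgn (series B) -> (forall n, series (a n) @ \oo --> A n) ->
  (forall j, cvgn (series (a ^~ j))) /\
  series (fun j => limn (series (a ^~ j))) @ \oo --> limn (series A).
Proof.
move=> ab bB cB aA.
have b0 n j : 0 <= b n j by apply: le_trans _ (ab n j).
have aB n j : `|a n j| <= B n.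
  apply: le_trans (ab n j) _; apply: le_trans (bB n j.+1).
  rewrite /series /= big_nat_recr //= lerDr; exact: sumr_ge0.
have ca j : cvgn (series (a ^~ j)) by exact: dominated_series_cvg cB.
split=> //.
suff -> : series (fun j => limn (series (a ^~ j))) =
    (fun J => limn (series (fun n => series (a n) J))).
  apply: tannery cB aA => n J; apply: le_trans (bB n J).
  apply: le_trans (ler_norm_sum _ _ _) _.
  by apply: ler_sum => i _.
apply/funext => J; rewrite [LHS]/series /=.
apply/esym/cvg_lim => //.
rewrite (_ : series _ = fun N => \sum_(0 <= j < J) series (a ^~ j) N).
  exact: cvgn_sum.
by apply/funext => N; rewrite /series /= exchange_big.
Qed.

End series_lemmas.

(** * Complex series and majorants *)

Section complex_modulus.
Variable R : realType.
Implicit Types (x y z : R[i]).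

(** The norm of a complex number is itself complex; this is its real value. *)
Definition modc z : R := complex.Re `|z|.

Lemma modcE z : `|z| = (modc z)%:C%C.
Proof. by rewrite /modc normc_def. Qed.

Lemma modcM x y : modc (x * y) = modc x * modc y.
Proof. by apply: complexI; rewrite rmorphM /= -!modcE normrM. Qed.

Lemma modcX x n : modc (x ^+ n) = modc x ^+ n.
Proof. by apply: complexI; rewrite rmorphXn /= -!modcE normrX. Qed.

Lemma modcD x y : modc (x + y) <= modc x + modc y.
Proof. by rewrite -lecR rmorphD /= -!modcE ler_normD. Qed.

Lemma modc_ge0 x : 0 <= modc x.
Proof. by rewrite -ler0c -modcE. Qed.

Lemma modcN x : modc (- x) = modc x.
Proof. by apply: complexI; rewrite -!modcE normrN. Qed.

Lemma modc_real (a : R) : modc a%:C%C = `|a|.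
Proof.
by rewrite /modc normc_def /= expr0n addr0 sqrtr_sqr.
Qed.

Lemma Re_le_modc x : `|complex.Re x| <= modc x.
Proof. by rewrite -lecR -modcE normc_ge_Re. Qed.

Lemma Im_le_modc x : `|complex.Im x| <= modc x.
Proof.
rewrite -normrN -ReiNIm (le_trans (Re_le_modc _)) // modcM.
suff -> : modc ('i%C : R[i]) = 1 by rewrite mulr1.
by rewrite /modc normc_def /= expr0n add0r expr1n sqrtr1.
Qed.

Lemma modc_le_ReIm x : modc x <= `|complex.Re x| + `|complex.Im x|.
Proof.
rewrite {1}[x]complexE (le_trans (modcD _ _)) // modcM !modc_real.
suff -> : modc ('i%C : R[i]) = 1 by rewrite mul1r.
by rewrite /modc normc_def /= expr0n add0r expr1n sqrtr1.
Qed.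

Lemma cvg_complexP (u : nat -> R[i]^o) (l : R[i]^o) :
  u @ \oo --> l <->
  ((fun n => complex.Re (u n)) @ \oo --> complex.Re l /\
   (fun n => complex.Im (u n)) @ \oo --> complex.Im l).
Proof.
split=> [/cvgrPdist_lt ul|[/cvgrPdist_lt ul1 /cvgrPdist_lt ul2]].
  split; apply/cvgrPdist_lt => e e0; have /ul : 0 < e%:C%C :> R[i] by rewrite ltcR.
    apply: filterS => n; rewrite modcE ltcR; apply: le_lt_trans.
    by rewrite -raddfB; exact: Re_le_modc.
  apply: filterS => n; rewrite modcE ltcR; apply: le_lt_trans.
  by rewrite -raddfB; exact: Im_le_modc.
apply/cvgrPdist_lt => -[e e'].
rewrite ltcE /= => /andP[/eqP -> e0].
have e2 : 0 < e / 2 by rewrite divr_gt0.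
apply: filterS2 (ul1 _ e2) (ul2 _ e2) => n h1 h2.
rewrite modcE ltcR; apply: le_lt_trans (modc_le_ReIm _) _.
by rewrite !raddfB /= [e]splitr ltrD.
Qed.

End complex_modulus.

Section complex_balls.
Variable R : realType.

Lemma near_modcP (z0 : R[i]^o) (P : set R[i]^o) :
  (\forall z \near z0, P z) <->
  exists2 r : R, 0 < r & forall z, modc (z - z0) < r -> P z.
Proof.
split=> [/nbhs_normP[[e e']]|[r r0 H]].
  rewrite /= ltcE /= => /andP[/eqP -> e0] H; exists e => // z zr.
  by apply: H => /=; rewrite distrC modcE ltcR.
apply/nbhs_normP; exists r%:C%C; first by rewrite /= ltcR.
by move=> z /=; rewrite distrC modcE ltcR; exact: H.
Qed.

Lemma series_coef_horner (K : numFieldType) (P : {poly K}) (h : K) J :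
  (size P <= J)%N -> series (fun j => P`_j * h ^+ j) J = P.[h].
Proof.
move=> PJ; rewrite /series /= (@horner_coef_wide _ J) //.
by rewrite big_mkord.
Qed.

Lemma series_coef_le (P : {poly R}) (h : R) J : 0 <= h -> (forall j, 0 <= P`_j) ->
  series (fun j => P`_j * h ^+ j) J <= P.[h].
Proof.
move=> h0 P0; rewrite -(@series_coef_horner R P h (maxn J (size P))); last first.
  exact: leq_maxr.
rewrite -subr_ge0 sub_series_geq ?leq_maxl //.
by apply: sumr_ge0 => j _; rewrite mulr_ge0 // exprn_ge0.
Qed.

(** Cauchy's majorant method: majorants are stable under sums and products and
    bound all Taylor coefficients at once. *)
Definition majorant (P : {poly R[i]}) (Q : {poly R}) :=
  forall j, modc P`_j <= Q`_j.

Lemma majorant_ge0 P Q : majorant P Q -> forall j, 0 <= Q`_j.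
Proof. by move=> PQ j; apply: le_trans (PQ j); exact: modc_ge0. Qed.

Lemma majorantD P Q P' Q' :
  majorant P Q -> majorant P' Q' -> majorant (P + P') (Q + Q').
Proof.
move=> PQ PQ' j; rewrite !coefD (le_trans (modcD _ _)) //.
exact: lerD.
Qed.

Lemma modc_sum (I : Type) (r : seq I) (P : pred I) (F : I -> R[i]) :
  modc (\sum_(i <- r | P i) F i) <= \sum_(i <- r | P i) modc (F i).
Proof.
elim/big_ind2 : _ => [|x y z t xy zt|//].
  by rewrite -[0]/(0%:C%C) modc_real normr0.
by rewrite (le_trans (modcD _ _)) // lerD.
Qed.

Lemma majorantM P Q P' Q' :
  majorant P Q -> majorant P' Q' -> majorant (P * P') (Q * Q').
Proof.
move=> PQ PQ' j; rewrite !coefM (le_trans (modc_sum _ _ _)) //.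
apply: ler_sum => i _; rewrite modcM; apply: ler_pM => //; exact: modc_ge0.
Qed.

Lemma majorant0 : majorant 0 0.
Proof. by move=> j; rewrite !coef0 -[0]/(0%:C%C) modc_real normr0. Qed.

Lemma majorant1 : majorant 1 1.
Proof.
move=> j; rewrite !coef1 -[_%:R in X in X <= _](rmorph_nat (real_complex R)).
by rewrite modc_real ger0_norm.
Qed.

Lemma majorant_affine (c d : R[i]) : modc d <= 1 ->
  majorant (c%:P + d *: 'X) ((modc c)%:P + 'X).
Proof.
have modc0 : modc (0 : R[i]) = 0 by rewrite -[0]/(0%:C%C) modc_real normr0.
move=> d1 j; rewrite !coefD coefZ !coefC !coefX; case: j => [|[|j]] /=.
- by rewrite mulr0 !addr0.
- by rewrite mulr1 !add0r.
- by rewrite mulr0 !addr0 modc0.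
Qed.

(** The Taylor expansion at z0 of the weight of a word. *)
Definition word_poly (z0 : R[i]) (w : seq bool) : {poly R[i]} :=
  \prod_(b <- w) (if b then z0%:P + 1 *: 'X else (1 - z0)%:P + (-1) *: 'X).

Definition word_maj (z0 : R[i]) (w : seq bool) : {poly R} :=
  \prod_(b <- w) (if b then (modc z0)%:P + 'X else (modc (1 - z0))%:P + 'X).

Lemma word_poly_majorant z0 w : majorant (word_poly z0 w) (word_maj z0 w).
Proof.
rewrite /word_poly /word_maj; elim/big_ind2 : _ => [||[] _].
- exact: majorant1.
- by move=> *; exact: majorantM.
- apply: majorant_affine; by rewrite -[1]/(1%:C%C) modc_real normr1.
- apply: majorant_affine; by rewrite modcN -[1]/(1%:C%C) modc_real normr1.
Qed.

Lemma horner_word_poly z0 w h : (word_poly z0 w).[h] = word_prob (z0 + h) w.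
Proof.
rewrite /word_poly /word_prob horner_prod; apply: eq_bigr => -[] _.
  by rewrite !hornerE.
by rewrite !hornerE /=; ring.
Qed.

(** A factor of the majorant is at most p + |z0 - p| + r for a toss 1, and
    1 - p + |z0 - p| + r for a toss 0, that is, at most
    1 + (|z0 - p| + r) / m times its value p or 1 - p. *)
Lemma horner_word_maj_le (p r : R) z0 w m : 0 < m -> m <= p -> m <= 1 - p ->
  0 <= r ->
  (word_maj z0 w).[r] <=
  word_prob p w * (1 + (modc (z0 - p%:C%C) + r) / m) ^+ size w.
Proof.
move=> m0 mp mq r0; rewrite /word_maj /word_prob horner_prod.
set t := _ / m.
have tE : modc (z0 - p%:C%C) + r = m * t by rewrite /t mulrCA divff ?mulr1 ?gt_eqF.
have t0 : 0 <= t by rewrite divr_ge0 ?addr_ge0 ?modc_ge0 // ltW.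
have Hw w' : 0 <= \prod_(b <- w') ((if b then (modc z0)%:P + 'X
    else (modc (1 - z0))%:P + 'X) : {poly R}).[r].
  by apply: prodr_ge0 => -[] _; rewrite !hornerE addr_ge0 // modc_ge0.
elim: w => [|b w IH]; first by rewrite !big_nil mul1r.
rewrite !big_cons /= exprS mulrACA; apply: ler_pM => //.
  by case: b; rewrite !hornerE addr_ge0 // modc_ge0.
case: b; rewrite !hornerE.
  have : modc z0 <= p + modc (z0 - p%:C%C).
    have p0 : 0 <= p by apply: le_trans mp; exact: ltW.
    rewrite -{1}(subrK p%:C%C z0) addrC (le_trans (modcD _ _)) //.
    by rewrite modc_real ger0_norm.
  by nra.
have : modc (1 - z0) <= (1 - p) + modc (z0 - p%:C%C).
  have q0 : 0 <= 1 - p by apply: le_trans mq; exact: ltW.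
  have -> : 1 - z0 = (1 - p)%:C%C - (z0 - p%:C%C).
    by rewrite rmorphB /= rmorph1; ring.
  rewrite (le_trans (modcD _ _)) // modcN.
  by rewrite modc_real ger0_norm.
by nra.
Qed.

Lemma Re_sum (I : Type) (r : seq I) (P : pred I) (F : I -> R[i]) :
  complex.Re (\sum_(i <- r | P i) F i) = \sum_(i <- r | P i) complex.Re (F i).
Proof. exact: raddf_sum. Qed.

Lemma Im_sum (I : Type) (r : seq I) (P : pred I) (F : I -> R[i]) :
  complex.Im (\sum_(i <- r | P i) F i) = \sum_(i <- r | P i) complex.Im (F i).
Proof. exact: raddf_sum. Qed.

Lemma complexM_ReIm (x y : R[i]) :
  (complex.Re (x * y) = complex.Re x * complex.Re y - complex.Im x * complex.Im y)
  * (complex.Im (x * y) = complex.Re x * complex.Im y + complex.Im x * complex.Re y).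
Proof. by case: x => a b; case: y => c d. Qed.

(** The sum is taken on real and imaginary parts, where the results on dominated
    real series apply. *)
Definition csum (u : nat -> R[i]) : R[i] :=
  Complex (limn (series (fun n => complex.Re (u n))))
          (limn (series (fun n => complex.Im (u n)))).

Lemma csumM (u : nat -> R[i]) (c : R[i]) (B : nat -> R) :
  (forall n, modc (u n) <= B n) -> cvgn (series B) ->
  csum (fun n => u n * c) = csum u * c.
Proof.
move=> uB cB.
have cr : cvgn (series (fun n => complex.Re (u n))).
  by apply: dominated_series_cvg cB => n; apply: le_trans (Re_le_modc _) (uB n).
have ci : cvgn (series (fun n => complex.Im (u n))).
  by apply: dominated_series_cvg cB => n; apply: le_trans (Im_le_modc _) (uB n).
rewrite /csum [_ * c]/GRing.mul /=; case: c => a b /=; congr Complex.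
  apply: cvg_lim => //.
  rewrite (_ : series _ = fun N => series (fun n => complex.Re (u n)) N * a -
     series (fun n => complex.Im (u n)) N * b).
    by apply: cvgB; apply: cvgMr_tmp.
  apply/funext => N; rewrite /series /= !mulr_suml -sumrB; apply: eq_bigr => i _.
  by rewrite complexM_ReIm.
apply: cvg_lim => //.
rewrite (_ : series _ = fun N => series (fun n => complex.Re (u n)) N * b +
   series (fun n => complex.Im (u n)) N * a).
  by apply: cvgD; apply: cvgMr_tmp.
apply/funext => N; rewrite /series /= !mulr_suml -big_split; apply: eq_bigr => i _.
by rewrite complexM_ReIm.
Qed.

Lemma csum_interchange (a : nat -> nat -> R[i]) (b : nat -> nat -> R)
    (A : nat -> R[i]) (B : nat -> R) :
  (forall n j, modc (a n j) <= b n j) -> (forall n J, series (b n) J <= B n) ->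
  cvgn (series B) -> (forall n, \forall J \near \oo, series (a n) J = A n) ->
  series (fun j => csum (a ^~ j) : R[i]^o) @ \oo --> (csum A : R[i]^o).
Proof.
move=> ab bB cB aA; apply/cvg_complexP; split.
  have := @series_interchange R (fun n j => complex.Re (a n j)) b
    (fun n => complex.Re (A n)) B _ bB cB.
  case=> [n j|n|_].
  - by apply: le_trans (ab n j); exact: Re_le_modc.
  - apply: cvg_near_cst; apply: filterS (aA n) => J <-.
    by rewrite /series /= Re_sum.
  apply: cvg_trans; apply: near_eq_cvg; near=> J.
  by rewrite /series /= Re_sum.
have := @series_interchange R (fun n j => complex.Im (a n j)) b
  (fun n => complex.Im (A n)) B _ bB cB.
case=> [n j|n|_].
- by apply: le_trans (ab n j); exact: Im_le_modc.
- apply: cvg_near_cst; apply: filterS (aA n) => J <-.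
  by rewrite /series /= Im_sum.
apply: cvg_trans; apply: near_eq_cvg; near=> J.
by rewrite /series /= Im_sum.
Unshelve. all: by end_near.
Qed.

End complex_balls.

(** * Fast simulation implies analyticity *)

Section converse.
Variable R : realType.

Definition words_weight (on : nat -> pred (seq bool)) (K : pzRingType) (z : K)
    (n : nat) : K :=
  \sum_(w <- words n | on n w) word_prob z w.

Lemma majorant_sum (r : seq (seq bool)) (P : pred (seq bool)) F
    (G : seq bool -> {poly R}) :
  (forall w, majorant (F w) (G w)) ->
  majorant (\sum_(w <- r | P w) F w) (\sum_(w <- r | P w) G w).
Proof.
move=> FG; elim/big_ind2 : _ => [||w _]; [exact: majorant0| |exact: FG].
by move=> *; exact: majorantD.
Qed.

(** With t = 1 + (|z0 - p| + r) / m, the moduli of the Taylor terms at z0 of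
    the n-th weight add up to at most K (s t)^n, and s t < 1 for z0 close to p.
    The two sums, over the length and over the Taylor index, can therefore be
    exchanged on the disc of radius r. *)
Lemma words_weight_analytic on (p K s : R) : 0 < p < 1 -> 0 < s < 1 ->
  (forall n, words_weight on p n <= K * s ^+ n) ->
  exists2 r : R, 0 < r & forall z0, modc (z0 - p%:C%C) < r ->
    @analytic_at R (fun z => csum (words_weight on z)) z0.
Proof.
move=> /andP[p0 p1] /andP[s0 s1] HK.
pose m := Num.min p (1 - p).
have m0 : 0 < m by rewrite /m lt_min p0 subr_gt0 p1.
have mp : m <= p by rewrite /m ge_min lexx.
have mq : m <= 1 - p by rewrite /m ge_min lexx orbT.
(* s t < 1 means |z0 - p| + r < m (1/s - 1); both terms get a quarter of it *)
pose r := m * (s^-1 - 1) / 4.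
have r0 : 0 < r by rewrite divr_gt0 // mulr_gt0 // subr_gt0 invf_gt1.
exists r => // z0 z0r.
pose t := 1 + (modc (z0 - p%:C%C) + r) / m.
have t0 : 0 <= t by rewrite /t addr_ge0 // divr_ge0 ?addr_ge0 ?modc_ge0 // ltW.
have st1 : s * t < 1.
  rewrite mulrC -ltr_pdivlMr // mul1r /t addrC -ltrBrDr ltr_pdivrMr //.
  apply: (@lt_le_trans _ _ (r + r)); first by rewrite ltrD2r.
  have : 0 < (s^-1 - 1) * m by rewrite mulr_gt0 // subr_gt0 invf_gt1.
  by rewrite /r; lra.
pose G n := \sum_(w <- words n | on n w) word_poly z0 w.
pose Q n := \sum_(w <- words n | on n w) word_maj z0 w.
have GQ n : majorant (G n) (Q n) by apply: majorant_sum => w; exact: word_poly_majorant.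
pose B n := K * (s * t) ^+ n.
have st0 : 0 <= s * t by rewrite mulr_ge0 // ltW.
have cB : cvgn (series B).
  by apply: (@is_cvg_geometric_series _ K (s * t)); rewrite ger0_norm.
have QB n : (Q n).[r] <= B n.
  rewrite /Q horner_sum /B exprMn mulrA.
  apply: (@le_trans _ _ (words_weight on p n * t ^+ n)); last first.
    by rewrite ler_wpM2r // exprn_ge0.
  rewrite /words_weight mulr_suml big_seq_cond [X in _ <= X]big_seq_cond.
  apply: ler_sum => w /andP[]; rewrite mem_words => /eqP <- _.
  by apply: horner_word_maj_le => //; exact: ltW.
have Qr n j : (Q n)`_j * r ^+ j <= B n.
  apply: le_trans (QB n); apply: le_trans (series_coef_le j.+1 _ _).
  - rewrite /series /= big_nat_recr //= lerDr; apply: sumr_ge0 => i _.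
    by rewrite mulr_ge0 ?exprn_ge0 ?(majorant_ge0 (GQ n)) // ltW.
  - exact: ltW.
  - exact: majorant_ge0 (GQ n).
exists (fun j => csum (fun n => (G n)`_j)).
apply/near_modcP; exists r => // z zr; set h := z - z0.
have hr j : modc (h ^+ j) <= r ^+ j.
  by rewrite modcX; apply: lerXn2r; rewrite ?nnegrE ?modc_ge0 // ltW.
have := @csum_interchange R (fun n j => (G n)`_j * h ^+ j)
  (fun n j => (Q n)`_j * r ^+ j) (words_weight on z) B.
move=> /(_ _ _ cB).
have -> : (fun j => csum (fun n => (G n)`_j) * h ^+ j) =
    (fun j => csum (fun n => (G n)`_j * h ^+ j)).
  apply/funext => j.
  apply/esym/(@csumM _ _ _ (fun n => K / r ^+ j * (s * t) ^+ n)).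
    move=> n; apply: (@le_trans _ _ ((Q n)`_j)); first exact: GQ.
    by rewrite mulrAC ler_pdivlMr ?exprn_gt0 // Qr.
  apply: (@is_cvg_geometric_series _ (K / r ^+ j) (s * t)).
  by rewrite ger0_norm.
apply=> [n j|n J|n].
- rewrite modcM; apply: ler_pM => //; try exact: modc_ge0.
  exact: GQ.
- apply: le_trans (QB n); apply: series_coef_le; first exact: ltW.
  exact: majorant_ge0 (GQ n).
exists (size (G n)) => // J /= GJ; rewrite series_coef_horner //.
rewrite /G horner_sum /words_weight; apply: eq_bigr => w _.
by rewrite horner_word_poly /h addrC subrK.
Qed.


Section output_words.
Variables (A : algorithm) (p : R).
Hypothesis p01 : 0 <= p <= 1.

(** Stopping at n is stopping by n but not by n - 1, and both are prefix events. *)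
Lemma halts_at_prefix n :
  exists P, [set x | inputs A x = Some n] = prefix_event n P.
Proof.
case: n => [|n].
  have [P HP] := halted_by_prefix A 0; exists P; rewrite -HP.
  apply/seteqP; split=> x /=; first by exists 0%N.
  by move=> [k xk]; rewrite leqn0 => /eqP k0; rewrite xk k0.
have [P HP] := halted_by_prefix A n.+1; have [Q HQ] := halted_by_prefix A n.
exists (fun w => P w && ~~ Q (take n w)).
have QE x : Q (take n (mkseq x n.+1)) <-> halted_by A n x.
  by rewrite HQ mkseqS_take.
have PE x : P (mkseq x n.+1) <-> halted_by A n.+1 x by rewrite HP.
apply/seteqP; split=> x /=.
  move=> xn; apply/andP; split; first by apply/PE; exists n.+1.
  by apply/negP => /QE[k]; rewrite xn => -[<-]; rewrite ltnn.
move=> /andP[/PE[k xk kn] /negP Hx].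
move: kn; rewrite leq_eqVlt => /orP[/eqP <- //|kn].
by exfalso; apply: Hx; apply/QE; exists k.
Qed.

Lemma output_words : exists on : nat -> pred (seq bool), forall n,
  [set x | inputs A x = Some n /\ decide A (mkseq x n)] = prefix_event n (on n).
Proof.
have [P HP] := choice halts_at_prefix.
exists (fun n w => P n w && decide A w) => n.
have PE x : P n (mkseq x n) <-> inputs A x = Some n.
  by have := HP n; rewrite /prefix_event => /seteqP[H1 H2]; split=> [/H2|/H1].
apply/seteqP; split=> x /=.
  by move=> [/PE xn dx]; apply/andP.
by move=> /andP[/PE].
Qed.

Lemma output_series on :
  (forall n, [set x | inputs A x = Some n /\ decide A (mkseq x n)] =
             prefix_event n (on n)) ->
  forall fp, coin_law p (outputs1 A) = fp%:E ->
  series (words_weight on p) @ \oo --> fp.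
Proof.
move=> onP fp Hfp.
have oE : outputs1 A = \bigcup_n prefix_event n (on n).
  apply/seteqP; split=> x.
    by move=> [n xn dn]; exists n => //; rewrite -onP.
  by move=> [n _]; rewrite -onP => -[xn dn]; exists n.
have tr : trivIset setT (fun n => prefix_event n (on n)).
  apply/trivIsetP => i j _ _ ij; rewrite -!onP.
  apply/seteqP; split=> x //= [[xi _] [xj _]].
  by move: ij; rewrite xi in xj; case: xj => ->; rewrite eqxx.
have mF n : measurable (prefix_event n (on n)) by exact: measurable_prefix_event.
have H : (fun n => \sum_(0 <= i < n) coin_law p (prefix_event i (on i)))%E @ \oo
    --> coin_law p (\bigcup_n prefix_event n (on n)).
  exact: (measure_sigma_additive mF tr).
have cl n : coin_law p (prefix_event n (on n)) = (words_weight on p n)%:E.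
  exact: coin_law_prefix_event.
have {}H : (fun n => (series (words_weight on p) n)%:E) @ \oo --> fp%:E.
  rewrite -Hfp oE; apply: cvg_trans H; apply: near_eq_cvg; near=> n.
  by rewrite /series /= -sumEFin; apply: eq_bigr => i _; rewrite -cl.
by move/fine_cvg : H.
Unshelve. all: by end_near.
Qed.

(** Stopping at time n + 1 requires more than n tosses.  The ratio (1 + rho) / 2
    replaces rho because rho may vanish, while [words_weight_analytic] divides
    by the ratio. *)
Lemma output_weight_fast on C rho :
  (forall n, [set x | inputs A x = Some n /\ decide A (mkseq x n)] =
             prefix_event n (on n)) ->
  0 < C -> rho < 1 ->
  (forall n, (coin_law p (needs_more_than A n) <= (C * rho ^+ n)%:E)%E) ->
  exists K s, 0 < s < 1 /\ forall n, words_weight on p n <= K * s ^+ n.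
Proof.
move=> onP C0 rho1 Hn.
have rho0 : 0 <= rho.
  have := le_trans (measure_ge0 (coin_law p) (needs_more_than A 1)) (Hn 1%N).
  by rewrite lee_fin expr1 pmulr_rge0.
have wE n : (words_weight on p n)%:E = coin_law p (prefix_event n (on n)).
  by rewrite coin_law_prefix_event.
pose s := (1 + rho) / 2.
have s1 : s < 1 by rewrite /s; lra.
have s2 : 1 <= 2 * s by rewrite /s; lra.
have s0 : 0 < s by rewrite /s; lra.
have rs : rho <= s by rewrite /s; lra.
exists (2 * C + 1), s; split; first by rewrite s0.
case=> [|n].
  rewrite expr0 mulr1 -lee_fin wE (@le_trans _ _ 1%E) //.
    by apply: probability_le1; exact: measurable_prefix_event.
  by rewrite lee_fin; lra.
have : words_weight on p n.+1 <= C * rho ^+ n.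
  rewrite -lee_fin wE; apply: le_trans (Hn n).
  apply: le_measure; rewrite ?inE.
  - exact: measurable_prefix_event.
  - by rewrite needs_more_thanE; apply: measurableC; exact: measurable_halted_by.
  - by rewrite -onP => x /= [xn _] k; rewrite xn => -[<-].
move=> /le_trans; apply.
have : rho ^+ n <= s ^+ n by apply: lerXn2r; rewrite // nnegrE // ltW.
have : 0 <= s ^+ n by rewrite exprn_ge0 // ltW.
rewrite exprS; move: (rho ^+ n) (s ^+ n) => a b b0 ab.
have h1 : b <= 2 * (s * b) by rewrite mulrA ler_peMl.
have h2 : 0 <= C * (2 * (s * b) - a) by rewrite mulr_ge0 ?subr_ge0 ?(le_trans ab) // ltW.
by lra.
Qed.

End output_words.

(** The extension is the sum of the continued word weights, on the union of the
    discs given by [words_weight_analytic] around the points of S. *)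
Theorem fast_simulation_real_analytic (S : set R) (f : R -> R) :
  S `<=` `]0, 1[ -> fast_simulation S f -> real_analytic_on S f.
Proof.
move=> S01 [A [simA fastA]].
have [on onP] := output_words A.
pose g (z : R[i]^o) : R[i]^o := csum (words_weight on z).
have local p : S p -> exists2 r : R, 0 < r &
    forall z0, modc (z0 - p%:C%C) < r -> analytic_at g z0.
  move=> Sp; have := S01 _ Sp; rewrite /= in_itv /= => p01.
  have [C [rho [C0 rho1 Hn]]] := fastA _ Sp.
  have p01' : 0 <= p <= 1 by case/andP: p01 => ? ?; rewrite !ltW.
  have [K [s [s01 HK]]] := output_weight_fast p01' onP C0 rho1 Hn.
  exact: words_weight_analytic s01 HK.
exists [set z | exists2 p, S p & exists2 r, 0 < r &
  modc (z - p%:C%C) < r /\ forall z0, modc (z0 - p%:C%C) < r -> analytic_at g z0], g.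
split=> [|x Sx|z [p Sp [r _ [zr Hr]]]|x Sx].
- rewrite openE => z [p Sp [r r0 [zr Hr]]].
  apply/near_modcP; exists (r - modc (z - p%:C%C)); first by rewrite subr_gt0.
  move=> y yz; exists p => //; exists r => //; split=> //.
  rewrite -(subrK z y) -addrA (le_lt_trans (modcD _ _)) //.
  by rewrite -ltrBrDr.
- have [r r0 Hr] := local _ Sx; exists x => //; exists r => //; split=> //.
  by rewrite subrr -[0]/(0%:C%C) modc_real normr0.
- exact: Hr.
have [_ out1] := simA _ Sx.
have := S01 _ Sx; rewrite /= in_itv /= => /andP[x0 x1].
have x01 : 0 <= x <= 1 by rewrite !ltW.
have := output_series x01 onP out1 => Hs.
have wE n : words_weight on x%:C%C n = (words_weight on x n)%:C%C.
  rewrite /words_weight rmorph_sum; apply: eq_bigr => w _.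
  rewrite /word_prob rmorph_prod; apply: eq_bigr => -[] _ //.
  by rewrite rmorphB rmorph1.
rewrite /g /csum; under eq_fun do rewrite wE /=.
rewrite (cvg_lim _ Hs) //; congr Complex.
under eq_fun do rewrite wE /=.
rewrite (_ : series _ = cst 0) ?lim_cst //.
by apply/funext => N; rewrite /series /= big1.
Qed.

End converse.

(** * Algorithms with prescribed numbers of decided words *)

Section greedy_decision.
Variables (A Z : nat -> nat -> nat).

(** The words of length m + 1 with k ones that extend words counted by F. *)
Definition inherited (F : nat -> nat -> nat) m k :=
  (F m k + (if k is k'.+1 then F m k' else 0))%N.

(** A word keeps the decision of its prefix.  Among the undecided words with k
    ones, listed in the order of [words], the first t1 are decided 1 and the
    next t0 are decided 0, which brings the counts to A n k and Z n k. *)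
Fixpoint decision n (w : seq bool) : option bool :=
  if n is m.+1 then
    if decision m (take m w) is Some v then Some v else
    let k := count id w in
    let L := [seq u <- words n | (count id u == k) &&
                                 (decision m (take m u) == None)] in
    let t1 := (A n k - inherited A m k)%N in
    let t0 := (Z n k - inherited Z m k)%N in
    if (index w L < t1)%N then Some true
    else if (index w L < t1 + t0)%N then Some false
    else None
  else None.

Lemma decision_take n m w v : (n <= m)%N -> size w = m ->
  decision n (take n w) = Some v -> decision m w = Some v.
Proof.
move=> nm wm; move: w wm; rewrite -(subnK nm); elim: (m - n)%N => [|d IH] w wm.
  by rewrite take_oversize // wm.
move=> H; rewrite addSn /= (IH (take (d + n) w)) //.
  by rewrite size_takel // wm addSn.
by rewrite take_takel // leq_addl.
Qed.

Lemma count_rcons_words n (P : pred (seq bool)) :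
  count P (words n.+1) =
  (count (fun u => P (rcons u true)) (words n) +
   count (fun u => P (rcons u false)) (words n))%N.
Proof. by rewrite /= count_cat !count_map. Qed.

Lemma count_words n k : count (fun w => count id w == k) (words n) = 'C(n, k).
Proof.
elim: n k => [|n IH] k; first by case: k.
rewrite count_rcons_words.
under eq_count do rewrite -cats1 count_cat /= addn0 addn1.
under [in X in (_ + X)%N]eq_count do rewrite -cats1 count_cat /= !addn0.
rewrite IH; case: k => [|k]; last by rewrite binS addnC; congr addn; exact: IH.
by rewrite !bin0; elim: (words n) => //=.
Qed.

Lemma count_index (T : eqType) (s : seq T) t : uniq s ->
  count (fun w => (index w s < t)%N) s = minn t (size s).
Proof.
elim: s t => [|x s IH] t /=; first by rewrite minn0.
move=> /andP[xs us]; rewrite eqxx.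
case: t => [|t].
  by rewrite min0n /=; apply/eqP; rewrite -leqn0 leqNgt -has_count; apply/hasPn.
rewrite minnSS /= -IH // add1n; congr S; apply: eq_in_count => y ys.
by case: eqVneq => [xy|//]; rewrite xy ys in xs.
Qed.

Lemma count_between (T : Type) (f : T -> nat) s a b :
  count (fun x => (f x < a + b)%N) s =
  (count (fun x => (f x < a)%N) s + count (fun x => (a <= f x < a + b)%N) s)%N.
Proof.
elim: s => [//|x s /= ->]; case: (ltnP (f x) a) => H; case: ltnP => H' /=; lia.
Qed.

Hypotheses (A0 : forall k, A 0 k = 0%N) (Z0 : forall k, Z 0 k = 0%N).
Hypotheses (inhA : forall m k, (inherited A m k <= A m.+1 k)%N)
           (inhZ : forall m k, (inherited Z m k <= Z m.+1 k)%N).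
Hypothesis AZ : forall n k, (A n k + Z n k <= 'C(n, k))%N.

Lemma count_inherited m k v (F := if v then A else Z) :
  (forall k, count (fun w => (count id w == k) && (decision m w == Some v))
    (words m) = F m k) ->
  count (fun w => (count id w == k) && (decision m (take m w) == Some v))
    (words m.+1) = inherited F m k.
Proof.
move=> IH; rewrite count_rcons_words /inherited -IH addnC; congr (_ + _)%N.
  apply: eq_in_count => u; rewrite mem_words => /eqP um.
  by rewrite -cats1 take_size_cat // count_cat /= !addn0.
case: k => [|k].
  rewrite -[RHS](count_pred0 (words m)); apply: eq_count => u.
  by rewrite -cats1 count_cat /= addn0 addn1.
rewrite -IH; apply: eq_in_count => u; rewrite mem_words => /eqP um.
by rewrite -cats1 take_size_cat // count_cat /= addn0 addn1 eqSS.
Qed.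

(** The undecided words with k ones number 'C(n, k) minus the inherited counts,
    so the hypothesis A + Z <= 'C leaves enough of them for both quotas. *)
Lemma count_decision n k v :
  count (fun w => (count id w == k) && (decision n w == Some v)) (words n) =
  (if v then A else Z) n k.
Proof.
elim: n k v => [|m IH] k v.
  by case: v; rewrite ?A0 ?Z0 /= andbF.
have CI v' : count (fun w => (count id w == k) &&
      (decision m (take m w) == Some v')) (words m.+1) =
    inherited (if v' then A else Z) m k by apply: count_inherited => k'; exact: IH.
set L := [seq u <- words m.+1 | (count id u == k) &&
                                (decision m (take m u) == None)].
have uL : uniq L by rewrite filter_uniq // words_uniq.
have sL : (size L + inherited A m k + inherited Z m k = 'C(m.+1, k))%N.
  rewrite -(count_words m.+1 k) size_filter -(CI true) -(CI false).
  elim: (words m.+1) => [//|w s /= <-].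
  by case: (count id w == k) => //=; case: (decision m (take m w)) => [[]|] /=;
    rewrite ?add0n ?add1n ?addSn ?addnS.
have t10 : (A m.+1 k - inherited A m k + (Z m.+1 k - inherited Z m k) <= size L)%N.
  by have := AZ m.+1 k; have := inhA m k; have := inhZ m k; lia.
set t1 := (A m.+1 k - inherited A m k)%N in t10.
set t0 := (Z m.+1 k - inherited Z m k)%N in t10.
transitivity (inherited (if v then A else Z) m k +
  count (fun w => if v then (index w L < t1)%N
           else (t1 <= index w L < t1 + t0)%N) L)%N.
  rewrite -CI count_filter -count_predUI; symmetry.
  rewrite [X in (_ + X)%N](_ : _ = 0%N) ?addn0; last first.
    rewrite -[RHS](count_pred0 (words m.+1)); apply: eq_count => w /=.
    by case: (decision m (take m w)) => [[]|]; rewrite ?andbF.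
  apply: eq_count => w /=.
  case: (eqVneq (count id w) k) => [wk|]; rewrite ?andbF //= wk -/L -/t1 -/t0.
  case: (decision m (take m w)) => [v'|] /=; first by rewrite andbF orbF.
  rewrite andbT; case: ltnP => /= [|]; case: v => //=.
  - by move=> _; case: ifP.
  - by move=> _; case: ifP.
case: v => /=.
  rewrite count_index // (minn_idPl _); last by apply: leq_trans t10; exact: leq_addr.
  by rewrite /t1 subnKC.
have := @count_between _ (index^~ L) L t1 t0.
rewrite !count_index // (minn_idPl t10) (minn_idPl _).
  by move/addnI => <-; rewrite /t0 subnKC.
by apply: leq_trans t10; exact: leq_addr.
Qed.

End greedy_decision.

(** * From decisions on words to algorithms *)

Lemma word_prob_count (K : comPzRingType) (z : K) w :
  word_prob z w = z ^+ count id w * (1 - z) ^+ (size w - count id w).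
Proof.
rewrite /word_prob; elim: w => [|b w IH]; first by rewrite big_nil mulr1.
have le := count_size id w.
rewrite big_cons IH; case: b => /=.
  by rewrite add1n exprS mulrA subSS.
by rewrite add0n subSn // exprS mulrCA.
Qed.

Definition binom_weight (R : pzRingType) n (p : R) k : R :=
  p ^+ k * (1 - p) ^+ (n - k).

(** The value at p of the polynomial of degree n with Bernstein coefficients u,
    which is also the expectation of u at the number of ones in n tosses. *)
Definition bern (R : pzRingType) n (p : R) (u : nat -> R) : R :=
  \sum_(k < n.+1) binom_weight n p k * ('C(n, k)%:R * u k).

Lemma binom_weight_ge0 (R : realType) n (p : R) k :
  0 <= p <= 1 -> 0 <= binom_weight n p k.
Proof. by move=> /andP[? ?]; rewrite mulr_ge0 ?exprn_ge0 ?subr_ge0. Qed.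

Lemma bern1 (R : comPzRingType) n (p : R) : bern n p (fun=> 1) = 1.
Proof.
have := exprDn (1 - p) p n; rewrite subrK expr1n => E; rewrite [RHS]E.
by apply: eq_bigr => i _; rewrite /binom_weight mulr1 mulr_natr mulrC.
Qed.

Lemma sum_words_count (R : comPzRingType) n (p : R) (P : pred (seq bool)) F :
  (forall k, count (fun w => (count id w == k) && P w) (words n) = F k) ->
  \sum_(w <- words n | P w) word_prob p w =
  \sum_(k < n.+1) binom_weight n p k * (F k)%:R.
Proof.
move=> PF.
rewrite big_seq_cond (partition_big (fun w => inord (count id w) : 'I_n.+1) xpredT) //=.
apply: eq_bigr => k _; rewrite -PF -sum1_count natr_sum mulr_sumr.
rewrite big_seq_cond [RHS]big_seq_cond.
have H w : w \in words n -> (count id w <= n)%N.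
  by rewrite mem_words => /eqP <-; exact: count_size.
rewrite [LHS](eq_bigl (fun w => (w \in words n) && ((count id w == k) && P w)));
  last first.
  move=> w; case wn: (w \in words n) => //=; rewrite andbC; congr andb.
  by rewrite -(inj_eq val_inj) /= inordK // ltnS H.
apply: eq_bigr => w /andP[]; rewrite mem_words => /eqP wn /andP[/eqP wk _].
by rewrite mulr1 word_prob_count wn wk.
Qed.

Section decision_algorithm.
Variable dec : nat -> seq bool -> option bool.
Hypothesis dec_take : forall n m w v, (n <= m)%N -> size w = m ->
  dec n (take n w) = Some v -> dec m w = Some v.

Definition dec_inputs (x : coin_space) : option nat :=
  if pselect (exists n, dec n (mkseq x n) != None) is left H
  then Some (ex_minn H) else None.

Lemma dec_mono x n m v : (n <= m)%N ->
  dec n (mkseq x n) = Some v -> dec m (mkseq x m) = Some v.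
Proof.
by move=> nm; rewrite -(mkseqS_take x nm); apply: dec_take; rewrite ?size_mkseq.
Qed.

Lemma dec_inputs_le n :
  [set x | exists2 k, dec_inputs x = Some k & (k <= n)%N] =
  prefix_event n (fun w => dec n w != None).
Proof.
apply/seteqP; split => x; rewrite /prefix_event /dec_inputs /=.
  case: pselect => [H|_] [k] // [<-]; case: ex_minnP => m Hm _ mn.
  by case E: (dec m (mkseq x m)) Hm => [v|//] _; rewrite (dec_mono mn E).
move=> H; case: pselect => [E|[]]; last by exists n.
by exists (ex_minn E) => //; case: ex_minnP => m _; apply.
Qed.

Lemma dec_stopping_time : stopping_time dec_inputs.
Proof.
move=> n; apply/natural_filtrationP; eexists; exact: dec_inputs_le.
Qed.

Definition dec_algorithm : algorithm :=
  @Algorithm dec_inputs (fun w => dec (size w) w == Some true) dec_stopping_time.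

Lemma dec_outputs1 : outputs1 dec_algorithm =
  \bigcup_n prefix_event n (fun w => dec n w == Some true).
Proof.
apply/seteqP; split => x; rewrite /outputs1 /prefix_event /=.
  by move=> [n _]; rewrite size_mkseq => H; exists n.
move=> [n _ /= /eqP H]; rewrite /dec_inputs.
case: pselect => [E|[]]; last by exists n; rewrite H.
exists (ex_minn E) => //; case: ex_minnP => m Hm Hmin.
have mn : (m <= n)%N by apply: Hmin; rewrite H.
rewrite size_mkseq; case E' : (dec m (mkseq x m)) Hm => [v|//] _.
by rewrite -H (dec_mono mn E').
Qed.

Lemma dec_halts : halts dec_algorithm =
  \bigcup_n prefix_event n (fun w => dec n w != None).
Proof.
apply/seteqP; split => x; rewrite /halts /=.
  by move=> [n xn]; exists n => //; rewrite -dec_inputs_le; exists n.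
by move=> [n _]; rewrite -dec_inputs_le => -[k xk _]; exists k.
Qed.

Lemma dec_needs_more n : needs_more_than dec_algorithm n =
  prefix_event n (fun w => dec n w == None).
Proof.
rewrite needs_more_thanE /halted_by /= dec_inputs_le /prefix_event.
apply/seteqP; split => x /=; first by move/negP; rewrite negbK.
by move=> /eqP ->.
Qed.

(** Both events are increasing unions of prefix events, so their probabilities
    are limits of the probabilities of those. *)
Lemma dec_simulates (R : realType) (p fp : R) : 0 <= p <= 1 ->
  (fun n => \sum_(w <- words n | dec n w == None) word_prob p w) @ \oo --> 0 ->
  (fun n => \sum_(w <- words n | dec n w == Some true) word_prob p w) @ \oo --> fp ->
  coin_law p (halts dec_algorithm) = 1%E /\
  coin_law p (outputs1 dec_algorithm) = fp%:E.
Proof.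
move=> p01 H0 H1.
have cvg_event (P : nat -> pred (seq bool)) l :
    (forall n m x, (n <= m)%N -> P n (mkseq x n) -> P m (mkseq x m)) ->
    (fun n => \sum_(w <- words n | P n w) word_prob p w) @ \oo --> l ->
    coin_law p (\bigcup_n prefix_event n (P n)) = l%:E.
  move=> Pm Pl.
  have mP n : measurable (prefix_event n (P n)) by exact: measurable_prefix_event.
  have H : (coin_law p \o (fun n => prefix_event n (P n))) @ \oo -->
      coin_law p (\bigcup_n prefix_event n (P n)).
    apply: nondecreasing_cvg_mu => //; first exact: bigcup_measurable.
    by move=> n m nm; apply/subsetPset => x; exact: Pm.
  apply: (cvg_unique _ H) => //.
  have -> : (coin_law p \o (fun n => prefix_event n (P n))) =
      EFin \o (fun n => \sum_(w <- words n | P n w) word_prob p w).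
    by apply/funext => n; exact: coin_law_prefix_event.
  by apply: cvg_EFin Pl; near=> n.
split.
  rewrite dec_halts; apply: (@cvg_event (fun n w => dec n w != None)).
    move=> n m x nm; case E: (dec n (mkseq x n)) => [v|//] _.
    by rewrite (dec_mono nm E).
  rewrite -[1]subr0.
  have : (fun n => 1 - \sum_(w <- words n | dec n w == None) word_prob p w) @ \oo
      --> 1 - (0 : R).
    by apply: cvgB H0; exact: cvg_cst.
  apply: cvg_trans; apply: near_eq_cvg; near=> n.
  rewrite -[in LHS](bern1 n p) /bern.
  transitivity (\sum_(w <- words n) word_prob p w -
     \sum_(w <- words n | dec n w == None) word_prob p w).
    congr (_ - _).
    rewrite (@sum_words_count R n p xpredT (fun k => 'C(n, k))) //.
      by apply: eq_bigr => k _; rewrite mulr1.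
    by move=> k; rewrite -count_words; apply: eq_count => w; rewrite andbT.
  by rewrite [X in X - _](bigID (fun w => dec n w == None)) /= addrAC subrr add0r.
rewrite dec_outputs1; apply: (@cvg_event (fun n w => dec n w == Some true)) => //.
by move=> n m x nm /eqP E; rewrite (dec_mono nm E).
Unshelve. all: by end_near.
Qed.

End decision_algorithm.

(** * Envelopes of Bernstein coefficients *)

Section realization.
Variable R : realType.

(** The expectation of u n j when j is the number of ones left after erasing one
    toss, chosen at random, of a word of length n + 1 with k ones; this is also
    the degree elevation rule for Bernstein coefficients.  For k = 0 the first
    weight is zero, so the value k.-1 = 0 does not matter. *)
Definition avg (u : nat -> nat -> R) n k : R :=
  k%:R / n.+1%:R * u n k.-1 + (1 - k%:R / n.+1%:R) * u n k.

(** In terms of word counts the average is the Pascal rule. *)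
Lemma bin_avg (u : nat -> nat -> R) n k : (k <= n.+1)%N ->
  'C(n.+1, k)%:R * avg u n k =
  'C(n, k)%:R * u n k + (if k is k'.+1 then 'C(n, k')%:R * u n k' else 0).
Proof.
move=> kn; rewrite /avg mulrDr !mulrA addrC; congr (_ * _ + _).
  have n0 : n.+1%:R != 0 :> R by rewrite pnatr_eq0.
  apply: (mulfI n0).
  have -> : n.+1%:R * 'C(n, k)%:R = (n.+1 - k)%:R * 'C(n.+1, k)%:R :> R.
    by rewrite -!natrM -mul_bin_down.
  by rewrite natrB // mulrCA; move: n.+1%:R n0 => N N0; field.
case: k kn => [|k] kn /=; first by rewrite mulr0 !mul0r.
congr (_ * _).
have n0 : n.+1%:R != 0 :> R by rewrite pnatr_eq0.
apply: (mulfI n0).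
have -> : n.+1%:R * 'C(n, k)%:R = k.+1%:R * 'C(n.+1, k.+1)%:R :> R.
  by rewrite -!natrM -mul_bin_diag.
by rewrite mulrA; move: n.+1%:R n0 => N N0; field.
Qed.

Lemma linear_geometric_bound (M : R) : 0 < M < 1 ->
  exists K mu : R, [/\ 0 < K, 0 < mu < 1 & forall n, n.+1%:R * M ^+ n <= K * mu ^+ n].
Proof.
move=> /andP[M0 M1]; pose d := (1 - M) / 2.
have d0 : 0 < d by rewrite /d; lra.
have d1 : d <= 1 by rewrite /d; lra.
exists d^-1, (M * (1 + d)); split; first by rewrite invr_gt0.
  apply/andP; split; first by rewrite mulr_gt0 // addr_gt0.
  by rewrite /d; nra.
move=> n; rewrite exprMn mulrCA mulrC ler_pM2l ?exprn_gt0 //.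
rewrite mulrC ler_pdivlMr //.
elim: n => [|n IH]; first by rewrite mul1r expr0.
rewrite exprS -natr1 mulrDl mul1r [_ * _ ^+ n]mulrDl mul1r lerD //.
rewrite ler_peMr ?exprn_ege1 //; [exact: ltW | by rewrite lerDl ltW].
Qed.

Variables (S : set R) (f : R -> R) (n0 : nat) (lo hi : nat -> nat -> R).
Hypothesis S01 : forall p, S p -> 0 < p < 1.
Hypothesis n0_gt0 : (0 < n0)%N.
Hypothesis lohi : forall n k, (n0 <= n)%N -> (k <= n)%N ->
  0 <= lo n k /\ lo n k <= hi n k <= 1.
Hypothesis lo_avg : forall n k, (n0 <= n)%N -> (k <= n.+1)%N ->
  avg lo n k <= lo n.+1 k.
Hypothesis hi_avg : forall n k, (n0 <= n)%N -> (k <= n.+1)%N ->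
  hi n.+1 k <= avg hi n k.
Hypothesis gap : forall p, S p -> exists C rho : R, 0 < rho < 1 /\
  forall n, (n0 <= n)%N -> bern n p (fun k => hi n k - lo n k) <= C * rho ^+ n.
Hypothesis lo_cvg : forall p, S p -> (fun n => bern n p (lo n)) @ \oo --> f p.

Definition ones n k : nat :=
  if (n < n0)%N then 0%N else Num.truncn ('C(n, k)%:R * lo n k).
Definition zeros n k : nat :=
  if (n < n0)%N then 0%N else Num.truncn ('C(n, k)%:R * (1 - hi n k)).

(** Rounding down keeps the Pascal inequality, since a sum of two integers below
    a real number is below its integer part.  Rounding [lo] and 1 - [hi] down is
    thus harmless. *)
Lemma superaverage_floor (u : nat -> nat -> R) (F : nat -> nat -> nat) :
  (forall n k, F n k = if (n < n0)%N then 0%N else Num.truncn ('C(n, k)%:R * u n k)) ->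
  (forall n k, (n0 <= n)%N -> (k <= n)%N -> 0 <= u n k) ->
  (forall n k, (n0 <= n)%N -> (k <= n.+1)%N -> avg u n k <= u n.+1 k) ->
  forall m k, (inherited F m k <= F m.+1 k)%N.
Proof.
move=> FE u0 uavg m k; rewrite /inherited.
case: (ltnP m n0) => mn0; first by case: k => [|k]; rewrite !FE mn0.
have C0 j : 0 <= 'C(m, j)%:R * u m j.
  case: (leqP j m) => jm; first by rewrite mulr_ge0 // u0.
  by rewrite bin_small // mul0r.
have nn : (m.+1 < n0)%N = false by apply/negbTE; rewrite -leqNgt (leq_trans mn0).
have Fle j : (F m j)%:R <= 'C(m, j)%:R * u m j.
  by rewrite FE ltnNge mn0 /= truncn_le.
case: (leqP k m.+1) => km; last first.
  case: k km => // k km; rewrite FE ltnNge mn0 /= FE ltnNge mn0 /=.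
  by rewrite !bin_small ?mul0r ?truncn0 // ltnW.
rewrite [F m.+1 k]FE nn truncn_ge_nat; last first.
  by rewrite mulr_ge0 // u0 // (leq_trans mn0).
apply: (@le_trans _ _ ('C(m.+1, k)%:R * avg u m k)); last first.
  by rewrite ler_wpM2l // uavg.
rewrite bin_avg // natrD lerD //.
by case: (k).
Qed.

Lemma ones_inherited m k : (inherited ones m k <= ones m.+1 k)%N.
Proof.
apply: (@superaverage_floor lo) => // n j nn0 jn.
by have [] := lohi nn0 jn.
Qed.

Lemma zeros_inherited m k : (inherited zeros m k <= zeros m.+1 k)%N.
Proof.
apply: (@superaverage_floor (fun n k => 1 - hi n k)) => // n j nn0 jn.
  by have [_ /andP[_]] := lohi nn0 jn; rewrite subr_ge0.
have := hi_avg nn0 jn; rewrite /avg.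
by set x := _ / _; move: (hi n j.-1) (hi n j) (hi n.+1 j) => a b c; lra.
Qed.

Lemma ones_zeros_le n k : (ones n k + zeros n k <= 'C(n, k))%N.
Proof.
rewrite /ones /zeros; case: ltnP => // nn0.
case: (leqP k n) => kn; last by rewrite bin_small // !mul0r truncn0.
have [l0 /andP[lh h1]] := lohi nn0 kn.
rewrite -(@ler_nat R) natrD.
have A0 : 0 <= 'C(n, k)%:R * lo n k by rewrite mulr_ge0.
have Z0 : 0 <= 'C(n, k)%:R * (1 - hi n k) by rewrite mulr_ge0 // subr_ge0.
have := truncn_le ('C(n, k)%:R * lo n k); rewrite A0 => A1.
have := truncn_le ('C(n, k)%:R * (1 - hi n k)); rewrite Z0 => Z1.
have C0 : 0 <= 'C(n, k)%:R :> R by [].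
by nra.
Qed.

Let dec := decision ones zeros.
Let ones0 k : ones 0 k = 0%N. Proof. by rewrite /ones n0_gt0. Qed.
Let zeros0 k : zeros 0 k = 0%N. Proof. by rewrite /zeros n0_gt0. Qed.

Let count_dec := count_decision ones0 zeros0 ones_inherited zeros_inherited
  ones_zeros_le.

Lemma sum_decided1 n p : \sum_(w <- words n | dec n w == Some true) word_prob p w =
  \sum_(k < n.+1) binom_weight n p k * (ones n k)%:R :> R.
Proof. by apply: sum_words_count => k; exact: (count_dec n k true). Qed.

Lemma sum_undecided n p : \sum_(w <- words n | dec n w == None) word_prob p w =
  \sum_(k < n.+1) binom_weight n p k * ('C(n, k) - ones n k - zeros n k)%:R :> R.
Proof.
apply: (@sum_words_count _ n p _
  (fun k => 'C(n, k) - ones n k - zeros n k)%N) => k.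
rewrite -(count_dec n k true) -(count_dec n k false) -count_words -/dec.
elim: (words n) => [//|w s IH] /=; rewrite {}IH.
have H v : (count (fun w0 => (count id w0 == k) && (dec n w0 == Some v)) s
            <= count (fun w0 => count id w0 == k) s)%N.
  by apply: sub_count => x /andP[].
have H2 : (count (fun w0 => (count id w0 == k) && (dec n w0 == Some true)) s +
   count (fun w0 => (count id w0 == k) && (dec n w0 == Some false)) s
            <= count (fun w0 => count id w0 == k) s)%N.
  elim: (s) => [//|x t IH] /=; case: (count id x == k) => //=.
  by case: (dec n x) => [[]|] /=; lia.
by case: (count id w == k) => //=; case: (dec n w) => [[]|] /=; lia.
Qed.

(** The cost of rounding: each of the n + 1 counts is off by less than one word,
    of probability at most max(p, 1 - p)^n. *)
Lemma sum_binom_weight p : 0 < p < 1 -> exists K mu : R, [/\ 0 < K, 0 < mu < 1 &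
  forall n, \sum_(k < n.+1) binom_weight n p k <= K * mu ^+ n].
Proof.
move=> /andP[p0 p1]; have q0 : 0 < 1 - p by rewrite subr_gt0.
pose M := Num.max p (1 - p).
have M01 : 0 < M < 1 by rewrite /M lt_max p0 /= gt_max p1 ltrBlDr ltrDl.
have [K [mu [K0 mu01 H]]] := linear_geometric_bound M01.
exists K, mu; split=> // n; apply: le_trans (H n).
have -> : n.+1%:R * M ^+ n = \sum_(k < n.+1) M ^+ n.
  by rewrite sumr_const card_ord -[RHS]mulr_natl.
have M0 : 0 <= M by case/andP: M01 => /ltW.
apply: ler_sum => k _; rewrite /binom_weight.
have -> : M ^+ n = M ^+ k * M ^+ (n - k) by rewrite -exprD subnKC // leq_ord.
apply: ler_pM; rewrite ?exprn_ge0 //; try exact: ltW.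
  by apply: lerXn2r; rewrite ?nnegrE // ?(ltW p0) // /M le_max lexx.
by apply: lerXn2r; rewrite ?nnegrE // ?(ltW q0) // /M le_max lexx orbT.
Qed.

(** Decide as many words as the rounded envelopes allow.  The undecided words
    have at most the weight of the gap plus twice the rounding cost, and the
    weight of the words decided 1 differs from the Bernstein polynomial of [lo]
    by at most the rounding cost. *)
Theorem bernstein_envelope_fast_simulation : fast_simulation S f.
Proof.
have dt := @decision_take ones zeros.
exists (dec_algorithm dt).
suff key p : S p ->
    (exists C rho : R, [/\ 0 < C, 0 < rho < 1 &
     forall n, \sum_(w <- words n | dec n w == None) word_prob p w <= C * rho ^+ n]) /\
    (fun n => \sum_(w <- words n | dec n w == Some true) word_prob p w) @ \oo --> f p.
  have p01 p : S p -> 0 <= p <= 1 by move=> /S01/andP[? ?]; rewrite !ltW.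
  split=> p Sp; have [[C [rho [C0 /andP[rho0 rho1] Hn]]] H1] := key _ Sp.
    apply: dec_simulates => //; first exact: p01.
    apply/cvgrPdist_lt => e e0.
    have : (fun n => C * rho ^+ n) @ \oo --> C * 0.
      by apply: cvgMl_tmp; apply: cvg_expr; rewrite ger0_norm // ltW.
    rewrite mulr0 => /cvgrPdist_lt/(_ _ e0); apply: filterS => n.
    rewrite !sub0r !normrN => H; apply: le_lt_trans H.
    rewrite ger0_norm.
      by apply: le_trans (Hn n) _; exact: ler_norm.
    by apply: sumr_ge0 => w _; apply: word_prob_ge0; exact: p01.
  exists C, rho; split=> // n.
  rewrite dec_needs_more coin_law_prefix_event ?lee_fin //; exact: p01.
move=> Sp; have p01 := S01 Sp; have p01' : 0 <= p <= 1.
  by case/andP: p01 => ? ?; rewrite !ltW.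
have [K [mu [K0 /andP[mu0 mu1] HK]]] := sum_binom_weight p01.
split.
  have [C [rho [/andP[rho0 rho1] Hg]]] := gap Sp.
  pose nu := Num.max rho mu.
  have nu0 : 0 < nu by rewrite /nu lt_max rho0.
  (* the last summand takes care of n < n0, where nothing is decided *)
  exists (`|C| + 2 * K + (nu ^+ n0)^-1), nu; split.
  - by rewrite ltr_pwDr ?invr_gt0 ?exprn_gt0 // addr_ge0 // mulr_ge0 // ltW.
  - by rewrite nu0 /nu gt_max rho1.
  move=> n; have nun : 0 < nu ^+ n by rewrite exprn_gt0.
  rewrite mulrDl; case: (ltnP n n0) => nn0.
    apply: (@le_trans _ _ 1).
      rewrite -lee_fin -(coin_law_prefix_event n _ p01').
      by apply: probability_le1; exact: measurable_prefix_event.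
    rewrite -[1]add0r lerD //.
      by rewrite mulr_ge0 ?(ltW nun) // addr_ge0 // mulr_ge0 // ltW.
    rewrite mulrC ler_pdivlMr ?exprn_gt0 // mul1r.
    have nu1 : nu < 1 by rewrite /nu gt_max rho1.
    by rewrite ler_wiXn2l ?(ltW nu0) ?(ltW nu1) // ltnW.
  rewrite ler_wpDr //; first by rewrite mulr_ge0 ?invr_ge0 ?exprn_ge0 // ltW.
  rewrite sum_undecided.
  apply: (@le_trans _ _ (bern n p (fun k => hi n k - lo n k) +
      2 * \sum_(k < n.+1) binom_weight n p k)).
    rewrite /bern mulr_sumr -big_split; apply: ler_sum => k _ /=.
    rewrite [2 * _]mulrC -mulrDr ler_wpM2l ?binom_weight_ge0 //.
    have kn : (k <= n)%N := leq_ord k.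
    have [l0 /andP[lh h1]] := lohi nn0 kn.
    have A1 := truncnS_gt ('C(n, k)%:R * lo n k).
    have Z1 := truncnS_gt ('C(n, k)%:R * (1 - hi n k)).
    have AZ := ones_zeros_le n k.
    rewrite -subnDA natrB // natrD.
    move: A1 Z1; rewrite /ones /zeros ltnNge nn0 /= -!natr1; lra.
  rewrite [leRHS]mulrDl lerD //.
    apply: le_trans (Hg _ nn0) _; apply: (@le_trans _ _ (`|C| * rho ^+ n)).
      by rewrite ler_wpM2r ?ler_norm // exprn_ge0 // ltW.
    rewrite ler_wpM2l //; apply: lerXn2r; rewrite ?nnegrE ?(ltW rho0) ?(ltW nu0) //.
    by rewrite /nu le_max lexx.
  rewrite -mulrA ler_wpM2l //; apply: le_trans (HK n) _.
  rewrite ler_wpM2l ?(ltW K0) //; apply: lerXn2r; rewrite ?nnegrE ?(ltW mu0) ?(ltW nu0) //.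
  by rewrite /nu le_max lexx orbT.
have Kmu : (fun n => K * mu ^+ n) @ \oo --> 0.
  rewrite -[X in _ --> X](mulr0 K).
  by apply: cvgMl_tmp; apply: cvg_expr; rewrite ger0_norm // ltW.
have := lo_cvg Sp => /cvgrPdist_lt Hlo.
move/cvgrPdist_lt : Kmu => Kmu.
apply/cvgrPdist_lt => e e0.
have e2 : 0 < e / 2 by rewrite divr_gt0.
near=> n.
have nn0 : (n0 <= n)%N by near: n; exists n0.
have h1 : `|f p - bern n p (lo n)| < e / 2 by near: n; exact: Hlo.
have h2 : `|0 - K * mu ^+ n| < e / 2 by near: n; exact: Kmu.
rewrite sum_decided1.
have h3 : `|bern n p (lo n) - \sum_(k < n.+1) binom_weight n p k * (ones n k)%:R|
   <= K * mu ^+ n.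
  apply: le_trans (HK n); rewrite /bern -sumrB (le_trans (ler_norm_sum _ _ _)) //.
  apply: ler_sum => k _; rewrite -mulrBr normrM ger0_norm ?binom_weight_ge0 //.
  rewrite ler_piMr ?binom_weight_ge0 //.
  have kn : (k <= n)%N := leq_ord k.
  have [l0 _] := lohi nn0 kn.
  have C0 : 0 <= 'C(n, k)%:R * lo n k by rewrite mulr_ge0.
  have := truncn_itv C0; rewrite -natr1 => /andP[t1 t2].
  by rewrite /ones ltnNge nn0 /= ger0_norm ?subr_ge0 // lerBlDr addrC ltW.
rewrite sub0r normrN in h2.
have := le_lt_trans (ler_norm _) h2 => h4.
rewrite -(subrKA (bern n p (lo n))) [e]splitr.
rewrite (le_lt_trans (ler_normD _ _)) // ltrD //.
exact: le_lt_trans h4.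
Unshelve. all: by end_near.
Qed.

End realization.

(** * Power series expansions along an interval *)

Section local_expansions.
Variable R : realType.
Implicit Types (phi : R -> R) (e : nat -> R) (y h K M : R).

(** The coefficient bound is part of the notion: together with the radius 1 / M
    it is what survives a change of centre, up to constants. *)
Definition expands phi y e K M : Prop :=
  (forall i, `|e i| <= K * M ^+ i) /\
  forall h, `|h| * M <= 1 ->
    series (fun i => e i * h ^+ i) @ \oo --> phi (y + h).

(** The coefficients of the same power series centred at distance d; terms with
    j < i vanish through the binomial coefficient. *)
Definition reexpansion e d i := limn (series (fun j => e j * 'C(j, i)%:R * d ^+ (j - i))).

Lemma expands_weaken phi y e K M K' M' : 0 <= K -> 0 <= M -> K <= K' -> M <= M' ->
  expands phi y e K M -> expands phi y e K' M'.
Proof.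
move=> K0 M0 KK MM [eB eS]; split=> [i|h hM].
  apply: le_trans (eB i) _; apply: ler_pM; rewrite ?exprn_ge0 //.
  by apply: lerXn2r; rewrite ?nnegrE // (le_trans M0).
by apply: eS; apply: le_trans hM; rewrite ler_wpM2l.
Qed.

Lemma binom_term_le (u v : R) i j : 0 <= u -> 0 <= v ->
  'C(j, i)%:R * u ^+ (j - i) * v ^+ i <= (u + v) ^+ j.
Proof.
move=> u0 v0; case: (leqP i j) => ij; last first.
  by rewrite bin_small // !mul0r exprn_ge0 // addr_ge0.
rewrite exprDn (bigD1 (Ordinal (ij : (i < j.+1)%N))) //= -mulrA mulr_natl lerDl.
by apply: sumr_ge0 => k _; rewrite mulrn_wge0 // mulr_ge0 ?exprn_ge0.
Qed.

Section reexpand.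
Variables (e : nat -> R) (K M d : R).
Hypotheses (K0 : 0 <= K) (M0 : 0 < M).
Hypothesis eB : forall i, `|e i| <= K * M ^+ i.
Hypothesis dM : `|d| * M <= 1 / 4.

(** With v = 1 / (4 M), the left-hand side times v^i is at most K M^j times one
    term of the binomial expansion of (|d| + v)^j, and M (|d| + v) <= 1/2. *)
Lemma reexpansion_term i j :
  `|e j * 'C(j, i)%:R * d ^+ (j - i)| <= K * (4 * M) ^+ i * (1 / 2) ^+ j.
Proof.
pose v := (4 * M)^-1.
have v0 : 0 < v by rewrite invr_gt0 mulr_gt0.
have H := @binom_term_le `|d| v i j (normr_ge0 _) (ltW v0).
have M4 : 0 < (4 * M) ^+ i by rewrite exprn_gt0 // mulr_gt0.
have vi : v ^+ i * (4 * M) ^+ i = 1.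
  by rewrite -exprMn /v mulVf ?expr1n // mulf_neq0 ?gt_eqF.
have H2 : (`|d| + v) ^+ j * M ^+ j <= (1 / 2) ^+ j.
  rewrite -exprMn; apply: lerXn2r; rewrite ?nnegrE; last first.
  - have : v * M = 1 / 4 by rewrite /v; field; rewrite gt_eqF.
    by rewrite mulrDl; move: dM; lra.
  - lra.
  - by rewrite mulr_ge0 ?addr_ge0 // ltW.
rewrite !normrM normrX [`|_%:R|]ger0_norm //.
apply: (@le_trans _ _ (K * M ^+ j * 'C(j, i)%:R * `|d| ^+ (j - i))).
  by rewrite !ler_wpM2r // ?exprn_ge0.
apply: (@le_trans _ _ (K * (4 * M) ^+ i * ((`|d| + v) ^+ j * M ^+ j))); last first.
  by rewrite ler_wpM2l // mulr_ge0 // ltW.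
have -> : K * M ^+ j * 'C(j, i)%:R * `|d| ^+ (j - i) =
    K * (4 * M) ^+ i * (('C(j, i)%:R * `|d| ^+ (j - i) * v ^+ i) * M ^+ j).
  transitivity (K * M ^+ j * 'C(j, i)%:R * `|d| ^+ (j - i) * (v ^+ i * (4 * M) ^+ i)).
    by rewrite vi mulr1.
  by ring.
rewrite ler_wpM2l ?mulr_ge0 ?(ltW M4) // ler_wpM2r //.
by rewrite exprn_ge0 // ltW.
Qed.

Lemma reexpansion_cvg i :
  series (fun j => e j * 'C(j, i)%:R * d ^+ (j - i)) @ \oo --> reexpansion e d i.
Proof.
apply: (@geometric_dominated_cvg _ _ (K * (4 * M) ^+ i) (1 / 2)).
  by apply/andP; split; lra.
by move=> j; exact: reexpansion_term.
Qed.

Lemma reexpansion_bound i : `|reexpansion e d i| <= 2 * K * (4 * M) ^+ i.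
Proof.
have h01 : 0 <= (1 / 2 : R) < 1 by apply/andP; split; lra.
have := geometric_dominated_lim 0 h01 (reexpansion_term i).
rewrite {2}/series /= big_geq // subr0 expr0 mulr1 => /le_trans; apply.
by rewrite le_eqVlt; apply/orP; left; apply/eqP; field; lra.
Qed.

(** Expand (d + h)^j by the binomial theorem and exchange the two sums, which is
    allowed since M (|d| + |h|) <= 1/2. *)
Lemma reexpansion_expands phi y : expands phi y e K M ->
  expands phi (y + d) (reexpansion e d) (2 * K) (4 * M).
Proof.
move=> [_ eS]; split=> [i|h hM]; first exact: reexpansion_bound.
have hM' : `|h| * M <= 1 / 4 by move: hM; lra.
pose b j i := K * M ^+ j * ('C(j, i)%:R * `|d| ^+ (j - i) * `|h| ^+ i).
have dh0 : 0 <= `|d| + `|h| by rewrite addr_ge0.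
have t01 : 0 <= (`|d| + `|h|) * M < 1.
  by rewrite mulr_ge0 ?(ltW M0) //= mulrDl; move: dM; lra.
have := @series_interchange R
  (fun j i => e j * 'C(j, i)%:R * d ^+ (j - i) * h ^+ i) b
  (fun j => e j * (d + h) ^+ j) (fun j => K * ((`|d| + `|h|) * M) ^+ j).
case.
- move=> j i; rewrite !normrM !normrX [`|_%:R|]ger0_norm // /b !mulrA.
  by rewrite !ler_wpM2r // ?exprn_ge0.
- move=> j J; rewrite exprMn [_ * M ^+ j]mulrC mulrA /b /series /= -mulr_sumr.
  rewrite ler_wpM2l ?mulr_ge0 ?exprn_ge0 ?(ltW M0) // exprDn.
  apply: (@le_trans _ _ (\sum_(0 <= i < maxn J j.+1)
      'C(j, i)%:R * `|d| ^+ (j - i) * `|h| ^+ i)).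
    rewrite [leRHS](@big_cat_nat _ _ _ J) ?leq_maxl //= lerDl.
    by apply: sumr_ge0 => i _; rewrite !mulr_ge0 ?exprn_ge0.
  rewrite (@big_cat_nat _ _ _ j.+1) ?leq_maxr //= [X in _ + X]big_nat_cond.
  rewrite [X in _ + X]big1 ?addr0; last first.
    by move=> i /andP[/andP[ji _] _]; rewrite bin_small // !mul0r.
  rewrite big_mkord; apply: ler_sum => i _.
  by rewrite -mulrA mulr_natl.
- apply: (@is_cvg_geometric_series _ K ((`|d| + `|h|) * M)).
  by case/andP: t01 => t0 t1; rewrite ger0_norm.
- move=> j; apply: cvg_near_cst; exists j.+1 => // J /= jJ.
  rewrite exprDn /series /= (@big_cat_nat _ _ _ j.+1) //= [X in _ + X]big_nat_cond.
  rewrite [X in _ + X]big1 ?addr0; last first.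
    by move=> i /andP[/andP[ji _] _]; rewrite bin_small // !(mulr0, mul0r).
  rewrite big_mkord mulr_sumr; apply: eq_bigr => i _.
  by rewrite -[_ *+ 'C(j, i)]mulr_natl; ring.
move=> _.
have -> : limn (series (fun j => e j * (d + h) ^+ j)) = phi (y + d + h).
  apply: cvg_lim => //; rewrite -addrA; apply: eS.
  apply: (@le_trans _ _ ((`|d| + `|h|) * M)); last by case/andP: t01 => _ /ltW.
  by rewrite ler_wpM2r ?(ltW M0) // ler_normD.
apply: cvg_trans; apply: near_eq_cvg; near=> J.
congr (series _ J); apply/funext => i.
apply/cvg_lim => //.
rewrite (_ : series _ =
  fun N => series (fun j => e j * 'C(j, i)%:R * d ^+ (j - i)) N * h ^+ i).
  by apply: cvgMr_tmp; exact: reexpansion_cvg.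
by apply/funext => N; rewrite /series /= mulr_suml.
Unshelve. all: by end_near.
Qed.

End reexpand.

Lemma expands_near phi y e K M h : 0 <= K -> 0 <= M -> expands phi y e K M ->
  `|h| * M <= 1 / 2 -> `|phi (y + h) - e 0%N| <= 2 * K * (`|h| * M).
Proof.
move=> K0 M0 [eB eS] hM.
have hM0 : 0 <= `|h| * M by rewrite mulr_ge0.
have t01 : 0 <= `|h| * M < 1 by rewrite hM0 /=; lra.
have aB j : `|e j * h ^+ j| <= K * (`|h| * M) ^+ j.
  rewrite normrM normrX exprMn [`|h| ^+ j * _]mulrC mulrA.
  by rewrite ler_wpM2r ?exprn_ge0.
have := geometric_dominated_lim 1 t01 aB.
rewrite (cvg_lim _ (eS h _)) //; last lra.
rewrite {1}/series /= big_nat1 expr0 mulr1 expr1 => /le_trans; apply.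
rewrite ler_pdivrMr; last lra.
rewrite [2 * K * _ * _](_ : _ = (2 * (1 - `|h| * M)) * (K * (`|h| * M))); last by ring.
by rewrite ler_peMl ?mulr_ge0 //; lra.
Qed.

Lemma expands0 phi y e K M : expands phi y e K M -> e 0%N = phi y.
Proof.
move=> [_ /(_ 0)]; rewrite normr0 mul0r addr0 => /(_ ler01) H.
apply/esym/(cvg_unique _ H) => //; apply: cvg_near_cst; exists 1%N => // J /= J1.
rewrite /series /= big_ltn // expr0 mulr1 big_nat_cond big1 ?addr0 // => i.
by move=> /andP[/andP[i1 _] _]; rewrite expr0n; case: i i1 => // i _; rewrite mulr0.
Qed.

(** If the coefficients agree below i, then dividing the difference of the two
    series by h^i leaves the difference of the i-th coefficients plus O(h). *)
Lemma expands_uniq phi y e e' K M : 0 <= K -> 0 < M ->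
  expands phi y e K M -> expands phi y e' K M -> forall i, e i = e' i.
Proof.
move=> K0 M0 [eB eS] [eB' eS'] i; apply/eqP; rewrite -subr_eq0; apply/eqP.
pose u j := e j - e' j; rewrite -/(u i).
have [N] := ubnP i; elim: N i => // N IH i; rewrite ltnS => iN.
have uB j : `|u j| <= 2 * K * M ^+ j.
  rewrite (le_trans (ler_normB _ _)) //.
  by have := eB j; have := eB' j; move: (M ^+ j) => v; lra.
have key h : 0 < h -> h * M <= 1 / 2 -> `|u i| <= 4 * K * M ^+ i.+1 * h.
  move=> h0 hM.
  have t01 : 0 <= h * M < 1 by rewrite mulr_ge0 ?(ltW h0) ?(ltW M0) //=; lra.
  have aB j : `|u j * h ^+ j| <= 2 * K * (h * M) ^+ j.
    rewrite normrM normrX exprMn (gtr0_norm h0) [h ^+ j * _]mulrC mulrA.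
    by rewrite ler_wpM2r ?exprn_ge0 // ltW.
  have := geometric_dominated_lim i.+1 t01 aB.
  have -> : limn (series (fun j => u j * h ^+ j)) = 0.
    apply: cvg_lim => //; rewrite -(subrr (phi (y + h))).
    have hM1 : `|h| * M <= 1 by rewrite gtr0_norm //; lra.
    have -> : series (fun j => u j * h ^+ j) = (fun J =>
        series (fun j => e j * h ^+ j) J - series (fun j => e' j * h ^+ j) J).
      apply/funext => J; rewrite /series /= -sumrB.
      by apply: eq_bigr => j _; rewrite mulrBl.
    by apply: cvgB; [exact: eS|exact: eS'].
  rewrite /series /= big_nat_recr //= big_nat_cond big1 ?add0r; last first.
    move=> j /andP[/andP[_ ji] _]; rewrite IH ?mul0r //.
    exact: leq_trans iN.
  rewrite ?add0r normrN normrM normrX (gtr0_norm h0) => H.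
  have hi : 0 < h ^+ i by rewrite exprn_gt0.
  rewrite -(ler_pM2r hi); apply: le_trans H _.
  rewrite ler_pdivrMr; last lra.
  rewrite [leRHS](_ : _ = (2 * (1 - h * M)) * (2 * K * (h * M) ^+ i.+1)); last first.
    by rewrite exprMn [h ^+ i.+1]exprS; ring.
  by rewrite ler_peMl ?mulr_ge0 ?exprn_ge0 ?(ltW h0) ?(ltW M0) //; lra.
apply/eqP; rewrite -normr_eq0; apply/eqP/le_anti; rewrite normr_ge0 andbT.
apply/ler_addgt0Pl => eps eps0; rewrite addr0.
pose C := 4 * K * M ^+ i.+1.
have C0 : 0 <= C by rewrite !mulr_ge0 ?exprn_ge0 // ltW.
pose h := Num.min (1 / (2 * M)) (eps / (C + 1)).
have C1 : 0 < C + 1 by lra.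
have h0 : 0 < h by rewrite lt_min !divr_gt0 // mulr_gt0.
apply: le_trans (key h h0 _) _.
  apply: (@le_trans _ _ (1 / (2 * M) * M)).
    by rewrite ler_wpM2r ?(ltW M0) // /h ge_min lexx.
  by rewrite le_eqVlt; apply/orP; left; apply/eqP; field; rewrite gt_eqF.
apply: (@le_trans _ _ (C * (eps / (C + 1)))).
  by rewrite -/C ler_wpM2l // /h ge_min lexx orbT.
rewrite mulrA ler_pdivrMr // mulrC ler_wpM2l ?(ltW eps0) //; lra.
Qed.

(** For real arguments the real part of g is given by the real parts of its
    Taylor coefficients; this extends f to a neighbourhood of the interval
    without any reference to the imaginary direction. *)
Definition real_trace (g : R[i]^o -> R[i]^o) (t : R) : R := complex.Re (g t%:C%C).

Lemma Re_mul_real (z : R[i]) (t : R) : complex.Re (z * t%:C%C) = complex.Re z * t.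
Proof. by rewrite complexM_ReIm /= mulr0 subr0. Qed.

Lemma analytic_at_expands g x : analytic_at g x%:C%C ->
  exists e K M, [/\ 0 <= K, 0 < M & expands (real_trace g) x e K M].
Proof.
move=> [c /near_modcP[r r0 H]].
pose e n := complex.Re (c n).
have S h : `|h| < r -> series (fun n => e n * h ^+ n) @ \oo --> real_trace g (x + h).
  move=> hr; have := H (x + h)%:C%C; rewrite rmorphD /= addrAC subrr add0r.
  rewrite modc_real => /(_ hr) /cvg_complexP[+ _].
  rewrite /real_trace rmorphD /=.
  apply: cvg_trans; apply: near_eq_cvg; near=> J.
  rewrite /series /= Re_sum; apply: eq_bigr => n _.
  by rewrite -rmorphXn /= Re_mul_real.
pose h0 := r / 2.
have h00 : 0 < h0 by rewrite divr_gt0.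
have h0r : `|h0| < r by rewrite gtr0_norm // /h0; lra.
have /cvg_seq_bounded[K' [_ HK]] : cvgn (fun n => e n * h0 ^+ n).
  by apply: cvgP; apply: cvg_series_cvg_0; apply: cvgP; exact: S h0r.
exists e, (`|K'| + 1), h0^-1; split; [by rewrite addr_ge0|by rewrite invr_gt0|split].
  move=> n; have : `|e n * h0 ^+ n| <= `|K'| + 1.
    apply: HK => //; rewrite (le_lt_trans (ler_norm _)) // ltrDl //.
  rewrite normrM normrX (gtr0_norm h00) exprVn => Hn.
  by rewrite ler_pdivlMr // exprn_gt0.
move=> h; rewrite ler_pdivrMr // mul1r => hh0; apply: S.
by apply: le_lt_trans hh0 _; rewrite -[h0]gtr0_norm.
Unshelve. all: by end_near.
Qed.

(** The statement has the form needed for a compactness argument: all data are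
    controlled by the single integer n. *)
Lemma expansions_near phi e x K M : 0 <= K -> 0 < M -> expands phi x e K M ->
  0 < phi x < 1 ->
  exists N : nat, forall n y, (N <= n)%N -> `|y - x| * N.+1%:R <= 2 ->
    (exists e', expands phi y e' n.+1%:R n.+1%:R) /\
    n.+1%:R^-1 <= phi y <= 1 - n.+1%:R^-1.
Proof.
move=> K0 M0 xe /andP[p0 p1].
pose m := Num.min (phi x) (1 - phi x).
have m0 : 0 < m by rewrite lt_min p0 subr_gt0.
(* one summand for each of: the new K, the new M, the variation of phi, and
   the distance of phi to 0 and 1 *)
pose B := 2 * K + 8 * M + 8 * K * M / m + 2 / m.
have M4 : 0 <= 8 * K * M / m by rewrite !mulr_ge0 ?invr_ge0 // ltW.
have m4 : 0 <= 2 / m by rewrite divr_ge0 // ltW.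
exists (Num.truncn B) => n y Nn yx.
set d := y - x in yx.
have BN : B < (Num.truncn B).+1%:R by exact: truncnS_gt.
have Bn : B < n.+1%:R by apply: lt_le_trans BN _; rewrite ler_nat.
have dB : `|d| * B <= 2 by apply: le_trans yx; rewrite ler_wpM2l // ltW.
have dM : `|d| * (8 * M) <= 2.
  by apply: le_trans dB; rewrite ler_wpM2l // /B; lra.
have yE : y = x + d by rewrite /d addrC subrK.
split.
  exists (reexpansion e d); rewrite yE.
  apply: (@expands_weaken _ _ _ (2 * K) (4 * M)).
  - by rewrite mulr_ge0.
  - by rewrite mulr_ge0 // ltW.
  - by apply: ltW; apply: le_lt_trans Bn; rewrite /B; lra.
  - by apply: ltW; apply: le_lt_trans Bn; rewrite /B; lra.
  - by apply: reexpansion_expands => //; [case: xe|lra].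
have n0 : 0 < n.+1%:R :> R by [].
have nm : n.+1%:R^-1 <= m / 2.
  rewrite -[leLHS]mul1r ler_pdivrMr // mulrAC ler_pdivlMr // mul1r mulrC.
  by rewrite -ler_pdivrMr //; apply: ltW; apply: le_lt_trans Bn; rewrite /B; lra.
have := expands_near K0 (ltW M0) xe (h := d).
rewrite (expands0 xe) -yE => /(_ _)/wrap[]; first by lra.
have : `|d| * (8 * K * M / m) <= 2.
  by apply: le_trans dB; rewrite ler_wpM2l // /B; lra.
rewrite mulrA ler_pdivrMr // => H1 H2.
have : `|phi y - phi x| <= m / 2 by apply: le_trans H2 _; lra.
have : m <= phi x by rewrite ge_min lexx.
have : m <= 1 - phi x by rewrite ge_min lexx orbT.
rewrite ler_norml; clearbody m; move: (n.+1%:R^-1) nm => z.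
by move=> ? ? ? /andP[? ?]; apply/andP; split; lra.
Qed.

(** Compactness of [a, b] makes the constants uniform.  Coefficients are chosen
    at each point separately; by uniqueness of expansions they are nevertheless
    related by [reexpansion] as soon as two centres are close. *)
Theorem coherent_expansions (a b : R) (f : R -> R) : a <= b ->
  (forall p, a <= p <= b -> 0 < f p < 1) -> real_analytic_on `[a, b] f ->
  exists (n : nat) (co : R -> nat -> R),
    let N : R := n.+1%:R in let J := [set y | a - N^-1 <= y <= b + N^-1] in
    [/\ forall y j, J y -> `|co y j| <= N * N ^+ j,
        forall x y i, J x -> J y -> `|y - x| * N <= 1 / 4 ->
          series (fun j => co x j * 'C(j, i)%:R * (y - x) ^+ (j - i)) @ \oo --> co y i,
        forall y, J y -> N^-1 <= co y 0%N <= 1 - N^-1 &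
        forall p, a <= p <= b -> co p 0%N = f p].
Proof.
move=> ab f01 [D [g [oD DI anD gf]]].
pose phi := real_trace g.
have phif p : a <= p <= b -> phi p = f p.
  by move=> pI; rewrite /phi /real_trace gf //= in_itv.
pose P (n : nat) x := forall y, `|y - x| * n.+1%:R <= 1 ->
  (exists e, expands phi y e n.+1%:R n.+1%:R) /\
  n.+1%:R^-1 <= phi y <= 1 - n.+1%:R^-1.
have cov : \forall n \near \oo, `[a, b]%classic `<=` P n.
  apply: (compact_near_coveringP _).1; first exact: segment_compact.
  move=> x xI; have xI' : a <= x <= b by move: xI; rewrite /= in_itv.
  have [e [K [M [K0 M0 xe]]]] := analytic_at_expands (anD _ (DI _ xI)).
  have px : 0 < phi x < 1 by rewrite phif // f01.
  have [N HN] := expansions_near K0 M0 xe px.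
  have nx : \forall x' \near x, `|x' - x| * N.+1%:R <= 1.
    apply/nbhs_normP; exists N.+1%:R^-1; first by rewrite /= invr_gt0.
    by move=> z /=; rewrite distrC -ler_pdivlMr // mul1r => /ltW.
  near=> x' n => y yx'.
  have Nn : (N <= n)%N by near: n; exists N.
  apply: (HN n y Nn).
  have h1 : `|y - x'| * N.+1%:R <= 1.
    by apply: le_trans yx'; rewrite ler_wpM2l // ler_nat.
  have h2 : `|x' - x| * N.+1%:R <= 1 by near: x'; exact: nx.
  rewrite -(subrKA x') (le_trans (ler_wpM2r _ (ler_normD _ _))) // mulrDl.
  by lra.
case: cov => n _ /(_ n (leqnn n)) Hn.
have Jexp y : a - n.+1%:R^-1 <= y <= b + n.+1%:R^-1 ->
    (exists e, expands phi y e n.+1%:R n.+1%:R) /\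
    n.+1%:R^-1 <= phi y <= 1 - n.+1%:R^-1.
  move=> /andP[ay yb].
  have n0 : 0 < n.+1%:R :> R by [].
  have r0 : 0 < n.+1%:R^-1 :> R by rewrite invr_gt0.
  (* compare y with the point of [a, b] nearest to it *)
  case: (ltP y a) => [ya|ya].
    apply: (Hn a); first by rewrite /= in_itv /= lexx.
    rewrite -ler_pdivlMr // mul1r ler_norml.
    by move: (n.+1%:R^-1) r0 ay yb => r *; apply/andP; split; lra.
  case: (ltP b y) => [yb'|yb'].
    apply: (Hn b); first by rewrite /= in_itv /= lexx andbT.
    rewrite -ler_pdivlMr // mul1r ler_norml.
    by move: (n.+1%:R^-1) r0 ay yb => r *; apply/andP; split; lra.
  apply: (Hn y); first by rewrite /= in_itv /= ya.
  by rewrite subrr normr0 mul0r.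
have [co Hco] : {co : R -> nat -> R & forall y,
    a - n.+1%:R^-1 <= y <= b + n.+1%:R^-1 -> expands phi y (co y) n.+1%:R n.+1%:R}.
  apply: (@choice R _ (fun y e => a - n.+1%:R^-1 <= y <= b + n.+1%:R^-1 ->
    expands phi y e n.+1%:R n.+1%:R)) => y.
  case: (boolP (a - n.+1%:R^-1 <= y <= b + n.+1%:R^-1)) => [/Jexp[[e He] _]|_].
    by exists e.
  by exists (fun=> 0).
have N0 : 0 < n.+1%:R :> R by [].
exists n, co; split=> [y j /Hco[]//|x y i Jx Jy yx|y Jy|p pI].
- have ex := Hco _ Jx; have eB := ex.1.
  have -> : co y i = reexpansion (co x) (y - x) i.
    apply: (@expands_uniq phi y _ _ (2 * n.+1%:R) (4 * n.+1%:R)).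
    + by rewrite mulr_ge0.
    + by rewrite mulr_gt0.
    + by apply: expands_weaken (Hco _ Jy); rewrite ?ler_peMl ?ler1n.
    + have := @reexpansion_expands _ _ _ (y - x) (ltW N0) N0 eB yx _ x ex.
      by rewrite addrC subrK.
  exact: (reexpansion_cvg (ltW N0) N0 eB yx).
- by rewrite (expands0 (Hco _ Jy)); have [] := Jexp _ Jy.
- rewrite (expands0 (Hco _ _)) ?phif //.
  have r0 : 0 < n.+1%:R^-1 :> R by rewrite invr_gt0.
  by move: (n.+1%:R^-1) r0 => r ?; case/andP: pI => ? ?; apply/andP; split; lra.
Unshelve. all: by end_near.
Qed.

End local_expansions.

(** * Bernstein coefficients of polynomials *)

Section bernstein_coefficients.
Variable R : realType.
Implicit Types (P Q : {poly R}) (x y s : R).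

(** The monomial X^i has Bernstein coefficients k^_i / n^_i in degree n, that is,
    the probability that i tosses drawn without replacement from n tosses with k
    ones are all ones. *)
Definition bcoef n k Q : R :=
  \sum_(i < size Q) Q`_i * ((k ^_ i)%:R / (n ^_ i)%:R).

Lemma bcoef_wide N n k Q : (size Q <= N)%N ->
  bcoef n k Q = \sum_(i < N) Q`_i * ((k ^_ i)%:R / (n ^_ i)%:R).
Proof.
move=> QN; rewrite /bcoef.
rewrite (big_ord_widen _ (fun i => Q`_i * ((k ^_ i)%:R / (n ^_ i)%:R)) QN).
rewrite big_mkcond; apply: eq_bigr => i _; case: ltnP => // Qi.
by rewrite nth_default // mul0r.
Qed.

Lemma bcoef_is_linear n k : linear (bcoef n k : {poly R} -> R^o).
Proof.
move=> a P Q; pose N := maxn (size (a *: P + Q)) (maxn (size P) (size Q)).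
rewrite (@bcoef_wide N _ _ (_ + _)) ?leq_maxl //.
rewrite (@bcoef_wide N _ _ P); last by rewrite /N !leq_max leqnn !orbT.
rewrite (@bcoef_wide N _ _ Q); last by rewrite /N !leq_max leqnn !orbT.
rewrite scaler_sumr -big_split; apply: eq_bigr => i _ /=.
by rewrite coefD coefZ mulrDl -mulrA.
Qed.

HB.instance Definition _ n k :=
  GRing.isLinear.Build R {poly R} R^o _ (bcoef n k) (@bcoef_is_linear n k).

Lemma bcoefZ n k a Q : bcoef n k (a *: Q) = a * bcoef n k Q.
Proof. exact: linearZ. Qed.

Lemma bcoef1 n k : bcoef n k 1 = 1.
Proof.
by rewrite /bcoef size_poly1 big_ord1 coef1 mul1r !ffactn0 divr1.
Qed.

(** Degree elevation; it suffices to check it on monomials of degree at most n,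
    for which the falling factorial n^_i does not vanish. *)
Lemma bcoef_avg n k Q : (size Q <= n.+1)%N ->
  bcoef n.+1 k Q = avg (fun n k => bcoef n k Q) n k.
Proof.
move=> Qn; rewrite /avg !(bcoef_wide _ _ Qn) !mulr_sumr -big_split.
apply: eq_bigr => -[i /= i_n] _.
have n1 : n.+1%:R != 0 :> R by rewrite pnatr_eq0.
have nN : (n ^_ i)%:R != 0 :> R by rewrite pnatr_eq0 -lt0n ffact_gt0.
have n1N : (n.+1 ^_ i)%:R != 0 :> R by rewrite pnatr_eq0 -lt0n ffact_gt0 ltnW.
have E1 : (n.+1 ^_ i)%:R * (n.+1%:R - i%:R) = n.+1%:R * (n ^_ i)%:R :> R.
  by rewrite -natrB ?(ltnW i_n) // -!natrM -ffactnSr ffactSS.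
have E2 : k%:R * (k.-1 ^_ i)%:R = (k ^_ i)%:R * (k%:R - i%:R) :> R.
  rewrite -natrM -ffactnS ffactnSr natrM; case: (leqP i k) => ik.
    by rewrite natrB.
  by rewrite ffact_small // !mul0r.
rewrite [RHS](_ : _ = Q`_i * ((k%:R * (k.-1 ^_ i)%:R
    + (n.+1%:R - k%:R) * (k ^_ i)%:R) / (n.+1%:R * (n ^_ i)%:R))); last first.
  by move: n.+1%:R n1 nN => N N0; move: (n ^_ i)%:R => M M0; field; rewrite M0 N0.
congr (_ * _); rewrite E2 -E1.
have ni : n.+1%:R - i%:R != 0 :> R by rewrite subr_eq0 eqr_nat gtn_eqF.
move: n1N ni; move: (n.+1 ^_ i)%:R (k ^_ i)%:R n.+1%:R i%:R k%:R => A B C D E A0 C0.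
by field; rewrite A0 C0.
Qed.

Lemma bcoefMX n k Q :
  bcoef n.+1 k ('X * Q) = k%:R / n.+1%:R * bcoef n k.-1 Q.
Proof.
have sz : (size ('X * Q)%R <= (size Q).+1)%N.
  by rewrite mulrC; case: (eqVneq Q 0) => [->|Q0];
    rewrite ?mul0r ?size_poly0 // size_mulX.
rewrite (bcoef_wide _ _ sz) big_ord_recl coefXM mul0r add0r mulr_sumr.
apply: eq_bigr => i _; rewrite coefXM /= /bump /= add1n /=.
rewrite ffactnS ffactSS !natrM invfM; ring.
Qed.

Lemma bcoef_diff n k Q :
  bcoef n.+1 k.+1 Q - bcoef n.+1 k Q = n.+1%:R^-1 * bcoef n k Q^`().
Proof.
have sz : (size Q^`() <= size Q)%N.
  by rewrite /deriv (leq_trans (size_poly _ _)) // leq_pred.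
have sz1 : (size Q <= (size Q).+1)%N by [].
rewrite !(bcoef_wide _ _ sz1) -sumrB big_ord_recl !ffactn0 subrr add0r.
rewrite (bcoef_wide _ _ sz) mulr_sumr; apply: eq_bigr => i _.
rewrite coef_deriv !lift0 -mulrBr -mulrBl !ffactSS.
rewrite (natrM _ k.+1) (natrM _ n.+1) invfM.
have -> : k.+1%:R * (k ^_ i)%:R - (k ^_ i.+1)%:R = i.+1%:R * (k ^_ i)%:R :> R.
  rewrite ffactnSr natrM; case: (leqP i k) => ik.
    by rewrite natrB // -!natr1; ring.
  by rewrite ffact_small // !(mul0r, mulr0) subr0.
by rewrite -mulr_natr; ring.
Qed.

(** Degree elevation and [bcoefMX] express the left-hand side through two
    neighbouring coefficients of Q, and [bcoef_diff] replaces their difference by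
    a coefficient of the derivative, which carries the small factor 1 / (m + 1). *)
Lemma bcoef_three_term m k y Q (x := k.+1%:R / m.+2%:R) : (size Q <= m.+2)%N ->
  bcoef m.+2 k.+1 (('X - y%:P) * Q) =
  (x - y) * bcoef m.+1 k.+1 Q - x * (1 - y) / m.+1%:R * bcoef m k Q^`().
Proof.
move=> sQ; rewrite mulrBl raddfB /= bcoefMX mul_polyC bcoefZ (bcoef_avg k.+1 sQ) /avg /=.
by rewrite -/x -[x * _ / _ * _]mulrA -bcoef_diff /=; ring.
Qed.

(** Applied to Q = (X - y)^j, the three-term relation reads
    c_(j+1) = (x - y) c_j - O(j / n) c_(j-1), where |x - y| <= s / 2 and j / n is
    at most s^2 / 4; so s^j bounds c_j by induction.  The hypotheses are phrased
    so that they pass from (j + 1, n, k) to (j, n - 1, k) and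
    (j - 1, n - 2, k - 1). *)
Lemma bcoef_centered_bound y s j n k : 0 <= y <= 1 -> 0 < s <= 1 ->
  `|k%:R - y * n%:R| + j%:R <= s / 2 * (n%:R - j%:R) ->
  j%:R <= s ^+ 2 / 4 * (n%:R - j%:R) ->
  `|bcoef n k (('X - y%:P) ^+ j)| <= s ^+ j.
Proof.
move=> /andP[y0 y1] /andP[s0 s1].
have [N] := ubnP j; elim: N j n k => // N IH [|j] n k; rewrite ltnS => jN.
  by rewrite expr0 bcoef1 normr1.
move=> H1 H2.
have s20 : 0 < s ^+ 2 by rewrite exprn_gt0.
have s21 : s ^+ 2 <= 1 by rewrite exprn_ile1 // ltW.
have jn : (j.+2 <= n)%N.
  rewrite -(ler_nat R); move: H2; rewrite -[j.+2%:R]natr1 -[j.+1%:R]natr1.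
  have j0 : 0 <= j%:R :> R by [].
  move: (j%:R) (n%:R) j0 => J M J0 H.
  have M0 : 0 < M - (J + 1).
    by rewrite -(@pmulr_rgt0 _ (s ^+ 2 / 4)) ?divr_gt0 // (lt_le_trans _ H) // ltr_wpDl.
  by move: (s ^+ 2) s20 s21 H => u u0 u1 H; nra.
case: n jn H1 H2 => [|[|m]] // jn.
rewrite -[m.+2%:R]natr1 -[m.+1%:R]natr1 -[j.+1%:R]natr1 => H1 H2.
rewrite exprS.
have szQ : (size (('X - y%:P) ^+ j) <= m.+2)%N by rewrite size_exp_XsubC ltnW.
have j0 : 0 <= j%:R :> R by [].
have m0 : 0 <= m%:R :> R by [].
have mj : 0 < m%:R + 1 - j%:R :> R.
  rewrite -(@pmulr_rgt0 _ (s ^+ 2 / 4)) ?divr_gt0 //; lra.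
case: k H1 => [|k] H1.
  rewrite mulrBl raddfB /= bcoefMX !mul0r sub0r mul_polyC bcoefZ normrN normrM.
  rewrite (bcoef_avg 0 szQ) /avg !mul0r add0r subr0 mul1r exprS.
  move: H1; rewrite sub0r normrN normrM [`|y|]ger0_norm //.
  rewrite [`|_ + 1|]ger0_norm ?addr_ge0 // => H1.
  apply: ler_pM => //; first by nra.
  apply: IH => //; rewrite -?[m.+1%:R]natr1; last by nra.
  by rewrite sub0r normrN normrM !ger0_norm ?addr_ge0 //; nra.
have dQ : (('X - y%:P) ^+ j)^`() = ('X - y%:P) ^+ j.-1 *+ j.
  by rewrite deriv_exp derivXsubC mul1r.
rewrite bcoef_three_term // dQ raddfMn /=.
set x := k.+1%:R / _.
have xE : x * (m%:R + 1 + 1) = k.+1%:R.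
  by rewrite /x !natr1 mulfVK // pnatr_eq0.
have m2 : 0 < m%:R + 1 + 1 :> R by lra.
have xy : `|x - y| <= s / 2.
  rewrite -(ler_pM2r m2) -[X in `|_| * X]gtr0_norm // -normrM mulrBl xE.
  by nra.
have A1 : `|bcoef m.+1 k.+1 (('X - y%:P) ^+ j)| <= s ^+ j.
  apply: IH => //; rewrite -?[m.+1%:R]natr1; last by nra.
  have : `|k.+1%:R - y * (m%:R + 1)| <= `|k.+1%:R - y * (m%:R + 1 + 1)| + 1.
    have -> : k.+1%:R - y * (m%:R + 1) = (k.+1%:R - y * (m%:R + 1 + 1)) + y by ring.
    by rewrite (le_trans (ler_normD _ _)) // lerD2l ger0_norm.
  by move: H1; lra.
apply: le_trans (ler_normB _ _) _; rewrite normrM.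
have A2 : `|x - y| * `|bcoef m.+1 k.+1 (('X - y%:P) ^+ j)| <= s / 2 * s ^+ j.
  by apply: ler_pM.
suff A3 : `|x * (1 - y) / m.+1%:R * (bcoef m k (('X - y%:P) ^+ j.-1) *+ j)| <=
    s / 2 * s ^+ j by rewrite exprS; lra.
case: j jN H1 H2 szQ j0 mj jn dQ A1 A2 => [|j] jN H1 H2 szQ j0 mj jn dQ A1 A2.
  by rewrite mulr0n mulr0 normr0 expr0 mulr1 divr_ge0 // ltW.
rewrite -[j.+1%:R]natr1 in H1 H2 mj.
have A4 : `|bcoef m k (('X - y%:P) ^+ j)| <= s ^+ j.
  apply: IH; first by apply: leq_trans jN.
    have : `|k%:R - y * m%:R| <= `|k.+1%:R - y * (m%:R + 1 + 1)| + 1.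
      have -> : k%:R - y * m%:R = (k.+1%:R - y * (m%:R + 1 + 1)) + (2 * y - 1).
        by rewrite -[k.+1%:R]natr1; ring.
      rewrite (le_trans (ler_normD _ _)) // lerD2l ler_norml.
      by apply/andP; split; lra.
    by move: H1; lra.
  by move: H2; lra.
set b := bcoef m k _ in A4 *.
have -> : x * (1 - y) / m.+1%:R * (b *+ j.+1) =
    (x * (1 - y) * (m.+1%:R^-1 * j.+1%:R)) * b.
  by rewrite -mulr_natr; ring.
rewrite normrM exprS [s / 2 * _]mulrA.
apply: ler_pM => //.
have xb : `|x * (1 - y)| <= 2.
  rewrite normrM -[X in _ <= X]mulr1; apply: ler_pM => //.
    rewrite -(subrK y x) (le_trans (ler_normD _ _)) // [`|y|]ger0_norm //; lra.
  by rewrite ger0_norm ?subr_ge0 // lerBlDr lerDl.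
have jm : `|m.+1%:R^-1 * j.+1%:R| <= s ^+ 2 / 4.
  rewrite ger0_norm ?mulr_ge0 // mulrC ler_pdivrMr //.
  have := H2; rewrite -[j.+1%:R]natr1 -[m.+1%:R]natr1.
  move: (s ^+ 2) s20 => u u0; nra.
apply: (@le_trans _ _ (2 * (s ^+ 2 / 4))).
  by rewrite normrM; apply: ler_pM.
by rewrite expr2; lra.
Qed.

End bernstein_coefficients.

(** * Bernstein coefficients of Taylor polynomials with a moving centre *)

Section local_coefficients.
Variable R : realType.
(** co y is the sequence of Taylor coefficients at y.  The condition on M s makes
    s a small part of the radius of convergence, and the condition on q makes
    every j <= n / q admissible in [bcoef_centered_bound]. *)
Variables (co : R -> nat -> R) (J : set R) (K M s : R) (q : nat).
Hypothesis J01 : forall y, J y -> 0 < y < 1.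
Hypotheses (K0 : 0 <= K) (M0 : 0 <= M) (s0 : 0 < s) (s1 : s <= 1).
Hypothesis Ms : M * s <= 1 / 8.
Hypothesis co_bound : forall y j, J y -> `|co y j| <= K * M ^+ j.
Hypothesis co_shift : forall x y i, J x -> J y -> `|y - x| <= s ->
  series (fun j => co x j * 'C(j, i)%:R * (y - x) ^+ (j - i)) @ \oo --> co y i.
Hypothesis qs : 16 <= q%:R * s ^+ 2.

Definition taylor_poly y d : {poly R} :=
  \sum_(j < d) co y j *: ('X - y%:P) ^+ j.

Lemma bcoef_taylor_poly n k y d : bcoef n k (taylor_poly y d) =
  \sum_(j < d) co y j * bcoef n k (('X - y%:P) ^+ j).
Proof. by rewrite /taylor_poly raddf_sum; apply: eq_bigr => j _; rewrite /= bcoefZ. Qed.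

Lemma size_taylor_poly y d : (size (taylor_poly y d) <= d)%N.
Proof.
apply: (leq_trans (size_sum _ _ _)); apply/bigmax_leqP => j _.
by rewrite (leq_trans (size_scale_leq _ _)) // size_exp_XsubC.
Qed.

(** The degree cap n / q keeps the Taylor terms within the range of
    [bcoef_centered_bound], and still makes the truncation error exponentially
    small in n. *)
Definition local_coef n k : R := bcoef n k (taylor_poly (k%:R / n%:R) (n %/ q)).

Lemma q_gt0 : (0 < q)%N.
Proof.
rewrite lt0n; apply/negP => /eqP q0; move: qs; rewrite q0 mul0r; lra.
Qed.

Lemma geometric_sum_le2 d (t : R) : 0 <= t <= 1 / 2 -> \sum_(j < d) t ^+ j <= 2.
Proof.
move=> /andP[t0 t1].
suff : \sum_(j < d) t ^+ j <= 2 - 2 * t ^+ d.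
  by move/le_trans; apply; rewrite gerBl mulr_ge0 // exprn_ge0.
elim: d => [|d IH]; first by rewrite big_ord0 expr0; lra.
rewrite big_ord_recr /= exprS.
have td : 0 <= t ^+ d by rewrite exprn_ge0.
by move: IH; move: (\sum_(i < d) _) (t ^+ d) td => S u u0; nra.
Qed.

Lemma nat_le_expr2 (j : nat) : j%:R <= 2 ^+ j :> R.
Proof. by rewrite -natrX ler_nat ltnW // ltn_expl. Qed.

Lemma bin_le_exp2 n k : ('C(n, k) <= 2 ^ n)%N.
Proof.
elim: n k => [|n IH] [|k]; rewrite ?bin0 ?expn_gt0 // binS expnS mul2n -addnn.
exact: leq_add.
Qed.

Lemma near_center_bound n k y j : 0 <= y <= 1 ->
  `|k%:R - y * n%:R| <= 2 -> 8 <= n%:R * s -> (q * j <= n)%N ->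
  `|bcoef n k (('X - y%:P) ^+ j)| <= s ^+ j.
Proof.
move=> y01 kn ns; rewrite -(ler_nat R) natrM => qj.
have s2 : 0 < s ^+ 2 by rewrite exprn_gt0.
have ss : s ^+ 2 <= s by rewrite expr2 ler_piMl // ltW.
have j0 : 0 <= j%:R :> R by [].
have jn : 16 * j%:R <= s ^+ 2 * n%:R.
  apply: (@le_trans _ _ (q%:R * s ^+ 2 * j%:R)); first by rewrite ler_wpM2r.
  by rewrite mulrAC mulrC ler_wpM2l // ltW.
have n0 : 0 <= n%:R :> R by [].
have sn : s ^+ 2 * n%:R <= s * n%:R by rewrite ler_wpM2r.
have sn1 : s * n%:R <= n%:R by rewrite ler_piMl.
have sj : s * j%:R <= j%:R by rewrite ler_piMl.
have s2j : s ^+ 2 * j%:R <= s * j%:R by rewrite ler_wpM2r.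
apply: bcoef_centered_bound => //; first by rewrite s0.
  rewrite mulrBr; lra.
rewrite mulrBr; lra.
Qed.

(** Expanding around y, the coefficient of (X - y)^i on the left is the partial
    sum up to d of a series whose sum is co y i.  The remainder, multiplied by
    s^i, is at most 2 K (2 M s)^d for each i < d, and 2 M s <= 1/4. *)
Lemma taylor_poly_change_center n k x y d : J x -> J y -> `|y - x| <= s ->
  (forall i, (i < d)%N -> `|bcoef n k (('X - y%:P) ^+ i)| <= s ^+ i) ->
  `|bcoef n k (taylor_poly x d) - bcoef n k (taylor_poly y d)| <= 2 * K * (1 / 2) ^+ d.
Proof.
move=> Jx Jy yx H.
pose m i := bcoef n k (('X - y%:P) ^+ i).
pose a i j := co x j * 'C(j, i)%:R * (y - x) ^+ (j - i).
have t01 : 0 <= 2 * (M * s) < 1.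
  by rewrite mulr_ge0 ?mulr_ge0 ?(ltW s0) //=; move: Ms; lra.
have E : bcoef n k (taylor_poly x d) = \sum_(i < d) m i * series (a i) d.
  rewrite bcoef_taylor_poly /series /=.
  under [RHS]eq_bigr do rewrite big_mkord mulr_sumr.
  rewrite exchange_big /=; apply: eq_bigr => j _.
  have -> : 'X - x%:P = (y - x)%:P + ('X - y%:P) :> {poly R}.
    by rewrite polyCB; ring.
  rewrite exprDn raddf_sum /= mulr_sumr.
  rewrite (big_ord_widen d (fun i => co x j * bcoef n k
    ((y - x)%:P ^+ (j - i) * ('X - y%:P) ^+ i *+ 'C(j, i)))) //.
  rewrite big_mkcond; apply: eq_bigr => i _; rewrite ltnS.
  case: leqP => ij; last by rewrite /a bin_small // !(mulr0, mul0r).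
  rewrite raddfMn /= -polyC_exp mul_polyC bcoefZ /a -/(m i) -mulr_natr; ring.
rewrite E bcoef_taylor_poly -sumrB.
have aB i j : `|a i j| <= K / s ^+ i * (2 * (M * s)) ^+ j.
  rewrite /a; case: (leqP i j) => ij; last first.
    rewrite bin_small // mulr0 mul0r normr0 mulr_ge0 ?exprn_ge0 //.
      by rewrite divr_ge0 // exprn_ge0 // ltW.
    by case/andP: t01.
  rewrite !normrM normrX.
  have -> : K / s ^+ i * (2 * (M * s)) ^+ j = K * M ^+ j * 2 ^+ j * s ^+ (j - i).
    have sj : s ^+ j = s ^+ (j - i) * s ^+ i by rewrite -exprD subnK.
    rewrite !exprMn sj.
    have : s ^+ i != 0 by rewrite expf_neq0 // gt_eqF.
    by move: (s ^+ i) => u u0; field.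
  apply: ler_pM => //; first by apply: ler_pM => //; [exact: co_bound|
    rewrite ger0_norm // -natrX ler_nat; exact: bin_le_exp2].
  by apply: lerXn2r; rewrite ?nnegrE // ltW.
have [t0 t1] := andP t01.
have d2 : d%:R * (2 * (M * s)) ^+ d <= (1 / 2) ^+ d :> R.
  apply: (@le_trans _ _ (2 ^+ d * (1 / 4) ^+ d)); last first.
    by rewrite -exprMn (_ : 2 * (1 / 4) = 1 / 2) //; field.
  apply: ler_pM; rewrite ?exprn_ge0 //; first exact: nat_le_expr2.
  by apply: lerXn2r; rewrite ?nnegrE //; move: Ms; lra.
apply: (@le_trans _ _ (\sum_(i < d) 2 * K * (2 * (M * s)) ^+ d)).
  apply: le_trans (ler_norm_sum _ _ _) _; apply: ler_sum => i _.
  have := geometric_dominated_lim d t01 (aB i).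
  rewrite (cvg_lim _ (@co_shift x y i Jx Jy yx)) // => T.
  rewrite [co y i * _]mulrC -/(m i) -mulrBr normrM distrC.
  have si : 0 < s ^+ i by rewrite exprn_gt0.
  have -> : 2 * K * (2 * (M * s)) ^+ d =
      s ^+ i * (2 * (K / s ^+ i * (2 * (M * s)) ^+ d)).
    by move: (s ^+ i) si => u u0; field; rewrite gt_eqF.
  apply: ler_pM => //; first exact: H.
  apply: le_trans T _; rewrite ler_pdivrMr ?subr_gt0 // [2 * _ * _]mulrAC.
  rewrite ler_peMl // ?mulr_ge0 ?invr_ge0 ?exprn_ge0 ?(ltW s0) //.
  by move: Ms; lra.
rewrite sumr_const card_ord -[leLHS]mulr_natl mulrCA.
by rewrite ler_wpM2l // mulr_ge0.
Qed.

Lemma lipschitz_center x y : J x -> J y -> `|y - x| <= s ->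
  `|co y 0 - co x 0| <= 2 * K * M * `|y - x|.
Proof.
move=> Jx Jy yx.
have yxM : M * `|y - x| <= M * s by rewrite ler_wpM2l.
have t01 : 0 <= M * `|y - x| < 1.
  by rewrite mulr_ge0 //=; move: Ms yxM; lra.
have aB j : `|co x j * 'C(j, 0)%:R * (y - x) ^+ (j - 0)| <= K * (M * `|y - x|) ^+ j.
  rewrite bin0 mulr1 subn0 normrM normrX exprMn mulrA.
  by rewrite ler_wpM2r ?exprn_ge0 // co_bound.
have := geometric_dominated_lim 1 t01 aB.
rewrite (cvg_lim _ (@co_shift x y 0 Jx Jy yx)) // /series /= big_nat1 bin0 mulr1 ?subn0.
rewrite ?mulr1 => /le_trans; apply.
have [t0 t1] := andP t01.
rewrite ler_pdivrMr ?subr_gt0 //.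
rewrite (_ : 2 * K * M * _ = 2 * (K * (M * `|y - x|))); last by ring.
rewrite [2 * _ * _]mulrAC ler_peMl ?mulr_ge0 //; move: Ms yxM; lra.
Qed.

(** At the centre x = k / n the linear term vanishes, and in the three-term
    relation only the part with the factor 1 / (n - 1) remains; so all terms of
    degree at least 2 contribute O(1/n) together. *)
Lemma local_coef_approx n k : J (k%:R / n%:R) -> 10 <= n%:R * s -> (q <= n)%N ->
  `|local_coef n k - co (k%:R / n%:R) 0| <= 4 * K / s ^+ 2 / n%:R.
Proof.
set x := k%:R / n%:R => Jx ns qn.
have /andP[x0 x1] := J01 Jx.
have n2 : (2 <= n)%N.
  rewrite -(ler_nat R); apply: (@le_trans _ _ (n%:R * s)); first lra.
  by rewrite ler_piMr.
have d0 : (0 < n %/ q)%N by rewrite divn_gt0 // q_gt0.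
have qd : (q * (n %/ q) <= n)%N by rewrite mulnC leq_trunc_div.
rewrite /local_coef -/x bcoef_taylor_poly.
case: (n %/ q)%N d0 qd => // d _ qd.
rewrite big_ord_recl /= expr0 bcoef1 mulr1 addrAC subrr add0r.
case: n n2 ns qn qd @x Jx x0 x1 => [|[|m]] // _ ns qn qd x Jx x0 x1.
case: k @x Jx x0 x1 => [|k] x Jx x0 x1; first by move: x0; rewrite /x mul0r ltxx.
apply: le_trans (ler_norm_sum _ _ _) _.
have n0 : 0 < m.+2%:R :> R by rewrite ltr0n.
have s20 : 0 < s ^+ 2 by rewrite exprn_gt0.
apply: (@le_trans _ _ (\sum_(i < d) (2 * K / s ^+ 2 / m.+2%:R) * (1 / 4) ^+ i)).
  apply: ler_sum => i _.
  rewrite /bump add1n exprS bcoef_three_term; last first.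
    rewrite size_exp_XsubC; have := ltn_ord i; have := q_gt0; clear - qd; nia.
  rewrite -/x subrr mul0r sub0r mulrN normrN.
  have -> : (('X - x%:P) ^+ i)^`() = ('X - x%:P) ^+ i.-1 *+ i.
    by rewrite deriv_exp derivXsubC mul1r.
  rewrite raddfMn /=.
  case: i => [[|i] /= id]; first by rewrite mulr0n !mulr0 normr0
     mulr_ge0 ?divr_ge0 ?mulr_ge0 ?exprn_ge0 // ltW.
  have B : `|bcoef m k (('X - x%:P) ^+ i)| <= s ^+ i.
    apply: near_center_bound.
    - by rewrite !ltW.
    - have -> : k%:R - x * m%:R = 2 * x - 1.
        have : x * m.+2%:R = k.+1%:R by rewrite /x mulfVK // pnatr_eq0.
        by rewrite -[m.+2%:R]natr1 -[m.+1%:R]natr1 -[k.+1%:R]natr1; lra.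
      by rewrite ler_norml; lra.
    - move: ns; rewrite -[m.+2%:R]natr1 -[m.+1%:R]natr1 !mulrDl !mul1r.
      by move: (m%:R * s) => z; have := s1; lra.
    - by have := q_gt0; clear - qd id; nia.
  set b := bcoef m k _ in B *.
  have m10 : 0 < m.+1%:R :> R by rewrite ltr0n.
  have C := co_bound i.+2 Jx.
  have -> : co x i.+2 * (x * (1 - x) / m.+1%:R * (b *+ i.+1)) =
     (x * (1 - x)) * (m.+1%:R^-1 * ((co x i.+2 * i.+1%:R) * b)).
    by rewrite -mulr_natr; ring.
  rewrite normrM; apply: (@le_trans _ _
      (1 * `|m.+1%:R^-1 * ((co x i.+2 * i.+1%:R) * b)|)).
    rewrite ler_wpM2r // ger0_norm ?mulr_ge0 ?subr_ge0 ?(ltW x0) ?(ltW x1) //.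
    by nra.
  rewrite mul1r normrM [`|m.+1%:R^-1|]gtr0_norm ?invr_gt0 //.
  have A1 : m.+1%:R^-1 <= 2 / m.+2%:R :> R.
    rewrite -[m.+1%:R^-1]mul1r ler_pdivrMr // mulrAC ler_pdivlMr // mul1r.
    by rewrite -natrM ler_nat; clear - m; lia.
  have A2 : `|co x i.+2 * i.+1%:R * b| <= K / s ^+ 2 * (1 / 4) ^+ i.+1.
    have i2 : i.+1%:R <= 2 ^+ i.+2 :> R.
      by apply: le_trans (nat_le_expr2 i.+2); rewrite ler_nat.
    apply: (@le_trans _ _ ((K * M ^+ i.+2 * 2 ^+ i.+2) * s ^+ i)).
      rewrite normrM; apply: ler_pM => //; rewrite normrM; apply: ler_pM => //.
      by rewrite ger0_norm.
    have -> : K * M ^+ i.+2 * 2 ^+ i.+2 * s ^+ i = K / s ^+ 2 * (2 * (M * s)) ^+ i.+2.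
      rewrite !exprMn [s ^+ i.+2](exprD s 2 i); move: (s ^+ 2) s20 => u u0.
      by field; rewrite gt_eqF.
    rewrite ler_wpM2l ?divr_ge0 ?(ltW s20) //.
    apply: (@le_trans _ _ ((1 / 4) ^+ i.+2)).
      apply: lerXn2r; rewrite ?nnegrE ?mulr_ge0 ?(ltW s0) //; move: Ms; lra.
    by rewrite ler_wiXn2l //; lra.
  apply: (@le_trans _ _ (2 / m.+2%:R * (K / s ^+ 2 * (1 / 4) ^+ i.+1))).
    by apply: ler_pM => //; rewrite invr_ge0.
  by rewrite le_eqVlt; apply/orP; left; apply/eqP; ring.
rewrite -mulr_sumr.
have -> : 4 * K / s ^+ 2 / m.+2%:R = 2 * K / s ^+ 2 / m.+2%:R * 2 by ring.
rewrite ler_wpM2l ?divr_ge0 ?mulr_ge0 ?exprn_ge0 ?(ltW s0) //.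
by apply: geometric_sum_le2; lra.
Qed.

(** With x = k / (n + 1) as common centre and n / q as common degree, the
    invariance is exact.  Passing to the true degree costs at most one Taylor
    term, and passing to the true centres costs two changes of centre, at
    distance at most 1 / n. *)
Lemma local_coef_avg n k : (0 < k <= n)%N -> J (k%:R / n.+1%:R) ->
  J (k.-1%:R / n%:R) -> J (k%:R / n%:R) -> 10 <= n%:R * s ->
  `|local_coef n.+1 k - avg local_coef n k| <= 3 * K * (1 / 2) ^+ (n %/ q).
Proof.
move=> /andP[k0 kn] Jx Ju Jv ns.
set x := k%:R / n.+1%:R in Jx *.
set d := (n %/ q)%N; set h := (1 / 2) ^+ d.
have n0 : 0 < n%:R :> R by rewrite ltr0n; exact: leq_trans kn.
have n10 : 0 < n.+1%:R :> R by rewrite ltr0n.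
have ns' : 1 / n%:R <= s by rewrite ler_pdivrMr // mulrC; lra.
have x01 := J01 Jx.
have qd : (q * d <= n)%N by rewrite mulnC leq_trunc_div.
(* the degrees (n + 1) / q and n / q differ by at most one *)
have A1 : `|local_coef n.+1 k - bcoef n.+1 k (taylor_poly x d)| <= K * h.
  have d'1 : (n.+1 %/ q <= d.+1)%N.
    rewrite -ltnS ltn_divLR ?q_gt0 //; have := ltn_ceil n q_gt0; have := q_gt0.
    by rewrite -/d; clear; nia.
  have d'0 : (d <= n.+1 %/ q)%N by apply: leq_div2r.
  rewrite /local_coef -/x !bcoef_taylor_poly.
  have : (n.+1 %/ q = d \/ n.+1 %/ q = d.+1)%N by clear - d'0 d'1; lia.
  have h0 : 0 <= K * h by rewrite mulr_ge0 // exprn_ge0 //; lra.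
  case=> ->; first by rewrite subrr normr0.
  rewrite big_ord_recr /= addrAC subrr add0r normrM.
  apply: (@le_trans _ _ (K * M ^+ d * s ^+ d)).
    apply: ler_pM => //; first exact: co_bound.
    apply: near_center_bound.
    - by case/andP: x01 => ? ?; rewrite !ltW.
    - by rewrite /x mulfVK ?gt_eqF // subrr normr0.
    - by rewrite -[n.+1%:R]natr1 mulrDl mul1r; move: (n%:R * s) ns => z; move: s0; lra.
    - exact: leqW.
  rewrite -mulrA -exprMn ler_wpM2l //; apply: lerXn2r; rewrite ?nnegrE.
  - by rewrite mulr_ge0 // ltW.
  - lra.
  - by move: Ms; lra.
have A2 j : J (j%:R / n%:R) -> `|j%:R / n%:R - x| <= s ->
    `|bcoef n j (taylor_poly x d) - local_coef n j| <= 2 * K * h.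
  move=> Jj jx; apply: taylor_poly_change_center => // i id.
  apply: near_center_bound.
  - by have /andP[? ?] := J01 Jj; rewrite !ltW.
  - by rewrite mulfVK ?gt_eqF // subrr normr0.
  - by move: (n%:R * s) ns => z; lra.
  - by apply: leq_trans qd; rewrite leq_mul2l (ltnW id) orbT.
have xE : x * n.+1%:R = k%:R by rewrite /x mulfVK // gt_eqF.
have kx : `|k%:R / n%:R - x| <= s.
  apply: le_trans ns'; rewrite ler_pdivlMr // -[X in _ * X](gtr0_norm n0) -normrM.
  rewrite mulrBl mulfVK ?gt_eqF // -xE -[n.+1%:R]natr1.
  by case/andP: x01 => a b; rewrite mulrDr mulr1 addrAC subrr add0r ger0_norm ltW.
have k1x : `|k.-1%:R / n%:R - x| <= s.
  apply: le_trans ns'; rewrite ler_pdivlMr // -[X in _ * X](gtr0_norm n0) -normrM.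
  rewrite mulrBl mulfVK ?gt_eqF //.
  have -> : k.-1%:R = k%:R - 1 :> R by rewrite -[in RHS](prednK k0) -natr1 addrK.
  rewrite -xE -[n.+1%:R]natr1; case/andP: x01 => a b.
  by rewrite mulrDr mulr1 ler_norml; apply/andP; split; lra.
have sz : (size (taylor_poly x d) <= n.+1)%N.
  apply: leq_trans (size_taylor_poly _ _) _; rewrite /d.
  by apply: leq_trans (leq_div _ _) _.
have B1 := A2 _ Ju k1x; have B2 := A2 _ Jv kx.
rewrite (bcoef_avg _ sz) /avg -/x in A1.
rewrite /avg -/x.
move: (bcoef n k.-1 _) (bcoef n k _) (local_coef n.+1 k) (local_coef n k.-1)
  (local_coef n k) A1 B1 B2 => b1 b2 c c1 c2 A1 B1 B2.
have -> : c - (x * c1 + (1 - x) * c2) = (c - (x * b1 + (1 - x) * b2)) +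
    (x * (b1 - c1) + (1 - x) * (b2 - c2)) by ring.
apply: le_trans (ler_normD _ _) _.
have -> : 3 * K * h = K * h + (x * (2 * K * h) + (1 - x) * (2 * K * h)) by ring.
case/andP: x01 => x0 x1.
apply: lerD => //; apply: le_trans (ler_normD _ _) _; apply: lerD.
  by rewrite normrM gtr0_norm // ler_wpM2l // ltW.
by rewrite normrM gtr0_norm ?subr_gt0 // ler_wpM2l // subr_ge0 ltW.
Qed.

(** With th = 1 - 1 / (2 q) Bernoulli's inequality gives th^q >= 1/2. *)
Lemma half_power_le : exists2 th : R, 0 < th < 1 &
  forall n, (1 / 2) ^+ (n %/ q) <= 2 * th ^+ n.
Proof.
pose th : R := 1 - 1 / (2 * q%:R).
have q0 : 0 < q%:R :> R by rewrite ltr0n q_gt0.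
have q1 : 1 <= q%:R :> R by rewrite ler1n q_gt0.
have i0 : 0 < 1 / (2 * q%:R) :> R by rewrite divr_gt0 // mulr_gt0.
have i1 : 1 / (2 * q%:R) <= 1 / 2 :> R.
  by rewrite ler_pdivrMr ?mulr_gt0 //; move: q1; lra.
have th0 : 0 < th by rewrite /th; lra.
have th1 : th < 1 by rewrite /th; lra.
have bern_ineq m : 1 - m%:R * (1 / (2 * q%:R)) <= th ^+ m.
  elim: m => [|m IH]; first by rewrite mul0r subr0 expr0.
  rewrite exprS -natr1; move: IH; rewrite /th.
  have m0 : 0 <= m%:R :> R by [].
  move: (1 / (2 * q%:R)) i0 i1 (m%:R) m0 => e e0 e1 j j0.
  move: (_ ^+ m) => u; nra.
have thq : 1 / 2 <= th ^+ q.
  apply: le_trans (bern_ineq q); rewrite le_eqVlt; apply/orP; left; apply/eqP.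
  by field; rewrite gt_eqF.
exists th; first by rewrite th0.
move=> n; set d := (n %/ q)%N.
have : th ^+ (q * d + q) <= th ^+ n.
  rewrite ler_wiXn2l ?(ltW th0) ?(ltW th1) //.
  by have := ltn_ceil n q_gt0; rewrite -/d; clear; nia.
rewrite exprD exprM => H.
have : (1 / 2) ^+ d <= (th ^+ q) ^+ d.
  by apply: lerXn2r; rewrite ?nnegrE ?exprn_ge0 ?(ltW th0) //; lra.
move/le_trans; apply.
have : 0 <= (th ^+ q) ^+ d by rewrite !exprn_ge0 // ltW.
move: H; move: (th ^+ q) thq (_ ^+ d) (th ^+ n) => a a0 b c; nra.
Qed.

End local_coefficients.

(** * Tail bound for Bernstein polynomials and a smooth step *)

Section chernoff.
Variable R : realType.
Implicit Types (p t : R) (u v : nat -> R).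

Lemma bern_le n p u v : 0 <= p <= 1 -> (forall k, (k <= n)%N -> u k <= v k) ->
  bern n p u <= bern n p v.
Proof.
move=> p01 uv; apply: ler_sum => k _; rewrite ler_wpM2l ?binom_weight_ge0 //.
by rewrite ler_wpM2l // uv // leq_ord.
Qed.

Lemma bernD n p u v : bern n p (fun k => u k + v k) = bern n p u + bern n p v.
Proof. by rewrite /bern -big_split; apply: eq_bigr => k _; rewrite /= -!mulrDr. Qed.

Lemma bernB n p u v : bern n p (fun k => u k - v k) = bern n p u - bern n p v.
Proof. by rewrite /bern -sumrB; apply: eq_bigr => k _; rewrite /= -!mulrBr. Qed.

Lemma bernZ n p c u : bern n p (fun k => c * u k) = c * bern n p u.
Proof. by rewrite /bern mulr_sumr; apply: eq_bigr => k _; ring. Qed.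

Lemma bern_cst n p c : bern n p (fun=> c) = c.
Proof.
have -> : (fun=> c) = (fun _ : nat => c * 1) by apply/funext => k; rewrite mulr1.
by rewrite bernZ bern1 mulr1.
Qed.

Lemma ler_norm_bern n p u v : 0 <= p <= 1 ->
  (forall k, (k <= n)%N -> `|u k| <= v k) -> `|bern n p u| <= bern n p v.
Proof.
move=> p01 uv; rewrite /bern (le_trans (ler_norm_sum _ _ _)) //.
apply: ler_sum => k _; rewrite normrM ger0_norm ?binom_weight_ge0 //.
rewrite ler_wpM2l ?binom_weight_ge0 // normrM ger0_norm // ler_wpM2l //.
by rewrite uv // leq_ord.
Qed.

Lemma expR_le_quadratic t : `|t| <= 1 / 2 -> expR t <= 1 + t + 2 * t ^+ 2.
Proof.
move=> t2; have [t3 t4] : - (1 / 2) <= t /\ t <= 1 / 2.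
  by move: t2; rewrite ler_norml => /andP.
have := expR_ge1Dx (- t); rewrite expRN => H.
have e0 : 0 < expR t by exact: expR_gt0.
have H1 : (1 - t) * expR t <= 1 by rewrite -ler_pdivlMr // mul1r.
have t20 : 0 <= t ^+ 2 by exact: sqr_ge0.
have H2 : 1 <= (1 - t) * (1 + t + 2 * t ^+ 2).
  rewrite [leRHS](_ : _ = 1 + t ^+ 2 * (1 - 2 * t)); last by ring.
  by rewrite lerDl mulr_ge0 //; lra.
have t1 : 0 < 1 - t by lra.
by rewrite -(ler_pM2l t1); apply: le_trans H1 H2.
Qed.

(** This is the moment generating function of the centred number of ones; each
    toss contributes a factor of at most exp (2 t^2). *)
Lemma bern_expR n p t : 0 <= p <= 1 -> `|t| <= 1 / 2 ->
  bern n p (fun k => expR (t * (k%:R - p * n%:R))) <= expR (2 * t ^+ 2) ^+ n.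
Proof.
move=> /andP[p0 p1] t2.
have -> : bern n p (fun k => expR (t * (k%:R - p * n%:R))) =
    ((1 - p + p * expR t) * expR (- (t * p))) ^+ n.
  rewrite exprMn exprDn mulr_suml; apply: eq_bigr => k _.
  have -> : t * (k%:R - p * n%:R) = t * k%:R + - (t * p) * n%:R by ring.
  rewrite expRD !expRM_natr /binom_weight exprMn -[_ *+ 'C(n, k)]mulr_natl; ring.
apply: lerXn2r; rewrite ?nnegrE ?expR_ge0 //.
  apply: mulr_ge0; last exact: expR_ge0.
  by apply: addr_ge0; rewrite ?subr_ge0 // mulr_ge0 // expR_ge0.
have H1 : 1 - p + p * expR t <= expR (t * p + 2 * t ^+ 2).
  apply: le_trans (expR_ge1Dx _).
  have := expR_le_quadratic t2; have : 0 <= t ^+ 2 by exact: sqr_ge0.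
  by move: (expR t) (t ^+ 2) => e w; nra.
apply: (@le_trans _ _ (expR (t * p + 2 * t ^+ 2) * expR (- (t * p)))).
  by rewrite ler_wpM2r // expR_ge0.
by rewrite -expRD addrAC subrr add0r.
Qed.

Definition far p d n k : bool := d * n%:R <= `|k%:R - p * n%:R|.

(** Chernoff's bound, with a parameter l small enough for 2 l^2 < l d. *)
Lemma bern_tail p d : 0 <= p <= 1 -> 0 < d -> exists2 rho : R, 0 < rho < 1 &
  forall n, bern n p (fun k => (far p d n k)%:R) <= 2 * rho ^+ n.
Proof.
move=> p01 d0; pose l := Num.min (d / 4) (1 / 2).
have l0 : 0 < l by rewrite lt_min !divr_gt0.
have l2 : l <= 1 / 2 by rewrite ge_min lexx orbT.
have ld : l <= d / 4 by rewrite ge_min lexx.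
clearbody l.
have llt : 2 * l ^+ 2 - l * d < 0 by rewrite expr2; nra.
exists (expR (2 * l ^+ 2 - l * d)); first by rewrite expR_gt0 expR_lt1.
move=> n; pose x k : R := k%:R - p * n%:R.
have n0 : 0 <= n%:R :> R by [].
apply: (@le_trans _ _ (bern n p (fun k => expR (- (l * d * n%:R)) *
    (expR (l * x k) + expR (- l * x k))))).
  apply: bern_le => // k _; rewrite /far; case: (leP (d * n%:R)) => [H|_]; last first.
    by rewrite mulr_ge0 ?addr_ge0 ?expR_ge0.
  rewrite mulrDr -!expRD.
  have [x0|x0] := leP 0 (x k).
    apply: (@le_trans _ _ (expR (- (l * d * n%:R) + l * x k))).
      move: H; rewrite -/(x k) ger0_norm // => H.
      have : 0 <= l * (x k - d * n%:R) by rewrite mulr_ge0 ?subr_ge0 // ltW.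
      by rewrite -expR0 ler_expR; move: (x k) => z; lra.
    by rewrite lerDl expR_ge0.
  apply: (@le_trans _ _ (expR (- (l * d * n%:R) + - l * x k))).
    move: H; rewrite -/(x k) ltr0_norm // => H.
    have : 0 <= l * (- x k - d * n%:R) by rewrite mulr_ge0 ?subr_ge0 // ltW.
    by rewrite -expR0 ler_expR; move: (x k) => z; lra.
  by rewrite lerDr expR_ge0.
rewrite bernZ bernD.
have nl : `|l| <= 1 / 2 by rewrite gtr0_norm.
have nl' : `|- l| <= 1 / 2 by rewrite normrN.
have H1 := bern_expR n p01 nl; have H2 := bern_expR n p01 nl'.
rewrite sqrrN in H2.
have -> : 2 * expR (2 * l ^+ 2 - l * d) ^+ n =
    expR (- (l * d * n%:R)) * (expR (2 * l ^+ 2) ^+ n + expR (2 * l ^+ 2) ^+ n).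
  rewrite expRD exprMn -[in RHS]mulNr expRM_natr; ring.
by rewrite ler_wpM2l ?expR_ge0 // lerD.
Qed.

End chernoff.

Section cutoff.
Variable R : realType.
Implicit Types (t u v l x : R).

Definition sqp t : R := Num.max 0 t ^+ 2.

Lemma sqp_pos t : 0 <= t -> sqp t = t ^+ 2.
Proof. by move=> t0; rewrite /sqp max_r. Qed.

Lemma sqp_neg t : t <= 0 -> sqp t = 0.
Proof. by move=> t0; rewrite /sqp max_l // expr0n. Qed.

Lemma sqp_convex u v l : 0 <= l <= 1 ->
  sqp (l * u + (1 - l) * v) <= l * sqp u + (1 - l) * sqp v.
Proof.
move=> /andP[l0 l1].
have q0 : 0 <= 1 - l by lra.
have [u0|u0] := leP 0 u; have [v0|v0] := leP 0 v.
- rewrite !sqp_pos // ?addr_ge0 ?mulr_ge0 //.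
  have : 0 <= l * (1 - l) * (u - v) ^+ 2.
    by apply: mulr_ge0; [exact: mulr_ge0|exact: sqr_ge0].
  by rewrite !expr2; lra.
- rewrite (sqp_pos u0) (sqp_neg (ltW v0)).
  have [w0|w0] := leP 0 (l * u + (1 - l) * v); last first.
    by rewrite (sqp_neg (ltW w0)) mulr0 addr0 mulr_ge0 // sqr_ge0.
  rewrite sqp_pos // mulr0 addr0.
  apply: (@le_trans _ _ ((l * u) ^+ 2)).
    by apply: lerXn2r; rewrite ?nnegrE ?mulr_ge0 //; nra.
  by rewrite exprMn ler_wpM2r ?sqr_ge0 // expr2 ler_piMl.
- rewrite (sqp_pos v0) (sqp_neg (ltW u0)).
  have [w0|w0] := leP 0 (l * u + (1 - l) * v); last first.
    by rewrite (sqp_neg (ltW w0)) mulr0 add0r mulr_ge0 // sqr_ge0.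
  rewrite sqp_pos // mulr0 add0r.
  apply: (@le_trans _ _ (((1 - l) * v) ^+ 2)).
    by apply: lerXn2r; rewrite ?nnegrE ?mulr_ge0 //; nra.
  by rewrite exprMn ler_wpM2r ?sqr_ge0 // expr2 ler_piMl //; lra.
- rewrite !sqp_neg ?mulr0 ?addr0 ?(ltW u0) ?(ltW v0) //.
  by nra.
Qed.

Lemma sqp_split t : sqp t + sqp (- t) = t ^+ 2.
Proof.
have [t0|t0] := leP 0 t.
  by rewrite sqp_pos // sqp_neg ?addr0 // oppr_le0.
by rewrite (sqp_neg (ltW t0)) sqp_pos ?sqrrN ?add0r // oppr_ge0 ltW.
Qed.

(** [sqp t + sqp (- t)] is t^2, both terms are convex, and the defect of t^2 is
    l (1 - l) (u - v)^2; hence the defect of each lies between 0 and that. *)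
Lemma sqp_defect u v l : 0 <= l <= 1 ->
  0 <= l * sqp u + (1 - l) * sqp v - sqp (l * u + (1 - l) * v) <= (u - v) ^+ 2 / 4.
Proof.
move=> l01; have H1 := sqp_convex u v l01; have H2 := sqp_convex (- u) (- v) l01.
have E : l * (- u) + (1 - l) * (- v) = - (l * u + (1 - l) * v) by ring.
rewrite E in H2.
have S1 := sqp_split u; have S2 := sqp_split v.
have S3 := sqp_split (l * u + (1 - l) * v).
have E2 : l * u ^+ 2 + (1 - l) * v ^+ 2 - (l * u + (1 - l) * v) ^+ 2 =
    l * (1 - l) * (u - v) ^+ 2 by ring.
have l4 : l * (1 - l) * (u - v) ^+ 2 <= (u - v) ^+ 2 / 4.
  rewrite mulrC ler_wpM2l ?sqr_ge0 //.
  have : 0 <= (l - 1 / 2) ^+ 2 by exact: sqr_ge0.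
  by rewrite expr2; lra.
move: H1 H2 S1 S2 S3 E2 l4.
move: (sqp u) (sqp v) (sqp (- u)) (sqp (- v)) (sqp (l * u + (1 - l) * v))
  (sqp (- (l * u + (1 - l) * v))) => A B A' B' D D'.
move: (u ^+ 2) (v ^+ 2) (_ ^+ 2) (_ * (u - v) ^+ 2) ((u - v) ^+ 2 / 4) => U V W Z T.
by move=> H1 H2 <- <- <- E2 l4; apply/andP; split; lra.
Qed.

(** 0 up to 0, then 2 t^2 up to 1/2, then 1 - 2 (1 - t)^2 up to 1, then 1.
    Writing this piecewise quadratic function by truncated squares reduces its
    convexity defect to [sqp_defect]. *)
Definition smooth_step t := 2 * sqp t - 4 * sqp (t - 1 / 2) + 2 * sqp (t - 1).

Lemma smooth_step_le0 t : t <= 0 -> smooth_step t = 0.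
Proof. by move=> t0; rewrite /smooth_step !sqp_neg; lra. Qed.

Lemma smooth_step_ge1 t : 1 <= t -> smooth_step t = 1.
Proof. by move=> t0; rewrite /smooth_step !sqp_pos; lra. Qed.

Lemma smooth_step_mono u v : u <= v ->
  0 <= smooth_step v - smooth_step u <= 2 * (v - u).
Proof.
have incr x y : x <= y -> (1 <= x \/ y <= 0 \/ (0 <= x /\ y <= 1 / 2) \/
    (1 / 2 <= x /\ y <= 1)) ->
    0 <= smooth_step y - smooth_step x <= 2 * (y - x).
  move=> xy [x1|[y0|[[x0 y2]|[x2 y1]]]].
  - by rewrite !smooth_step_ge1 //; [lra|exact: le_trans xy].
  - by rewrite !smooth_step_le0 //; [lra|exact: le_trans y0].
  - rewrite /smooth_step (sqp_pos x0) (sqp_pos (le_trans x0 xy)).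
    rewrite !(sqp_neg (t := _ - _)); try lra.
    by rewrite !expr2; apply/andP; split; nra.
  - rewrite /smooth_step !(sqp_neg (t := _ - 1)); try lra.
    by rewrite !sqp_pos; try lra; rewrite !expr2; apply/andP; split; nra.
have trans x y z : 0 <= smooth_step y - smooth_step x <= 2 * (y - x) ->
    0 <= smooth_step z - smooth_step y <= 2 * (z - y) ->
    0 <= smooth_step z - smooth_step x <= 2 * (z - x) by lra.
have A x y : x <= y -> 1 / 2 <= x -> 0 <= smooth_step y - smooth_step x <= 2 * (y - x).
  move=> xy x2; have [x1|x1] := leP 1 x; first by apply: incr; auto.
  have [y1|y1] := leP y 1; first by apply: incr; auto.
  apply: (trans x 1); apply: incr; auto; lra.
have B x y : x <= y -> 0 <= x -> 0 <= smooth_step y - smooth_step x <= 2 * (y - x).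
  move=> xy x0; have [x1|x1] := leP (1 / 2) x; first exact: A.
  have [y1|y1] := leP y (1 / 2); first by apply: incr; auto.
  apply: (trans x (1 / 2)); [apply: incr; auto|apply: A]; lra.
move=> uv; have [x1|x1] := leP 0 u; first exact: B.
have [y1|y1] := leP v 0; first by apply: incr; auto.
apply: (trans u 0); [apply: incr; auto|apply: B]; lra.
Qed.

Lemma smooth_step_itv t : 0 <= smooth_step t <= 1.
Proof.
have [t0|t0] := leP t 0; first by rewrite smooth_step_le0 // lexx ler01.
have [t1|t1] := leP 1 t; first by rewrite smooth_step_ge1 // lexx ler01.
have := smooth_step_mono (ltW t0); rewrite (smooth_step_le0 (lexx 0)) => H1.
have := smooth_step_mono (ltW t1); rewrite (smooth_step_ge1 (lexx 1)) => H2.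
by lra.
Qed.

Lemma smooth_step_lipschitz u v :
  `|smooth_step u - smooth_step v| <= 2 * `|u - v|.
Proof.
wlog uv : u v / u <= v.
  move=> H; have [/H//|/ltW/H] := leP u v.
  by rewrite distrC [`|v - u|]distrC.
rewrite distrC [`|u - v|]distrC [`|v - u|]ger0_norm ?subr_ge0 //.
by have /andP[? ?] := smooth_step_mono uv; rewrite ger0_norm.
Qed.

Lemma smooth_step_defect u v l : 0 <= l <= 1 ->
  `|l * smooth_step u + (1 - l) * smooth_step v - smooth_step (l * u + (1 - l) * v)|
  <= (u - v) ^+ 2.
Proof.
move=> l01; have := sqp_defect u v l01.
have := sqp_defect (u - 1 / 2) (v - 1 / 2) l01.
have := sqp_defect (u - 1) (v - 1) l01.
rewrite /smooth_step.
have -> c : l * (u - c) + (1 - l) * (v - c) = l * u + (1 - l) * v - c by ring.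
have -> c : l * (u - c) + (1 - l) * (v - c) = l * u + (1 - l) * v - c by ring.
have -> c : (u - c) - (v - c) = u - v by ring.
have -> c : (u - c) - (v - c) = u - v by ring.
move=> H1 H2 H3; rewrite ler_norml; lra.
Qed.

End cutoff.

(** * The window around the interval *)

Section window.
Variable R : realType.
Variables (a b r : R).
Hypotheses (ab : a <= b) (r0 : 0 < r).

(** One of the two steps is always 1, so the sum minus 1 acts as their product. *)
Definition cutoff (x : R) : R :=
  smooth_step (4 / r * (x - (a - r / 2))) + smooth_step (4 / r * (b + r / 2 - x)) - 1.

Let scale_gt0 : 0 < 4 / r. Proof. by rewrite divr_gt0. Qed.

Lemma cutoff_out x : x <= a - r / 2 \/ b + r / 2 <= x -> cutoff x = 0.
Proof.
have H y : r / 4 <= y -> 1 <= 4 / r * y.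
  by move=> yr; rewrite mulrAC ler_pdivlMr // mul1r; lra.
case=> xr; rewrite /cutoff.
  rewrite smooth_step_le0; last by rewrite pmulr_rle0 //; lra.
  rewrite smooth_step_ge1; first by lra.
  by apply: H; move: r0 ab; lra.
rewrite addrC [smooth_step (_ * (b + _ - _))]smooth_step_le0; last first.
  by rewrite pmulr_rle0 //; lra.
rewrite smooth_step_ge1; first by lra.
by apply: H; move: r0 ab; lra.
Qed.

Lemma cutoff_in x : a - r / 4 <= x <= b + r / 4 -> cutoff x = 1.
Proof.
have H y : r / 4 <= y -> 1 <= 4 / r * y.
  by move=> yr; rewrite mulrAC ler_pdivlMr // mul1r; lra.
move=> /andP[ax xb]; rewrite /cutoff !smooth_step_ge1; first by lra.
  by apply: H; move: r0; lra.
by apply: H; move: r0; lra.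
Qed.

Lemma cutoff_itv x : 0 <= cutoff x <= 1.
Proof.
have H y : r / 4 <= y -> 1 <= 4 / r * y.
  by move=> yr; rewrite mulrAC ler_pdivlMr // mul1r; lra.
rewrite /cutoff; have [xm|xm] := leP x ((a + b) / 2).
  rewrite [smooth_step (_ * (b + _ - _))]smooth_step_ge1; last first.
    by apply: H; move: r0 ab xm; lra.
  by rewrite addrK smooth_step_itv.
rewrite [smooth_step (_ * (_ - (a - _)))]smooth_step_ge1; last first.
  by apply: H; move: r0 ab xm; lra.
by rewrite addrAC subrr add0r smooth_step_itv.
Qed.

Let riseL x := smooth_step (4 / r * (x - (a - r / 2))).
Let fallR x := smooth_step (4 / r * (b + r / 2 - x)).

Lemma cutoff_lipschitz u v : `|cutoff u - cutoff v| <= 16 / r * `|u - v|.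
Proof.
have H1 : `|riseL u - riseL v| <= 2 * (4 / r * `|u - v|).
  apply: le_trans (smooth_step_lipschitz _ _) _.
  rewrite -mulrBr (_ : u - (a - r / 2) - _ = u - v); last by ring.
  by rewrite normrM (gtr0_norm scale_gt0).
have H2 : `|fallR u - fallR v| <= 2 * (4 / r * `|u - v|).
  apply: le_trans (smooth_step_lipschitz _ _) _.
  rewrite -mulrBr (_ : b + r / 2 - u - _ = v - u); last by ring.
  by rewrite normrM (gtr0_norm scale_gt0) distrC.
rewrite /cutoff -/(riseL u) -/(riseL v) -/(fallR u) -/(fallR v).
rewrite [X in `|X|](_ : _ = (riseL u - riseL v) + (fallR u - fallR v)); last by ring.
apply: le_trans (ler_normD _ _) _.
have -> : 16 / r * `|u - v| = 2 * (4 / r * `|u - v|) + 2 * (4 / r * `|u - v|) by ring.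
exact: lerD.
Qed.

Lemma cutoff_defect u v l : 0 <= l <= 1 ->
  `|l * cutoff u + (1 - l) * cutoff v - cutoff (l * u + (1 - l) * v)|
  <= 32 / r ^+ 2 * (u - v) ^+ 2.
Proof.
move=> l01; set w := l * u + (1 - l) * v.
pose E := 16 / r ^+ 2 * (u - v) ^+ 2.
have H1 : `|l * riseL u + (1 - l) * riseL v - riseL w| <= E.
  have := smooth_step_defect (4 / r * (u - (a - r / 2))) (4 / r * (v - (a - r / 2))) l01.
  have -> : l * (4 / r * (u - (a - r / 2))) + (1 - l) * (4 / r * (v - (a - r / 2))) =
    4 / r * (w - (a - r / 2)) by rewrite /w; ring.
  rewrite (_ : (_ - _) ^+ 2 = E) //.
  by rewrite /E; field; rewrite gt_eqF.
have H2 : `|l * fallR u + (1 - l) * fallR v - fallR w| <= E.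
  have := smooth_step_defect (4 / r * (b + r / 2 - u)) (4 / r * (b + r / 2 - v)) l01.
  have -> : l * (4 / r * (b + r / 2 - u)) + (1 - l) * (4 / r * (b + r / 2 - v)) =
    4 / r * (b + r / 2 - w) by rewrite /w; ring.
  rewrite (_ : (_ - _) ^+ 2 = E) //.
  by rewrite /E; field; rewrite gt_eqF.
have -> : 32 / r ^+ 2 * (u - v) ^+ 2 = E + E by rewrite /E; ring.
rewrite /cutoff -/(riseL u) -/(riseL v) -/(riseL w) -/(fallR u) -/(fallR v) -/(fallR w).
rewrite [X in `|X|](_ : _ = (l * riseL u + (1 - l) * riseL v - riseL w) +
  (l * fallR u + (1 - l) * fallR v - fallR w)); last by ring.
by rewrite (le_trans (ler_normD _ _)) // lerD.
Qed.

(** The distance to [a - r/16, b + r/16]: convex, zero with room to spare around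
    the interval, and at least r/16 wherever the cutoff may fail to be 1. *)
Definition outside (x : R) : R :=
  Num.max 0 (a - r / 16 - x) + Num.max 0 (x - (b + r / 16)).

Lemma max0_convex (u v l : R) : 0 <= l <= 1 ->
  Num.max 0 (l * u + (1 - l) * v) <= l * Num.max 0 u + (1 - l) * Num.max 0 v.
Proof.
move=> /andP[l0 l1]; have q0 : 0 <= 1 - l by lra.
rewrite ge_max; apply/andP; split.
  by rewrite addr_ge0 // mulr_ge0 // le_max lexx.
by rewrite lerD // ler_wpM2l // le_max lexx orbT.
Qed.

Lemma outside_convex u v l : 0 <= l <= 1 ->
  outside (l * u + (1 - l) * v) <= l * outside u + (1 - l) * outside v.
Proof.
move=> l01; rewrite /outside !mulrDr addrACA; apply: lerD.
  have -> : a - r / 16 - (l * u + (1 - l) * v) =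
    l * (a - r / 16 - u) + (1 - l) * (a - r / 16 - v) by ring.
  exact: max0_convex.
have -> : l * u + (1 - l) * v - (b + r / 16) =
  l * (u - (b + r / 16)) + (1 - l) * (v - (b + r / 16)) by ring.
exact: max0_convex.
Qed.

Lemma outside_ge0 x : 0 <= outside x.
Proof. by rewrite addr_ge0 // le_max lexx. Qed.

Lemma outside_far x : x < a - r / 8 \/ b + r / 8 < x -> r / 16 <= outside x.
Proof.
rewrite /outside; case=> H; rewrite -[r / 16]addr0.
  by rewrite lerD ?le_max ?lexx //; apply/orP; right; lra.
by rewrite addrC lerD ?le_max ?lexx //; apply/orP; right; lra.
Qed.

Lemma outside_in x p : a <= p <= b -> `|x - p| < r / 16 -> outside x = 0.
Proof.
move=> /andP[ap pb]; rewrite ltr_norml => /andP[h1 h2].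
by rewrite /outside !max_l ?addr0 //; lra.
Qed.

Lemma outside_le2 x : 0 <= x <= 1 -> a <= 1 -> 0 <= b -> outside x <= 2.
Proof.
move=> /andP[x0 x1] a1 b0; rewrite /outside -[2]/(1 + 1) lerD //.
  by rewrite ge_max ler01 /=; move: r0; lra.
by rewrite ge_max ler01 /=; move: r0; lra.
Qed.

End window.

(** * Analyticity implies fast simulation *)

Section assembly.
Variable R : realType.

Lemma avgB (u v : nat -> nat -> R) n k :
  avg (fun n k => u n k - v n k) n k = avg u n k - avg v n k.
Proof. by rewrite /avg; ring. Qed.

Lemma avgD (u v : nat -> nat -> R) n k :
  avg (fun n k => u n k + v n k) n k = avg u n k + avg v n k.
Proof. by rewrite /avg; ring. Qed.

Lemma lattice_mean n k : (0 < n)%N ->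
  k%:R / n.+1%:R * (k.-1%:R / n%:R) + (1 - k%:R / n.+1%:R) * (k%:R / n%:R)
  = k%:R / n.+1%:R :> R.
Proof.
move=> n0; have n1 : n%:R != 0 :> R by rewrite pnatr_eq0 -lt0n.
have n2 : n.+1%:R != 0 :> R by rewrite pnatr_eq0.
case: k => [|k] /=; first by rewrite !mul0r mulr0 addr0.
rewrite -[n.+1%:R]natr1 -[k.+1%:R]natr1 in n2 *; field.
by rewrite n1 n2.
Qed.

Lemma lattice_close n k : (0 < n)%N -> (k <= n.+1)%N ->
  `|k.-1%:R / n%:R - k%:R / n.+1%:R| <= n%:R^-1 :> R /\
  `|k%:R / n%:R - k%:R / n.+1%:R| <= n%:R^-1 :> R.
Proof.
move=> n0 kn; have n1 : 0 < n%:R :> R by rewrite ltr0n.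
have n2 : 0 < n.+1%:R :> R by rewrite ltr0n.
have kn' : k%:R <= n%:R + 1 :> R by rewrite natr1 ler_nat.
have k0 : 0 <= k%:R :> R by [].
have E (x : R) : `|x| <= n.+1%:R -> `|x / (n%:R * n.+1%:R)| <= n%:R^-1.
  move=> xn; rewrite normrM [`|_^-1|]gtr0_norm ?invr_gt0 ?mulr_gt0 //.
  rewrite ler_pdivrMr ?mulr_gt0 // mulrA mulVf ?mul1r //.
  by rewrite gt_eqF.
split; last first.
  rewrite [X in `|X|](_ : _ = k%:R / (n%:R * n.+1%:R)); last first.
    by rewrite -[n.+1%:R]natr1 in n2 *; field; rewrite !gt_eqF.
  by apply: E; rewrite ger0_norm // ler_nat.
case: k kn kn' k0 => [|k] kn kn' k0 /=.
  by rewrite !mul0r subrr normr0 invr_ge0 ltW.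
rewrite [X in `|X|](_ : _ = (k%:R - n%:R) / (n%:R * n.+1%:R)); last first.
  by rewrite -[n.+1%:R]natr1 -[k.+1%:R]natr1 in n2 *; field; rewrite !gt_eqF.
apply: E; rewrite -[n.+1%:R]natr1; rewrite -[k.+1%:R]natr1 in kn'.
have : 0 <= k%:R :> R by [].
by rewrite ler_norml => ?; apply/andP; split; lra.
Qed.

(** A product is averaged up to the defect of each factor and the covariance of
    the two; the covariance is the term with c1 - c2 and e1 - e2. *)
Lemma blend_error (l c1 c2 c e1 e2 e A B C : R) : 0 <= l <= 1 -> 0 <= e <= 1 ->
  0 <= c1 <= 1 -> 0 <= c2 <= 1 ->
  `|c - (l * c1 + (1 - l) * c2)| <= A ->
  `|l * e1 + (1 - l) * e2 - e| <= B -> `|c1 - c2| * `|e1 - e2| <= C ->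
  `|l * (1 / 2 + (c1 - 1 / 2) * e1) + (1 - l) * (1 / 2 + (c2 - 1 / 2) * e2)
     - (1 / 2 + (c - 1 / 2) * e)| <= A + (B + C).
Proof.
move=> /andP[l0 l1] /andP[e0 e1'] /andP[c10 c11] /andP[c20 c21] HA HB HC.
have q0 : 0 <= 1 - l by lra.
rewrite [X in `|X|](_ : _ = - ((c - (l * c1 + (1 - l) * c2)) * e) +
  ((l * (c1 - 1 / 2) + (1 - l) * (c2 - 1 / 2)) * (l * e1 + (1 - l) * e2 - e)
   + l * (1 - l) * ((c1 - c2) * (e1 - e2)))); last by field.
apply: le_trans (ler_normD _ _) _; apply: lerD.
  rewrite normrN normrM (ger0_norm e0); apply: le_trans HA.
  by rewrite ler_piMr.
apply: le_trans (ler_normD _ _) _; apply: lerD.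
  rewrite normrM; apply: le_trans HB; rewrite ler_piMl //.
  have : l * (c1 - 1 / 2) <= l * (1 / 2) by rewrite ler_wpM2l //; lra.
  have : l * (- (1 / 2)) <= l * (c1 - 1 / 2) by rewrite ler_wpM2l //; lra.
  have : (1 - l) * (c2 - 1 / 2) <= (1 - l) * (1 / 2) by rewrite ler_wpM2l //; lra.
  have : (1 - l) * (- (1 / 2)) <= (1 - l) * (c2 - 1 / 2) by rewrite ler_wpM2l //; lra.
  move: (l * (c1 - 1 / 2)) ((1 - l) * (c2 - 1 / 2)) => x y.
  by rewrite ler_norml; lra.
rewrite !normrM; apply: le_trans HC; rewrite ler_piMl ?mulr_ge0 //.
by rewrite !ger0_norm // mulr_ile1 //; lra.
Qed.

Variables (a b r eps : R) (f : R -> R) (co : R -> nat -> R) (K M s : R) (q : nat).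
Hypotheses (ab : a <= b) (r0 : 0 < r) (eps0 : 0 < eps).
Let J := [set y : R | a - r <= y <= b + r].
Hypothesis J01 : forall y, J y -> 0 < y < 1.
Hypotheses (K0 : 0 <= K) (M0 : 0 <= M) (s0 : 0 < s) (s1 : s <= 1).
Hypothesis Ms : M * s <= 1 / 8.
Hypothesis co_bound : forall y j, J y -> `|co y j| <= K * M ^+ j.
Hypothesis co_shift : forall x y i, J x -> J y -> `|y - x| <= s ->
  series (fun j => co x j * 'C(j, i)%:R * (y - x) ^+ (j - i)) @ \oo --> co y i.
Hypothesis qs : 16 <= q%:R * s ^+ 2.
Hypothesis co_itv : forall y, J y -> eps <= co y 0%N <= 1 - eps.
Hypothesis co_f : forall p, a <= p <= b -> co p 0%N = f p.

Let c := local_coef co q.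
Let Capx := 4 * K / s ^+ 2.

Definition blended n k : R := 1 / 2 + (c n k - 1 / 2) * cutoff a b r (k%:R / n%:R).

(** The second condition serves [near_center_bound], the third puts neighbouring
    lattice points within r / 8 of each other, and the last makes the error of
    [local_coef_approx] at most eps / 2. *)
Let large n := [/\ (q <= n)%N, 10 <= n%:R * s, 8 / r <= n%:R & 2 * Capx / eps <= n%:R].

Let Capx_ge0 : 0 <= Capx.
Proof. by rewrite /Capx !mulr_ge0 ?invr_ge0 ?exprn_ge0 // ltW. Qed.

Let large_gt0 n : large n -> (0 < n)%N.
Proof.
case=> _ ns _ _; rewrite lt0n; apply/negP => /eqP n0; move: ns; rewrite n0 mul0r; lra.
Qed.

Let large_near : exists n0, forall n, (n0 <= n)%N -> large n.
Proof.
exists (maxn q (maxn (Num.truncn (10 / s)).+1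
  (maxn (Num.truncn (8 / r)).+1 (Num.truncn (2 * Capx / eps)).+1))) => n.
rewrite !geq_max => /and4P[h1 h2 h3 h4].
have H (x : R) : ((Num.truncn x).+1 <= n)%N -> x <= n%:R.
  by rewrite -(ler_nat R) => /(lt_le_trans (truncnS_gt x))/ltW.
by split; [|rewrite -ler_pdivrMr //| |]; try exact: H.
Qed.

Let c_approx n k : large n -> J (k%:R / n%:R) ->
  `|c n k - co (k%:R / n%:R) 0%N| <= Capx / n%:R.
Proof.
move=> [qn ns _ _] Jx.
exact: (local_coef_approx J01 K0 M0 s0 s1 Ms co_bound qs Jx ns qn).
Qed.

Let c_itv n k : large n -> J (k%:R / n%:R) -> eps / 2 <= c n k <= 1 - eps / 2.
Proof.
move=> Ln Jx; have H := c_approx Ln Jx; have := co_itv Jx => /andP[h1 h2].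
have [_ _ _ ln] := Ln.
have n0 : 0 < n%:R :> R by rewrite ltr0n large_gt0.
have H2 : Capx / n%:R <= eps / 2.
  rewrite ler_pdivrMr // mulrC -ler_pdivrMr ?divr_gt0 //.
  by apply: le_trans ln; rewrite invf_div mulrA [Capx * 2]mulrC.
have := le_trans H H2; rewrite ler_norml => /andP[h3 h4].
by apply/andP; split; lra.
Qed.

Let eps_le1 : eps <= 1 / 2.
Proof.
have Ja : J a by rewrite /J /=; apply/andP; split; move: ab r0; lra.
by have /andP[] := co_itv Ja; lra.
Qed.

Lemma blended_itv n k : large n -> eps / 2 <= blended n k <= 1 - eps / 2.
Proof.
move=> Ln; rewrite /blended; have := cutoff_itv ab r0 (k%:R / n%:R).
set x := k%:R / n%:R; set e := cutoff _ _ _ _ => /andP[e0 e1].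
have [Jx|nJx] := boolP (a - r <= x <= b + r).
  have /andP[h1 h2] := c_itv Ln Jx; have := eps_le1; move: eps0.
  move: (c n k) h1 h2 => z h1 h2 ? ?; apply/andP; split; nra.
have -> : e = 0.
  rewrite /e cutoff_out //; move: nJx; rewrite negb_and -!ltNge => /orP[h|h].
    by left; move: r0; lra.
  by right; move: r0; lra.
by have := eps_le1; move: eps0; rewrite mulr0; lra.
Qed.

Let Clip := 2 * Capx + 2 * K * M.

Let c_lipschitz n k : large n -> (0 < k)%N -> J (k.-1%:R / n%:R) -> J (k%:R / n%:R) ->
  `|c n k.-1 - c n k| <= Clip / n%:R.
Proof.
move=> Ln k0 Ju Jv.
have n0 : 0 < n%:R :> R by rewrite ltr0n large_gt0.
have [_ ns _ _] := Ln.
have E : k.-1%:R / n%:R - k%:R / n%:R = - n%:R^-1 :> R.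
  by rewrite -mulrBl -[in k%:R](prednK k0) -natr1 opprD addrA subrr sub0r mulN1r.
have uv : `|k.-1%:R / n%:R - k%:R / n%:R| <= s.
  rewrite E normrN gtr0_norm ?invr_gt0 // -[leLHS]mul1r ler_pdivrMr // mulrC; lra.
have L := lipschitz_center K0 M0 Ms co_bound co_shift Jv Ju uv.
rewrite E normrN [`|_^-1|]gtr0_norm ?invr_gt0 // in L.
have H1 := c_approx Ln Ju; have H2 := c_approx Ln Jv.
rewrite distrC in H2.
move: (co _ _) (co _ _) H1 H2 L => x y H1 H2 L.
rewrite [X in `|X|](_ : _ = (c n k.-1 - y) + ((y - x) + (x - c n k))); last by ring.
apply: le_trans (ler_normD _ _) _.
rewrite [leRHS](_ : _ = Capx / n%:R + (2 * K * M / n%:R + Capx / n%:R)); last first.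
  by rewrite /Clip; ring.
have := ler_normD (y - x) (x - c n k).
by move: H1 H2 L; lra.
Qed.

Let Cblend := 32 / r ^+ 2 + Clip * (16 / r).

Let Clip_ge0 : 0 <= Clip.
Proof. by apply: addr_ge0; [exact: mulr_ge0|rewrite !mulr_ge0]. Qed.

Let Cblend_ge0 : 0 <= Cblend.
Proof.
apply: addr_ge0; first by rewrite divr_ge0 // exprn_ge0 // ltW.
by rewrite mulr_ge0 // divr_ge0 // ltW.
Qed.

(** Away from the window everything is 1/2; near [a, b] the cutoff is 1 and only
    the exponentially small error of [local_coef_avg] remains; in between,
    neighbouring values differ by O(1/n), so the defect of the cutoff and the
    covariance are O(1/n^2), and [outside] is at least r/16. *)
Let blended_avg n k : large n -> (k <= n.+1)%N ->
  `|avg blended n k - blended n.+1 k| <=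
    3 * K * (1 / 2) ^+ (n %/ q) +
    Cblend * (16 / r) / n%:R ^+ 2 * outside a b r (k%:R / n.+1%:R).
Proof.
move=> Ln kn; have n0 := large_gt0 Ln.
have nR : 0 < n%:R :> R by rewrite ltr0n.
have n1R : 0 < n.+1%:R :> R by rewrite ltr0n.
have [_ ns nr _] := Ln.
have [H1 H2] := lattice_close n0 kn.
have mean := lattice_mean k n0.
set u := k.-1%:R / n%:R in H1 mean *; set v := k%:R / n%:R in H2 mean *.
set x := k%:R / n.+1%:R in H1 H2 mean *.
have ni : n%:R^-1 <= r / 8.
  by rewrite -[leLHS]mul1r ler_pdivrMr // mulrC -ler_pdivrMr ?divr_gt0 // invf_div mul1r.
have rhs0 : 0 <= Cblend * (16 / r) / n%:R ^+ 2 * outside a b r x.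
  rewrite mulr_ge0 ?outside_ge0 // mulr_ge0 ?invr_ge0 ?exprn_ge0 //.
  by rewrite mulr_ge0 ?divr_ge0 // ltW.
have h0 : 0 <= 3 * K * (1 / 2) ^+ (n %/ q) by rewrite !mulr_ge0 ?exprn_ge0 //; lra.
have x01 : 0 <= x <= 1.
  by rewrite /x divr_ge0 //= ler_pdivrMr // mul1r ler_nat.
have /andP[u1 u2] : - (r / 8) <= u - x <= r / 8 by rewrite -ler_norml (le_trans H1).
have /andP[v1 v2] : - (r / 8) <= v - x <= r / 8 by rewrite -ler_norml (le_trans H2).
rewrite /avg /blended -/x -/u -/v.
(* beyond distance 3 r / 4 the cutoff vanishes at x and at both its parents *)
have [xo|xi] := boolP ((x < a - 3 * r / 4) || (b + 3 * r / 4 < x)).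
  have out y : `|y - x| <= r / 8 -> cutoff a b r y = 0.
    rewrite ler_norml => /andP[y1 y2]; apply: cutoff_out => //.
    by case/orP: xo => xo; [left|right]; move: r0; lra.
  have eu : cutoff a b r u = 0 by apply: out; rewrite ler_norml u1.
  have ev : cutoff a b r v = 0 by apply: out; rewrite ler_norml v1.
  have ex : cutoff a b r x = 0 by apply: out; rewrite subrr normr0 divr_ge0 // ltW.
  rewrite eu ev ex.
  rewrite !mulr0 !addr0 [X in `|X|](_ : _ = 0); last by field.
  by rewrite normr0 addr_ge0.
move: xi; rewrite negb_or -!leNgt => /andP[xa xb].
have Jx : J x by rewrite /J /=; apply/andP; split; move: r0; lra.
have Ju : J u by rewrite /J /=; apply/andP; split; move: r0; lra.
have Jv : J v by rewrite /J /=; apply/andP; split; move: r0; lra.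
have k0 : (0 < k)%N.
  rewrite lt0n; apply/negP => /eqP k0; have := J01 Jx.
  by rewrite /x k0 mul0r ltxx.
have kn' : (k <= n)%N.
  have /andP[_] := J01 Jv; rewrite /v ltr_pdivrMr // mul1r ltr_nat.
  by move/ltnW.
have knb : (0 < k <= n)%N by rewrite k0.
have A1 := local_coef_avg J01 K0 M0 s0 s1 Ms co_bound co_shift qs knb Jx Ju Jv ns.
rewrite -/c /avg -/x in A1.
have c01 j : J (j%:R / n%:R) -> 0 <= c n j <= 1.
  move=> Jj; have /andP[h1 h2] := c_itv Ln Jj; move: eps0.
  by move: (c n j) h1 h2 => z *; apply/andP; split; lra.
have uvE : u - v = - n%:R^-1.
  by rewrite /u /v -mulrBl -[in k%:R](prednK k0) -natr1 opprD addrA subrr sub0r mulN1r.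
have nV0 : 0 <= n%:R^-1 :> R by rewrite invr_ge0 ltW.
have D1 : `|x * cutoff a b r u + (1 - x) * cutoff a b r v - cutoff a b r x|
    <= 32 / r ^+ 2 / n%:R ^+ 2.
  have := cutoff_defect a b r0 u v x01; rewrite mean uvE sqrrN exprVn.
  by [].
have D2 : `|c n k.-1 - c n k| * `|cutoff a b r u - cutoff a b r v|
    <= Clip * (16 / r) / n%:R ^+ 2.
  have -> : Clip * (16 / r) / n%:R ^+ 2 = (Clip / n%:R) * (16 / r * n%:R^-1).
    by field; rewrite !gt_eqF.
  apply: ler_pM => //; first exact: c_lipschitz.
  have := cutoff_lipschitz a b r0 u v.
  by rewrite uvE normrN (ger0_norm nV0).
have [xw|xnw] := boolP (a - r / 8 <= x <= b + r / 8).
  have inn y : `|y - x| <= r / 8 -> cutoff a b r y = 1.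
    rewrite ler_norml => /andP[y1 y2]; apply: cutoff_in => //.
    by case/andP: xw => xw1 xw2; apply/andP; split; move: r0; lra.
  have eu : cutoff a b r u = 1 by apply: inn; rewrite ler_norml u1.
  have ev : cutoff a b r v = 1 by apply: inn; rewrite ler_norml v1.
  have ex : cutoff a b r x = 1 by apply: inn; rewrite subrr normr0 divr_ge0 // ltW.
  rewrite eu ev ex.
  apply: le_trans (_ : _ <= 3 * K * (1 / 2) ^+ (n %/ q)) _; last by rewrite lerDl.
  apply: le_trans A1; rewrite distrC le_eqVlt; apply/orP; left; apply/eqP.
  by congr `|_|; field.
apply: (@le_trans _ _ (3 * K * (1 / 2) ^+ (n %/ q) +
   (32 / r ^+ 2 / n%:R ^+ 2 + Clip * (16 / r) / n%:R ^+ 2))).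
  apply: blend_error => //; [exact: cutoff_itv|exact: c01|exact: c01].
rewrite lerD2l -mulrDl -/Cblend; set o := outside _ _ _ _.
have -> : Cblend * (16 / r) / n%:R ^+ 2 * o = Cblend / n%:R ^+ 2 * (16 / r * o) by ring.
rewrite ler_peMr ?divr_ge0 ?exprn_ge0 //.
have : r / 16 <= outside a b r x.
  apply: outside_far; move: xnw; rewrite negb_and -!ltNge => /orP[h|h].
    by left.
  by right.
by rewrite -/o => h; rewrite mulrAC ler_pdivlMr // mul1r; lra.
Qed.

Section envelope.
Variable th : R.
Hypotheses (th01 : 0 < th < 1)
  (half_th : forall n, (1 / 2) ^+ (n %/ q) <= 2 * th ^+ n).

Let D := 6 * K / (1 - th).
Let B := Cblend * (16 / r).
Let E := 2 * B.

(** D and E are chosen so that D (th^n - th^(n+1)) and E (1/n - 1/(n+1)) dominate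
    the two terms of [blended_avg]. *)
Definition margin n k : R :=
  D * th ^+ n + E / n%:R * outside a b r (k%:R / n%:R).

Let B_ge0 : 0 <= B.
Proof. by rewrite /B mulr_ge0 // divr_ge0 // ltW. Qed.

Let E_ge0 : 0 <= E.
Proof. by rewrite /E mulr_ge0. Qed.

Let D_ge0 : 0 <= D.
Proof.
by case/andP: th01 => t0 t1; rewrite /D divr_ge0 ?mulr_ge0 // subr_ge0 ltW.
Qed.

Let thn_ge0 n : 0 <= th ^+ n.
Proof. by case/andP: th01 => t0 t1; rewrite exprn_ge0 // ltW. Qed.

(** By convexity, averaging does not decrease [outside]; the gain comes from the
    coefficients D th^n and E / n, which decrease with n. *)
Let margin_avg n k : large n -> (k <= n.+1)%N ->
  `|avg blended n k - blended n.+1 k| <= avg margin n k - margin n.+1 k.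
Proof.
move=> Ln kn; have n0 := large_gt0 Ln.
have nR : 0 < n%:R :> R by rewrite ltr0n.
have n1R : 0 < n.+1%:R :> R by rewrite ltr0n.
apply: le_trans (blended_avg Ln kn) _.
have mean := lattice_mean k n0.
rewrite /avg /margin.
set u := k.-1%:R / n%:R in mean *; set v := k%:R / n%:R in mean *.
set x := k%:R / n.+1%:R in mean *.
have x01 : 0 <= x <= 1.
  by rewrite /x divr_ge0 //= ler_pdivrMr // mul1r ler_nat.
have Hc := outside_convex a b r u v x01; rewrite mean in Hc.
have o0 := outside_ge0 a b r x.
have H1 : 3 * K * (1 / 2) ^+ (n %/ q) <= D * th ^+ n - D * th ^+ n.+1.
  have -> : D * th ^+ n - D * th ^+ n.+1 = 3 * K * (2 * th ^+ n).
    rewrite exprS /D; field; rewrite subr_eq0 gt_eqF //; by case/andP: th01.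
  by rewrite ler_wpM2l // mulr_ge0.
have H2 : B / n%:R ^+ 2 <= E / n%:R - E / n.+1%:R.
  have -> : E / n%:R - E / n.+1%:R = B / n%:R * (2 / n.+1%:R).
    by rewrite /E -[n.+1%:R]natr1 in n1R *; field; rewrite !gt_eqF.
  have -> : B / n%:R ^+ 2 = B / n%:R * n%:R^-1 by rewrite expr2 invfM mulrA.
  rewrite ler_wpM2l ?divr_ge0 // ?(ltW nR) //.
  rewrite ler_pdivlMr // mulrC ler_pdivrMr // -natrM ler_nat.
  by clear - n0; lia.
have H3 : E / n%:R * outside a b r x <=
    E / n%:R * (x * outside a b r u + (1 - x) * outside a b r v).
  by rewrite ler_wpM2l // divr_ge0 // ltW.
have H4 : B / n%:R ^+ 2 * outside a b r x <=
    (E / n%:R - E / n.+1%:R) * outside a b r x by rewrite ler_wpM2r.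
rewrite -/B.
rewrite [leRHS](_ : _ = (D * th ^+ n - D * th ^+ n.+1) +
  (E / n%:R * (x * outside a b r u + (1 - x) * outside a b r v) -
   E / n.+1%:R * outside a b r x)); last by ring.
apply: lerD => //; apply: le_trans H4 _.
by rewrite mulrBl lerD2r.
Qed.

Let ab01 : 0 < a /\ b < 1 /\ 0 < b /\ a < 1.
Proof.
have Ja : J a by rewrite /J /=; apply/andP; split; move: ab r0; lra.
have Jb : J b by rewrite /J /=; apply/andP; split; move: ab r0; lra.
by have /andP[? ?] := J01 Ja; have /andP[? ?] := J01 Jb.
Qed.

Let outside_le n k : (0 < n)%N -> (k <= n)%N -> outside a b r (k%:R / n%:R) <= 2.
Proof.
move=> n0 kn; have [a0 [b1 [b0 a1]]] := ab01.
apply: outside_le2 => //; try exact: ltW.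
by rewrite divr_ge0 //= ler_pdivrMr ?ltr0n // mul1r ler_nat.
Qed.

Let margin_ge0 n k : 0 <= margin n k.
Proof.
apply: addr_ge0; first exact: mulr_ge0.
by apply: mulr_ge0; [exact: divr_ge0|exact: outside_ge0].
Qed.

Let far_close (p d : R) n k : (0 < n)%N -> ~~ far p d n k -> `|k%:R / n%:R - p| < d.
Proof.
move=> n0; rewrite /far -ltNge => H.
have nR : 0 < n%:R :> R by rewrite ltr0n.
rewrite -(ltr_pM2r nR) -[X in `|_| * X](gtr0_norm nR) -normrM mulrBl.
by rewrite mulfVK // gt_eqF.
Qed.

Let margin_le p n k : a <= p <= b -> (0 < n)%N -> (k <= n)%N ->
  margin n k <= D * th ^+ n + 2 * E * (far p (r / 16) n k)%:R.
Proof.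
move=> pI n0 kn; rewrite /margin lerD2l.
have nR : 1 <= n%:R :> R by rewrite ler1n.
case F : (far p (r / 16) n k); last first.
  rewrite (outside_in pI) ?mulr0 // ?mulr0n ?mulr0 //.
  by apply: far_close => //; rewrite F.
rewrite mulr1 mulrC [2 * E]mulrC mulrC; apply: ler_pM; rewrite ?divr_ge0 ?outside_ge0 //.
  by rewrite ler_pdivrMr ?ler_peMr // ltr0n.
exact: outside_le.
Qed.

Let margin_bern p : a <= p <= b -> exists C rho : R, [/\ 0 <= C, 0 < rho < 1 &
  forall n, (0 < n)%N -> bern n p (margin n) <= C * rho ^+ n].
Proof.
move=> pI; have [a0 [b1 [b0 a1]]] := ab01.
have p01 : 0 <= p <= 1 by case/andP: pI => ? ?; apply/andP; split; lra.
have r16 : 0 < r / 16 by rewrite divr_gt0.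
have [rho /andP[rho0 rho1] Hrho] := bern_tail p01 r16.
pose nu := Num.max th rho.
case/andP: th01 => t0 t1.
exists (D + 2 * E * 2), nu; split.
- by apply: addr_ge0 => //; apply: mulr_ge0 => //; exact: mulr_ge0.
- by rewrite /nu lt_max t0 gt_max t1.
move=> n n0.
apply: (@le_trans _ _ (bern n p (fun k => D * th ^+ n + 2 * E * (far p (r / 16) n k)%:R))).
  by apply: bern_le => // k kn; exact: margin_le.
rewrite bernD bern_cst bernZ [leRHS]mulrDl; apply: lerD.
  by rewrite ler_wpM2l //; apply: lerXn2r; rewrite ?nnegrE ?le_max ?(ltW t0) ?lexx.
have E2 : 0 <= 2 * E by exact: mulr_ge0.
rewrite -[leRHS]mulrA ler_wpM2l //; apply: le_trans (Hrho n) _.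
rewrite ler_wpM2l //; apply: lerXn2r; rewrite ?nnegrE ?le_max ?(ltW t0) ?(ltW rho0) ?lexx //.
by rewrite orbT.
Qed.

Let margin_small : exists n0, forall n k, (n0 <= n)%N -> (k <= n)%N ->
  margin n k <= eps / 2.
Proof.
have : (fun n => D * th ^+ n) @ \oo --> D * 0.
  by case/andP: th01 => t0 t1; apply: cvgMl_tmp; apply: cvg_expr; rewrite gtr0_norm.
rewrite mulr0 => /cvgrPdist_lt/(_ (eps / 4))[|N1 _ HN1]; first by rewrite divr_gt0.
exists (maxn N1 (Num.truncn (8 * E / eps)).+1) => n k.
rewrite geq_max => /andP[n1 n2] kn.
have n0 : (0 < n)%N by apply: leq_trans n2.
have nR : 0 < n%:R :> R by rewrite ltr0n.
have h1 := HN1 n n1; rewrite /= sub0r normrN in h1.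
have h2 : 8 * E / eps <= n%:R.
  by move: n2; rewrite -(ler_nat R) => /(lt_le_trans (truncnS_gt _))/ltW.
have h3 : E / n%:R * outside a b r (k%:R / n%:R) <= E / n%:R * 2.
  by rewrite ler_wpM2l ?divr_ge0 ?(ltW nR) // outside_le.
have h4 : E / n%:R * 2 <= eps / 4.
  rewrite mulrAC ler_pdivrMr //; move: h2; rewrite ler_pdivrMr // mulrC; lra.
have := ler_norm (D * th ^+ n).
by rewrite /margin; move: h1 h3 h4; lra.
Qed.

(** Close to p the blended value is within O(1/n) + O(|k/n - p|) of f p, and k / n
    is close to p outside of an event of small probability. *)
Let blended_cvg p : a <= p <= b -> (fun n => bern n p (blended n)) @ \oo --> f p.
Proof.
move=> pI; have [a0 [b1 [b0 a1]]] := ab01.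
have p01 : 0 <= p <= 1 by case/andP: pI => ? ?; apply/andP; split; lra.
have Jp : J p by case/andP: pI => ? ?; rewrite /J /=; apply/andP; split; move: r0; lra.
apply/cvgrPdist_lt => e e0.
pose L := 2 * K * M + 1.
have L0 : 0 < L by rewrite /L ltr_wpDl // !mulr_ge0.
pose d := Num.min (r / 16) (Num.min s (e / 4 / L)).
have d0 : 0 < d by rewrite !lt_min s0 !divr_gt0.
have [rho /andP[rho0 rho1] Hrho] := bern_tail p01 d0.
have [N1 HN1] := large_near.
have close n k : large n -> (k <= n)%N ->
    `|f p - blended n k| <= e / 4 + Capx / n%:R + (far p d n k)%:R.
  move=> Ln kn; have n0 := large_gt0 Ln.
  have nR : 0 < n%:R :> R by rewrite ltr0n.
  have F1 : 0 <= e / 4 + Capx / n%:R.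
    by apply: addr_ge0; [rewrite divr_ge0 // ltW|exact: divr_ge0].
  case F : (far p d n k).
    apply: (@le_trans _ _ 1); last by rewrite lerDr.
    have := blended_itv k Ln; have := co_itv Jp; rewrite (co_f pI).
    move: (blended n k) => z /andP[? ?] /andP[? ?]; move: eps0.
    by rewrite ler_norml => ?; apply/andP; split; lra.
  rewrite addr0; have := far_close n0 (negbT F).
  set x := k%:R / n%:R => xp.
  have xr : `|x - p| < r / 16 by apply: lt_le_trans xp _; rewrite /d ge_min lexx.
  have xs : `|x - p| <= s.
    by apply: ltW; apply: lt_le_trans xp _; rewrite /d !ge_min lexx orbT.
  have xe : `|x - p| <= e / 4 / L.
    by apply: ltW; apply: lt_le_trans xp _; rewrite /d !ge_min lexx !orbT.
  have [x1 x2] : a - r / 4 <= x <= b + r / 4 /\ J x.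
    move: xr; rewrite ltr_norml => /andP[? ?]; case/andP: pI => ? ?.
    by rewrite /J /=; split; apply/andP; split; move: r0; lra.
  rewrite /blended -/x cutoff_in // mulr1.
  rewrite [1 / 2 + _]addrC subrK.
  have H1 := c_approx Ln x2.
  have H2 := lipschitz_center K0 M0 Ms co_bound co_shift Jp x2 xs.
  rewrite (co_f pI) in H2.
  have H3 : 2 * K * M * `|x - p| <= e / 4.
    apply: (@le_trans _ _ (L * `|x - p|)); first by rewrite ler_wpM2r // /L lerDl.
    by rewrite mulrC -ler_pdivlMr.
  rewrite -/x in H1; move: (co x 0) H1 H2 => y H1 H2.
  have -> : f p - c n k = - ((y - f p) + (c n k - y)) by ring.
  rewrite normrN (le_trans (ler_normD _ _)) // lerD //.
  exact: le_trans H2 H3.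
have e4 : 0 < e / 4 by rewrite divr_gt0.
have : (fun n => 2 * rho ^+ n) @ \oo --> (2 * 0 : R).
  by apply: cvgMl_tmp; apply: cvg_expr; rewrite gtr0_norm.
rewrite mulr0 => /cvgrPdist_lt/(_ _ e4)[N2 _ HN2].
exists (maxn N1 (maxn N2 (Num.truncn (4 * Capx / e)).+1)) => // n /=.
rewrite !geq_max => /and3P[n1 n2 n3].
have Ln := HN1 n n1; have n0 := large_gt0 Ln.
have nR : 0 < n%:R :> R by rewrite ltr0n.
have h2 := HN2 n n2; rewrite /= sub0r normrN in h2.
have h3 : Capx / n%:R <= e / 4.
  have : 4 * Capx / e <= n%:R.
    by move: n3; rewrite -(ler_nat R) => /(lt_le_trans (truncnS_gt _))/ltW.
  by rewrite ler_pdivrMr // ler_pdivrMr // => h; lra.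
have -> : f p - bern n p (blended n) = bern n p (fun k => f p - blended n k).
  by rewrite bernB bern_cst.
have := ler_norm_bern p01 (fun k kn => close n k Ln kn).
rewrite (bernD n p (fun=> e / 4 + Capx / n%:R)) bern_cst => /le_lt_trans; apply.
have := Hrho n; have := ler_norm (2 * rho ^+ n); move: h2 h3.
move: (bern _ _ _) => z; lra.
Qed.

Lemma blended_fast_simulation : fast_simulation `[a, b] f.
Proof.
have [N1 HN1] := large_near; have [N2 HN2] := margin_small.
pose n0 := maxn N1 N2.
have n0L n : (n0 <= n)%N -> large n.
  by rewrite /n0 geq_max => /andP[/HN1].
have n0S n k : (n0 <= n)%N -> (k <= n)%N -> margin n k <= eps / 2.
  by rewrite /n0 geq_max => /andP[_ /HN2]; apply.
have [a0 [b1 [b0 a1]]] := ab01.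
apply: (@bernstein_envelope_fast_simulation _ _ _ n0
  (fun n k => blended n k - margin n k) (fun n k => blended n k + margin n k)).
- move=> p /=; rewrite in_itv /= => /andP[? ?]; apply/andP; split; lra.
- exact: large_gt0 (n0L n0 (leqnn _)).
- move=> n k nn kn.
  have /andP[h1 h2] := blended_itv k (n0L n nn).
  have h3 := n0S n k nn kn; have h4 := margin_ge0 n k.
  move: (blended n k) (margin n k) h1 h2 h3 h4 => z w *.
  by split; [lra|apply/andP; split; lra].
- move=> n k nn kn; rewrite avgB.
  have := margin_avg (n0L n nn) kn.
  move: (avg blended n k) (avg margin n k) => z w; rewrite ler_norml => /andP[? ?]; lra.
- move=> n k nn kn; rewrite avgD.
  have := margin_avg (n0L n nn) kn.
  move: (avg blended n k) (avg margin n k) => z w; rewrite ler_norml => /andP[? ?]; lra.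
- move=> p /=; rewrite in_itv /= => pI.
  have [C [rho [C0 rho01 H]]] := margin_bern pI.
  exists (2 * C), rho; split=> // n nn.
  have -> : (fun k => blended n k + margin n k - (blended n k - margin n k)) =
      (fun k => 2 * margin n k) by apply/funext => k; ring.
  rewrite bernZ -mulrA ler_wpM2l // H //.
  exact: large_gt0 (n0L n nn).
move=> p /=; rewrite in_itv /= => pI.
have [C [rho [C0 /andP[rho0 rho1] H]]] := margin_bern pI.
have p01 : 0 <= p <= 1 by case/andP: pI => ? ?; apply/andP; split; lra.
have M0' : (fun n => bern n p (margin n)) @ \oo --> 0.
  have : (fun n => C * rho ^+ n) @ \oo --> C * 0.
    by apply: cvgMl_tmp; apply: cvg_expr; rewrite gtr0_norm.
  rewrite mulr0 => /cvgrPdist_lt Hc; apply/cvgrPdist_lt => e e0.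
  have [N3 _ HN3] := Hc e e0.
  exists (maxn 1 N3) => // n /=; rewrite geq_max => /andP[n1 n3].
  have := HN3 n n3; rewrite /= !sub0r !normrN; apply: le_lt_trans.
  rewrite ger0_norm; first by apply: le_trans (H n n1) _; exact: ler_norm.
  have -> : 0 = bern n p (fun=> 0) by rewrite bern_cst.
  by apply: bern_le.
rewrite -[f p]subr0.
have -> : (fun n => bern n p (fun k => blended n k - margin n k)) =
    (fun n => bern n p (blended n) - bern n p (margin n)).
  by apply/funext => n; rewrite bernB.
by apply: cvgB M0'; exact: blended_cvg.
Qed.

End envelope.

Theorem coherent_expansions_fast_simulation : fast_simulation `[a, b] f.
Proof.
have [th th01 Hth] := half_power_le qs.
exact: blended_fast_simulation th01 Hth.
Qed.

End assembly.

(** The radius r is shrunk so that the window stays inside ]0, 1[, then s and q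
    are chosen from the radius of convergence 1 / N. *)
Theorem real_analytic_fast_simulation (R : realType) (a b : R) (f : R -> R) :
  0 < a -> a <= b -> b < 1 -> (forall p, a <= p <= b -> 0 < f p < 1) ->
  real_analytic_on `[a, b] f -> fast_simulation `[a, b] f.
Proof.
move=> a0 ab b1 f01 anf.
have [n [co [co_bound co_shift co_itv co_f]]] := coherent_expansions ab f01 anf.
set N : R := n.+1%:R in co_bound co_shift co_itv co_f.
have N1 : 1 <= N by rewrite /N ler1n.
have N0 : 0 < N by exact: lt_le_trans N1.
have Ni : 0 < N^-1 by rewrite invr_gt0.
pose r := Num.min N^-1 (Num.min (a / 2) ((1 - b) / 2)).
have r0 : 0 < r by rewrite !lt_min Ni !divr_gt0 // subr_gt0.
have rN : r <= N^-1 by rewrite ge_min lexx.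
have ra : r <= a / 2 by rewrite !ge_min lexx orbT.
have rb : r <= (1 - b) / 2 by rewrite !ge_min lexx !orbT.
clearbody r.
pose s := N^-1 / 8.
have s0 : 0 < s by rewrite divr_gt0.
have Ni1 : N^-1 <= 1 by rewrite invf_le1.
have s1 : s <= 1 by rewrite /s; move: (N^-1) Ni Ni1 => z *; lra.
have Ns : N * s = 1 / 8 by rewrite /s; field; rewrite gt_eqF.
pose q := (Num.truncn (16 / s ^+ 2)).+1.
have qs : 16 <= q%:R * s ^+ 2.
  by rewrite -ler_pdivrMr ?exprn_gt0 //; apply: ltW; exact: truncnS_gt.
have sub y (H : a - r <= y <= b + r) : a - N^-1 <= y <= b + N^-1.
  move: (N^-1) rN => z *.
  by case/andP: H => ? ?; apply/andP; split; lra.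
apply: (@coherent_expansions_fast_simulation R a b r N^-1 f co N N s q) => //.
- by move=> y /= /andP[? ?]; apply/andP; split; lra.
- by rewrite Ns.
- by move=> y j Jy; apply: co_bound; exact: sub.
- move=> x y i Jx Jy yx; apply: co_shift; [exact: sub|exact: sub|].
  apply: (@le_trans _ _ (s * N)); first by rewrite ler_wpM2r // ltW.
  by rewrite mulrC Ns; lra.
- by move=> y Jy; apply: co_itv; exact: sub.
Qed.

Theorem theorem2 (R : realType) :
  (forall (a b : R) (f : R -> R),
     0 < a -> a <= b -> b < 1 ->
     (forall p : R, a <= p <= b -> 0 < f p < 1) ->
     real_analytic_on `[a, b] f ->
     fast_simulation `[a, b] f) /\
  (forall (S : set R) (f : R -> R),
     S `<=` `]0, 1[ ->
     (forall p : R, S p -> 0 <= f p <= 1) ->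
     fast_simulation S f ->
     forall U : set R, open U -> U `<=` S -> real_analytic_on U f).
Proof.
split=> [a b f|S f S01 _ fastf U _ US]; first exact: real_analytic_fast_simulation.
have [D [g [oD SD anD gf]]] := fast_simulation_real_analytic S01 fastf.
by exists D, g; split=> // x /US; [exact: SD|exact: gf].
Qed.
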